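(* Let $\varphi$ be the random dynamical system associated to the SDE with degenerate additive noise $$dX_t=\bigl(X_t-|(X_t,Y_t)|^2X_t\bigr)\,dt+\sigma\,dW_t\ \text{ on }\mathbb{R}^n,\qquad dY_t=\bigl(Y_t-|(X_t,Y_t)|^2Y_t\bigr)\,dt\ \text{ on }\mathbb{R}^{d-n},$$ where $\sigma>0$ and $d,n\in\mathbb{N}$ with $n<d$. If the top Lyapunov exponent $\lambda_{top}$ of $\varphi$ is positive, then there is no synchronization of $\varphi$, not even weak synchronization; that is, there is neither a weak attractor nor a weak point attractor $A$ of $\varphi$ such that $A(\omega)$ is a singleton for $\mathbb{P}$-almost every $\omega\in\Omega$. In particular, this is the case for $n=1$ with $\sigma\le\frac12$.
   Context: Setting. $\mathbb{N}$ denotes the positive integers, $|\cdot|$ the Euclidean norm, and $b:\mathbb{R}^d\to\mathbb{R}^d$, $b(x)=(1-|x|^2)x$. Let $\Omega=\{\omega\in C(\mathbb{R},\mathbb{R}^n):\omega(0)=0\}$ with Borel $\sigma$-algebra $\mathcal{F}$, two-sided Wiener measure $\mathbb{P}$, $W_t(\omega)=\omega(t)$, and shifts $(\theta_t\omega)(s)=\omega(s+t)-\omega(t)$, $s,t\in\mathbb{R}$. For $t\ge 0$, $\omega\in\Omega$, $x\in\mathbb{R}^d$, $\varphi_t(\omega,x)$ is the unique global solution of $\varphi_t(\omega,x)=x+\int_0^t b(\varphi_s(\omega,x))\,ds+\sigma(\omega(t),0)$, with $(\omega(t),0)\in\mathbb{R}^n\times\mathbb{R}^{d-n}$. Then $\varphi$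 is a random dynamical system over $\theta$ (jointly measurable, $\varphi_0(\omega,\cdot)=\mathrm{id}$, $\varphi_{t+s}(\omega,x)=\varphi_t(\theta_s\omega,\varphi_s(\omega,x))$, continuous in $x$), called the RDS associated to the SDE. Attractors. A random compact set is a family $\{D(\omega)\}_{\omega\in\Omega}$ of non-empty subsets of $\mathbb{R}^d$ that is $\mathbb{P}$-a.s. compact and such that $\omega\mapsto\inf_{y\in D(\omega)}|x-y|$ is $\mathcal{F}$-measurable for each $x\in\mathbb{R}^d$. It is $\varphi$-invariant if for all $t\ge0$, $\varphi_t(\omega,D(\omega))=D(\theta_t\omega)$ for almost all $\omega$. A weak attractor is a $\varphi$-invariant random compact set $A$ such that for every compact $B\subset\mathbb{R}^d$, $\sup_{x\in B}\inf_{a\in A(\omega)}|\varphi_t(\theta_{-t}\omega,x)-a|\to0$ in probability as $t\to\infty$. A weak point attractor is defined in the same way with the compact sets $B$ replaced by single points. Synchronization (resp. weak synchronization) means that there is a weak attractor (resp. weak point attractor) which is $\mathbb{P}$-a.s. a singleton. Top Lyapunov exponent. Let $\rho$ be the probability measure on $\mathbb{R}^d=\mathbb{R}^n\times\mathbb{R}^{d-n}$ given by $\rho(A\times\{0\})=\frac1{Z_\sigma}\int_A e^{\frac{2}{\sigma^2}(\frac12|x|^2-\frac14|x|^4)}dx$ for Borel $A\subset\mathbb{R}^n$ and $\rho(\mathbb{R}^n\times(\mathbb{R}^{d-n}\setminus\{0\}))=0$, where $Z_\sigma=\int_{\mathbb{R}^n} e^{\frac{2}{\sigma^2}(\frac12|x|^2-\frac14|x|^4)}dx$;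 it is an invariant measure of the Markov semigroup $P_tf(x)=\mathbb{E}[f(\varphi_t(\cdot,x))]$. The Lyapunov exponents (with respect to $\rho$) are the constants $\lambda_N<\dots<\lambda_1$ provided by the multiplicative ergodic theorem, i.e. the values taken by $\lim_{m\to\infty}\frac1m\log|D\varphi_m(\omega,x)v|$, $v\in\mathbb{R}^d\setminus\{0\}$, for $\mathbb{P}\otimes\rho$-almost all $(\omega,x)$, where $D\varphi_m(\omega,x)$ is the derivative of $y\mapsto\varphi_m(\omega,y)$ at $x$. The top Lyapunov exponent is $\lambda_{top}:=\lambda_1$. *)

(* Defs.v *)
From HB Require Import structures.
From mathcomp Require Import all_boot all_order all_algebra.
From mathcomp Require Import all_classical all_reals all_analysis.
From mathcomp Require Import ring lra.

Set Implicit Arguments.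
Unset Strict Implicit.
Unset Printing Implicit Defensive.

Import Order.TTheory GRing.Theory Num.Theory.
Import numFieldNormedType.Exports.

Local Open Scope classical_set_scope.
Local Open Scope ring_scope.

Notation borel T := (g_sigma_algebraType (@open T)).

Section lebesgue_rV.
Context {R : realType}.

Section cons.
Variable n : nat.

Definition cons_rV (p : R * 'rV[R]_n) : 'rV[R]_n.+1 := row_mx p.1%:M p.2.

Definition uncons_rV (v : 'rV[R]_n.+1) : R * 'rV[R]_n :=
  (v 0 0, rsubmx (v : 'rV_(1 + n))).

Lemma uncons_rVK : cancel uncons_rV cons_rV.
Proof.
move=> v; rewrite /cons_rV /uncons_rV /=.
apply/matrixP => i j; rewrite ord1.
case: (@split_ordP 1 n j) => k ->.
- by rewrite (@row_mxEl R 1 1 n) ord1 mxE eqxx mulr1n; congr (v _ _); exact/val_inj.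
- by rewrite (@row_mxEr R 1 1 n) mxE; congr (v _ _); exact/val_inj.
Qed.

Lemma cons_rVK : cancel cons_rV uncons_rV.
Proof.
move=> [x y]; rewrite /cons_rV /uncons_rV /=; congr pair; last first.
  exact: (@row_mxKr R 1 1 n).
rewrite (_ : (0 : 'I_n.+1) = @lshift 1 n 0); last exact/val_inj.
by rewrite (@row_mxEl R 1 1 n) mxE eqxx mulr1n.
Qed.

Lemma mx_continuous (S : topologicalType) k l (f : S -> 'M[R]_(k, l)) :
  (forall i j, continuous (fun x => f x i j)) -> continuous f.
Proof.
move=> cf x A [Q nQ sub]; apply: (filterS sub).
by do 2![apply: filter_forall => ?]; exact: cf.
Qed.

Lemma cons_rV_continuous : continuous cons_rV.
Proof.
apply: mx_continuous => i j; rewrite ord1 /cons_rV.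
case: (@split_ordP 1 n j) => k ->.
- rewrite (_ : (fun _ => _) = fst); first by move=> x; exact: cvg_fst.
  by apply/funext => p; rewrite (@row_mxEl R 1 1 n) ord1 mxE eqxx mulr1n.
- rewrite (_ : (fun _ => _) = (fun v : 'rV[R]_n => v 0 k) \o snd).
    by move=> x; apply: continuous_comp; [exact: cvg_snd|exact: coord_continuous].
  by apply/funext => p; rewrite (@row_mxEr R 1 1 n).
Qed.

Lemma measurable_cons_rV :
  measurable_fun [set: R * borel 'rV[R]_n]
    (cons_rV : R * borel 'rV[R]_n -> borel 'rV[R]_n.+1).
Proof.
apply: (@measurability _ _ _ (borel 'rV[R]_n.+1) _ _ (@open 'rV[R]_n.+1)) => //.
move=> _ [U oU <-]; rewrite setTI.
pose V := cons_rV @^-1` U.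
have oV : open V by move/continuousP : cons_rV_continuous; exact.
pose W (qk : rat * nat) := \bigcup_(O in [set O : set 'rV[R]_n | open O /\
   ball (ratr qk.1 : R) qk.2.+1%:R^-1 `*` O `<=` V]) O.
have oW qk : open (W qk) by apply: bigcup_open => O [].
suff VE : V = \bigcup_(qk : rat * nat)
    (ball (ratr qk.1 : R) qk.2.+1%:R^-1 `*` W qk).
  change (measurable (V : set (R * borel 'rV[R]_n))); rewrite VE.
  apply: countable_bigcupT_measurable => // -[q k]; apply: measurableX.
    by apply: measurable_realfun.open_measurable; apply: ball_open.
  exact: sub_sigma_algebra.
apply/seteqP; split => [[x y] Vxy|[x y] [[q k] _ [xq [Q [oQ sQ] Qy]]]]; last first.
  by apply: sQ; split.
have : nbhs (x, y) V by exact: open_nbhs_nbhs.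
case=> -[A B] [/nbhs_ballP[e /= e0 eA]].
rewrite nbhsE => -[Q [oQ Qy] QB] sAB.
have [k k0] : exists k : nat, k.+1%:R^-1 < e / 2.
  exists (Num.truncn (e / 2)^-1).
  by rewrite invf_plt ?posrE ?divr_gt0// truncnS_gt.
have kp : (0 : R) < k.+1%:R^-1 by rewrite invr_gt0.
have [q] := @rat_in_itvoo R (x - k.+1%:R^-1) (x + k.+1%:R^-1) ltac:(by rewrite ltrBlDr -addrA ltrDl addr_gt0).
rewrite in_itv /= => /andP[q1 q2].
have xq : ball (ratr q : R) k.+1%:R^-1 x.
  by rewrite /ball /= ltr_distl q1 q2.
exists (q, k) => //; split => //=; exists Q => //; split => // -[u v] [uq Qv].
apply: sAB; split => /=; last exact: QB.
apply: eA; apply: (@ball_split _ _ (ratr q : R)).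
  by apply: ball_sym; apply: le_ball xq; exact: ltW.
by apply: le_ball uq; exact: ltW.
Qed.

Lemma measurable_coord m (i : 'I_m) :
  measurable_fun [set: borel 'rV[R]_m] ((fun x => x 0 i) : borel 'rV[R]_m -> R).
Proof.
apply: (measurability _ (measurable_realfun.RGenOpens.measurableE R)).
move=> _ [_ [a [b ->]] <-]; rewrite setTI; apply: sub_sigma_algebra.
move/continuousP : (@coord_continuous R 1 m 0 i); apply.
exact: interval_open.
Qed.

Lemma measurable_uncons_rV :
  measurable_fun [set: borel 'rV[R]_n.+1]
    (uncons_rV : borel 'rV[R]_n.+1 -> R * borel 'rV[R]_n).
Proof.
apply/measurable_fun_pairP; split; first exact: measurable_coord.
- apply: (@measurability _ _ _ (borel 'rV[R]_n) _ _ (@open 'rV[R]_n)) => //.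
  move=> _ [U oU <-]; rewrite setTI; apply: sub_sigma_algebra.
  have : continuous (fun v : 'rV[R]_n.+1 => rsubmx (v : 'rV_(1 + n))).
    apply: mx_continuous => i j; under eq_fun do rewrite mxE.
    exact: coord_continuous.
  by move/continuousP; exact.
Qed.

Section step.
Variable mu : {sigma_finite_measure set (borel 'rV[R]_n) -> \bar R}.

Definition lebesgue_rV_succ : set (borel 'rV[R]_n.+1) -> \bar R :=
  pushforward (@lebesgue_measure R \x mu)%E
    (cons_rV : R * borel 'rV[R]_n -> borel 'rV[R]_n.+1).

Let succ0 : lebesgue_rV_succ set0 = 0%E.
Proof. by rewrite /lebesgue_rV_succ /pushforward preimage_set0 measure0. Qed.

Let succ_ge0 A : (0 <= lebesgue_rV_succ A)%E.
Proof. by rewrite /lebesgue_rV_succ /pushforward; exact: measure_ge0. Qed.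

Let succ_sigma_additive : semi_sigma_additive lebesgue_rV_succ.
Proof.
have mp (A : set (borel 'rV[R]_n.+1)) : measurable A -> measurable
    ((cons_rV : R * borel 'rV[R]_n -> borel 'rV[R]_n.+1) @^-1` A).
  by move=> mA; rewrite -[X in measurable X]setTI; exact: measurable_cons_rV.
move=> F mF tF mUF; rewrite /lebesgue_rV_succ /pushforward preimage_bigcup.
apply: measure_semi_sigma_additive.
- by move=> k; exact: mp.
- apply/trivIsetP => /= i j _ _ ij; rewrite -preimage_setI.
  by move/trivIsetP : tF => /(_ _ _ _ _ ij) ->//; rewrite preimage_set0.
- by rewrite -preimage_bigcup; exact: mp.
Qed.

HB.instance Definition _ := isMeasure.Build _ _ _ lebesgue_rV_succ
  succ0 succ_ge0 succ_sigma_additive.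

Let succ_sigma_finite : sigma_finite setT lebesgue_rV_succ.
Proof.
have /sigma_finiteP[F [TF ndF Foo]] := sigma_finiteT (@lebesgue_measure R).
have /sigma_finiteP[G [TG ndG Goo]] := sigma_finiteT mu.
exists (fun k => (uncons_rV : borel 'rV[R]_n.+1 -> R * borel 'rV[R]_n)
    @^-1` (F k `*` G k)).
  apply/seteqP; split => // v _.
  have [[i _ Fi] [j _ Gj]] : (\bigcup_k F k) (uncons_rV v).1 /\
    (\bigcup_k G k) (uncons_rV v).2 by rewrite -TF -TG.
  exists (maxn i j) => //; split.
  - by move: Fi; apply: subsetPset; apply: ndF; exact: leq_maxl.
  - by move: Gj; apply: subsetPset; apply: ndG; exact: leq_maxr.
move=> k; have [mF Fk] := Foo k; have [mG Gk] := Goo k; split.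
  rewrite -[X in measurable X]setTI; apply: measurable_uncons_rV => //.
  exact: measurableX.
rewrite /lebesgue_rV_succ /pushforward -comp_preimage.
rewrite (_ : _ @^-1` _ = F k `*` G k).
  by rewrite product_measure1E// lte_mul_pinfty// ge0_fin_numE.
by apply/seteqP; split => p; rewrite /preimage /mkset /comp cons_rVK.
Qed.

HB.instance Definition _ := @Measure_isSigmaFinite.Build _ _ _
  lebesgue_rV_succ succ_sigma_finite.

End step.
End cons.

(* Lebesgue measure on R^n: the n-fold product of [lebesgue_measure],
   transported to row vectors. *)
Fixpoint lebesgue_rV n : {sigma_finite_measure set (borel 'rV[R]_n) -> \bar R} :=
  match n with
  | 0 => \d_(0 : borel 'rV[R]_0)
  | n'.+1 => lebesgue_rV_succ (lebesgue_rV n')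
  end.

Lemma lebesgue_rV_box n (A : 'I_n -> set R) :
  (forall i, measurable (A i)) ->
  lebesgue_rV n [set x : 'rV[R]_n | forall i, A i (x 0 i)] =
  (\prod_(i < n) lebesgue_measure (A i))%E.
Proof.
elim: n A => [|n IH] A mA.
  rewrite big_ord0 /= diracE (_ : _ \in _ = true)//.
  by apply/mem_set => -[].
rewrite big_ord_recl -IH; last by move=> i; exact: mA.
have mB : measurable
    ([set x : 'rV[R]_n | forall i, A (lift ord0 i) (x 0 i)] : set (borel 'rV[R]_n)).
  rewrite (_ : mkset _ = \bigcap_(i in [set: 'I_n])
      ((fun x : 'rV[R]_n => x 0 i) @^-1` A (lift ord0 i))); last first.
    by apply/seteqP; split => [x Ax i _|x Ax i]; [exact: Ax|exact: (Ax i I)].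
  apply: fin_bigcap_measurable => [|i _]; first exact: finite_finset.
  by rewrite -[X in measurable X]setTI; exact: measurable_coord.
rewrite -product_measure1E//=; last exact: (mA ord0).
rewrite /lebesgue_rV_succ /pushforward.
rewrite (_ : _ @^-1` _ = A ord0 `*`
  [set x : 'rV[R]_n | forall i, A (lift ord0 i) (x 0 i)])//.
have cons0 p : cons_rV p 0 ord0 = p.1 :> R by rewrite -[in RHS](cons_rVK p).
have consS (p : R * 'rV[R]_n) (i : 'I_n) : cons_rV p 0 (lift ord0 i) = p.2 0 i :> R.
  rewrite (_ : lift ord0 i = @rshift 1 n i); last exact/val_inj.
  by rewrite /cons_rV (@row_mxEr R 1 1 n).
apply/seteqP; split => [p Ap|p [Ap0 ApS] i].
  by split => [|i]; rewrite ?(cons0 p)// -?cons0 -?consS; exact: Ap.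
by case: (unliftP ord0 i) => [j|] ->; rewrite ?consS ?cons0//; exact: ApS.
Qed.

End lebesgue_rV.

Record wiener_space (R : realType) (n : nat) := WienerSpace {
  path_of :> R -> 'rV[R]_n;
  path_continuous : continuous path_of;
  path0 : path_of 0 = 0 }.

Section wiener_space.
Context {R : realType} {n : nat}.
Local Notation Omega := (wiener_space R n).

HB.instance Definition _ := gen_eqMixin Omega.
HB.instance Definition _ := gen_choiceMixin Omega.

Lemma zero_path_continuous : continuous (fun _ : R => 0 : 'rV[R]_n).
Proof. by move=> t; exact: cvg_cst. Qed.

HB.instance Definition _ := isPointed.Build Omega
  (WienerSpace zero_path_continuous erefl).

(* On continuous paths the compact-open topology is the topology of uniform
   convergence on compact sets. *)
HB.instance Definition _ := Topological.copy Omega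
  (initial_topology (@path_of R n : Omega -> {compact-open, R -> 'rV[R]_n})).

Lemma theta_continuous (t : R) (w : Omega) :
  continuous (fun s => w (s + t) - w t).
Proof.
move=> s; apply: cvgB; last exact: cvg_cst.
apply: (@continuous_comp _ _ _ (fun s => s + t) w); last exact: path_continuous.
by apply: cvgD; [exact: cvg_id|exact: cvg_cst].
Qed.

Lemma theta0 (t : R) (w : Omega) : w (0 + t) - w t = 0.
Proof. by rewrite add0r subrr. Qed.

Definition theta (t : R) (w : Omega) : Omega :=
  WienerSpace (@theta_continuous t w) (theta0 t w).

(* Two-sided Wiener measure: over any times t_0 < ... < t_k, negative or not,
   the coordinates of the increments W_{t_{j+1}} - W_{t_j} are independent,
   centered Gaussian with variance t_{j+1} - t_j. *)
Definition is_wiener_measure (P : probability (borel Omega) R) : Prop :=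
  forall (k : nat) (t : nat -> R) (B : 'I_k -> 'I_n -> set R),
    (forall j, t j < t j.+1) ->
    (forall j i, measurable (B j i)) ->
    P [set w : Omega | forall j i, B j i (w (t j.+1) 0 i - w (t j) 0 i)] =
    (\prod_(j < k) \prod_(i < n)
       normal_prob 0 (Num.sqrt (t j.+1 - t j)) (B j i))%E.

End wiener_space.

Section rds.
Context {R : realType} {d n : nat}.
Local Notation Omega := (wiener_space R n).
Implicit Types (P : probability (borel Omega) R) (rho : probability (borel 'rV[R]_d) R).
Implicit Types (phi : R -> Omega -> 'rV[R]_d -> 'rV[R]_d).

(* The norm of the library on ['rV[R]_m] is the sup norm; it induces the same
   topology as the Euclidean norm. *)
Definition enorm m (x : 'rV[R]_m) : R := Num.sqrt (\sum_i x 0 i ^+ 2).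

Definition drift (x : 'rV[R]_d) : 'rV[R]_d := (1 - enorm x ^+ 2) *: x.

(* [pad x] is (x, 0) in R^n x R^(d-n). *)
Definition pad (x : 'rV[R]_n) : 'rV[R]_d :=
  \row_(i < d) if insub (i : nat) is Some j then x 0 j else 0.

Definition is_sde_rds (sigma : R) phi : Prop :=
  forall (w : Omega) (x : 'rV[R]_d),
    {within `[0, +oo[, continuous (fun t => phi t w x)} /\
    forall t, 0 <= t ->
      phi t w x = x
        + \row_i (\int[lebesgue_measure]_(s in `[0, t]) drift (phi s w x) 0 i)
        + sigma *: pad (w t).

Definition dist_to (x : 'rV[R]_d) (D : set 'rV[R]_d) : R :=
  inf [set enorm (x - y) | y in D].

Definition random_compact_set P (D : Omega -> set 'rV[R]_d) : Prop :=
  [/\ forall w, D w !=set0,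
      {ae P, forall w, compact (D w)} &
      forall x, measurable_fun [set: borel Omega]
        ((fun w => dist_to x (D w)) : borel Omega -> R)].

Definition phi_invariant P phi (D : Omega -> set 'rV[R]_d) : Prop :=
  forall t, 0 <= t -> {ae P, forall w, phi t w @` D w = D (theta t w)}.

Definition cvg_in_probability0 P (X : R -> Omega -> R) : Prop :=
  forall eps : R, 0 < eps ->
    P [set w : Omega | eps < `|X t w|] @[t --> +oo] --> (0 : \bar R)%E.

Definition weak_attractor P phi (A : Omega -> set 'rV[R]_d) : Prop :=
  [/\ random_compact_set P A, phi_invariant P phi A &
      forall B : set 'rV[R]_d, compact B ->
        cvg_in_probability0 P (fun t w =>
          sup [set dist_to (phi t (theta (- t) w) x) (A w) | x in B])].

Definition weak_point_attractor P phi (A : Omega -> set 'rV[R]_d) : Prop :=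
  [/\ random_compact_set P A, phi_invariant P phi A &
      forall x : 'rV[R]_d,
        cvg_in_probability0 P (fun t w =>
          dist_to (phi t (theta (- t) w) x) (A w))].

Definition as_singleton P (A : Omega -> set 'rV[R]_d) : Prop :=
  {ae P, forall w, exists a, A w = [set a]}.

Definition synchronization P phi : Prop :=
  exists A, weak_attractor P phi A /\ as_singleton P A.

Definition weak_synchronization P phi : Prop :=
  exists A, weak_point_attractor P phi A /\ as_singleton P A.

Definition gibbs (sigma : R) (x : 'rV[R]_n) : R :=
  expR (2 / sigma ^+ 2 * (enorm x ^+ 2 / 2 - enorm x ^+ 4 / 4)).

Definition partition_function (sigma : R) : R :=
  \int[lebesgue_rV n]_x gibbs sigma x.

Definition is_rho (sigma : R) rho : Prop :=
  (forall A : set (borel 'rV[R]_n), measurable A ->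
    rho (pad @` A) = ((partition_function sigma)^-1 *
      \int[lebesgue_rV n]_(x in A) gibbs sigma x)%:E) /\
  rho [set x : 'rV[R]_d | exists2 i : 'I_d, (n <= i)%N & x 0 i != 0] = 0%E.

(* [phi m w] is a diffeomorphism, so the logarithm is never taken at 0. *)
Definition lyapunov_quotient phi (w : Omega) (x v : 'rV[R]_d) (m : nat) : R :=
  m%:R^-1 * ln (enorm ('d (phi m%:R w) x v)).

Definition lyapunov_spectrum P rho phi (s : seq R) : Prop :=
  sorted >%R s /\
  {ae (P \x rho)%E, forall wx : Omega * 'rV[R]_d,
    (forall v : 'rV[R]_d, v != 0 -> exists2 l, l \in s &
      lyapunov_quotient phi wx.1 wx.2 v m @[m --> \oo] --> l) /\
    (forall l, l \in s -> exists2 v : 'rV[R]_d, v != 0 &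
      lyapunov_quotient phi wx.1 wx.2 v m @[m --> \oo] --> l)}.

Definition is_top_lyapunov_exponent P rho phi (lambda : R) : Prop :=
  exists s, lyapunov_spectrum P rho phi (lambda :: s).

End rds.

Arguments is_rho {R d} n sigma rho.

(* Main.v *)
(* The hyperplanes y_i = 0 are invariant and the flow multiplies y_i by
   exp (growth), where growth is the integral of 1 - |x_t|^2.  Let x start on
   the noise subspace and z at distance one from it, in a direction without
   noise.  Then v = |z - x|^2 stays below 4, and
     d/dt (3 growth z - growth x - ln v) + v = ((|z|^2 - |x|^2 - v)^2) / v >= 0
   together with growth z <= (ln v) / 2 gives growth x t <= ln 2 + int_0^t v.
   Under weak synchronization E v_t -> 0, because the singleton attractor
   attracts both points and the law of v_t is invariant under the shift; hence
   the mean of (growth x t) / t is asymptotically nonpositive.  On the other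
   hand |z_t - x_t| <= |z_0 - x_0| exp ((growth z + growth x) / 2), so the
   derivative of the flow is bounded by exp (growth x), and a positive top
   exponent forces growth x t >= (lambda / 2) t eventually: a contradiction.

   For n = 1 the process on the axis is dx = (x - x^3) dt + sigma dW.  A
   polynomial V whose generator is at most 1 - sigma^2 / 5 - x^2, applied along
   the Euler scheme and passed to the limit by Fatou, gives
   E int_0^t x^2 <= V(x_0) + (1 - sigma^2 / 5 + e) t: the mean growth rate is
   positive.  In a direction without noise the derivative of the flow at a point
   of the axis is exactly exp (growth x), so the top exponent is positive. *)
Require Import Defs.
From HB Require Import structures.
From mathcomp Require Import all_boot all_order all_algebra.
From mathcomp Require Import all_classical all_reals all_analysis.
From mathcomp Require Import measurable_realfun ring lra.
Import Order.TTheory GRing.Theory Num.Theory.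
Import numFieldNormedType.Exports.
Set Implicit Arguments.
Unset Strict Implicit.
Unset Printing Implicit Defensive.
Local Open Scope classical_set_scope.
Local Open Scope ring_scope.

(** * Calculus on the half-line: monotonicity from derivatives, primitives *)

Section calculus.
Context {R : realType}.
Implicit Types (f g : R -> R) (a b t : R).

(** The flow is given only by its integral equation and [P] only by the probabilities of boxes of
    increments. The explicit Euler scheme, a polynomial in finitely many increments that converges
    along every path, bridges both gaps: it makes the flow measurable, it turns the equality in law
    of increments taken from 0 and from [tau] into the shift invariance of E v_t, and it stands in
    for the Itô formula. The shift is essential because attraction concerns the pullback phi_t
    (theta_(-t) w, .), whereas the pathwise estimates run forward in time.

    The cubic drift makes an Euler step hard to control far from the origin. Hence V is truncated at
    a level K, large Gaussian jumps cost at most K, and the mesh is chosen after K.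

    The bound on sigma matters in the generator inequality, as sigma^2 / 2 <= 1/8. *)

Lemma derive_cont f t (l : R) : is_derive t 1 f l -> {for t, continuous f}.
Proof. by move=> h; apply: differentiable_continuous; apply/derivable1_diffP; apply: ex_derive. Qed.

Lemma derive_mvt f g a b : a <= b ->
  (forall t, a <= t <= b -> is_derive t 1 f (g t)) ->
  exists2 c, a <= c <= b & f b - f a = g c * (b - a).
Proof.
move=> ab df.
have [||c cab E] := @MVT_segment R f g a b ab.
- by move=> x; rewrite in_itv/= => /andP[h1 h2]; apply: df; rewrite !ltW.
- apply: continuous_in_subspaceT => x; rewrite inE/= in_itv/= => h.
  exact: (derive_cont (df _ h)).
by exists c => //; move: cab; rewrite in_itv.
Qed.

Lemma derive_ndecr f g a b : a <= b ->
  (forall t, a <= t <= b -> is_derive t 1 f (g t)) ->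
  (forall t, a <= t <= b -> 0 <= g t) -> f a <= f b.
Proof.
move=> ab df g0; have [c cab E] := derive_mvt ab df.
by rewrite -subr_ge0 E mulr_ge0 ?g0 ?subr_ge0.
Qed.

Lemma derive_const f a b : a <= b ->
  (forall t, a <= t <= b -> is_derive t 1 f 0) -> f a = f b.
Proof.
move=> ab df; have [c cab E] := @derive_mvt f (fun=> 0) a b ab df.
by apply/esym/eqP; rewrite -subr_eq0 E mul0r.
Qed.

(** The integral starts at -1, so that 0 is an interior point and the derivative there is two-sided;
    the integral over [0, t] vanishes for t < 0 and in general has a corner at 0. *)
Lemma prim_ex g : continuous g ->
  exists G : R -> R, G 0 = 0 /\ forall t, -1 < t -> is_derive t 1 G (g t).
Proof.
move=> cg.
pose F t := \int[lebesgue_measure]_(s in `[(-1), t]) g s.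
exists (fun t => F t - F 0); split; first by rewrite subrr.
move=> t t1.
have [dF F'] : derivable F t 1 /\ derive1 F t = g t.
  apply: (@continuous_FTC1_closed R g (-1) t (t + 1)) => //; first by rewrite ltrDl.
    apply: continuous_compact_integrable; first exact: segment_compact.
    by apply: continuous_subspaceT.
  exact: cg.
have h : is_derive t 1 F (g t) by rewrite derive1E in F'; exact: (DeriveDef dF F').
by apply: is_derive_eq; rewrite subr0.
Qed.

Definition prim g : R -> R :=
  if pselect (exists G : R -> R, G 0 = 0 /\ forall t, -1 < t -> is_derive t 1 G (g t))
  is left h then sval (cid h) else g.

Lemma primP g : continuous g ->
  prim g 0 = 0 /\ forall t, 0 <= t -> is_derive t 1 (prim g) (g t).
Proof.
move=> /prim_ex h; rewrite /prim; case: pselect => // {}h.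
case: cid => G /= [h1 h2]; by split=> // t t0; apply: h2; rewrite (lt_le_trans _ t0)// ltrN10.
Qed.

Lemma prim0 g : continuous g -> prim g 0 = 0. Proof. by case/primP. Qed.

Lemma is_derive_prim g t : continuous g -> 0 <= t -> is_derive t 1 (prim g) (g t).
Proof. by case/primP => _; exact. Qed.

Lemma integral_prim g t : continuous g -> 0 <= t ->
  \int[lebesgue_measure]_(s in `[0, t]) g s = prim g t.
Proof.
move=> cg; rewrite le_eqVlt => /predU1P[<-|t0].
  by rewrite set_itv1 Rintegral_set1 prim0.
rewrite /Rintegral (@continuous_FTC2 R g (prim g)) //.
- by rewrite prim0// sube0.
- exact: continuous_subspaceT.
- split.
  + move=> x; rewrite in_itv/= => /andP[x0 _].
    by have := is_derive_prim cg (ltW x0); case.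
  + apply: cvg_at_right_filter; apply: derive_cont; exact: is_derive_prim.
  + apply: cvg_at_left_filter; apply: derive_cont; apply: is_derive_prim => //; exact: ltW.
- move=> x; rewrite in_itv/= => /andP[x0 _]; rewrite derive1E.
  by have := is_derive_prim cg (ltW x0); case.
Qed.

Lemma is_derive_expR_comp f t (l : R) :
  is_derive t 1 f l -> is_derive t 1 (fun s => expR (f s)) (l * expR (f t)).
Proof.
move=> h; have := is_derive1_comp (is_derive_expR (f t)) h.
by move=> k; apply: is_derive_eq; rewrite mulrC.
Qed.

Lemma is_derive_ln_comp f t (l : R) : 0 < f t ->
  is_derive t 1 f l -> is_derive t 1 (fun s => ln (f s)) (l / f t).
Proof.
move=> f0 h; have := is_derive1_comp (is_derive1_ln f0) h.
by move=> k; apply: is_derive_eq; rewrite mulrC.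
Qed.

End calculus.

Lemma continuous_sum {R : realType} (T : topologicalType) (I : Type) (s : seq I)
    (F : I -> T -> R) :
  (forall i, continuous (F i)) -> continuous (fun t => \sum_(i <- s) F i t).
Proof.
move=> cF t; elim: s => [|i s IH].
  by under eq_fun do rewrite big_nil; exact: cvg_cst.
by under eq_fun do rewrite big_cons; apply: cvgD => //; exact: cF.
Qed.

(** * The squared Euclidean norm and the cubic drift *)

Section sqn.
Context {R : realType} {d : nat}.
Implicit Types x y z : 'rV[R]_d.

Definition sqn x : R := \sum_i x 0 i ^+ 2.

Lemma sqn_ge0 x : 0 <= sqn x.
Proof. by apply: sumr_ge0 => i _; exact: sqr_ge0. Qed.

Lemma enorm_sqr x : enorm x ^+ 2 = sqn x.
Proof. by rewrite sqr_sqrtr ?sqn_ge0. Qed.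

Lemma driftE x i : drift x 0 i = (1 - sqn x) * x 0 i.
Proof. by rewrite /drift enorm_sqr mxE. Qed.

Lemma ler_sqn x i : x 0 i ^+ 2 <= sqn x.
Proof. by rewrite /sqn (bigD1 i)//= lerDl; apply: sumr_ge0 => j _; exact: sqr_ge0. Qed.

Lemma sqnBE x y : sqn (x - y) = sqn x + sqn y - 2 * \sum_i x 0 i * y 0 i.
Proof.
rewrite /sqn mulr_sumr -big_split -sumrB /=; apply: eq_bigr => i _.
by rewrite !mxE; ring.
Qed.

(* The identity behind the one-sided Lipschitz estimate of the cubic drift. *)
Lemma drift_inner x y :
  2 * \sum_i (x 0 i - y 0 i) * (drift x 0 i - drift y 0 i) =
  (2 - sqn x - sqn y) * sqn (x - y) - (sqn x - sqn y) ^+ 2.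
Proof.
rewrite sqnBE; set C := \sum_i x 0 i * y 0 i.
transitivity (2 * ((1 - sqn x) * sqn x + (1 - sqn y) * sqn y - (2 - sqn x - sqn y) * C)); last by ring.
congr (_ * _).
have E (a : R) u : a * sqn u = \sum_i a * u 0 i ^+ 2 by rewrite /sqn mulr_sumr.
rewrite !E /C mulr_sumr -big_split -sumrB/=.
by apply: eq_bigr => i _; rewrite !driftE; ring.
Qed.

Lemma sqnB_le x y : sqn (x - y) <= 2 * (sqn x + sqn y).
Proof.
rewrite /sqn -big_split/= mulr_sumr; apply: ler_sum => i _; rewrite !mxE.
by have := sqr_ge0 (x 0 i + y 0 i); nra.
Qed.

Lemma sqn_continuous (S : topologicalType) (z : S -> 'rV[R]_d) :
  continuous z -> continuous (fun t => sqn (z t)).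
Proof.
move=> cz; apply: continuous_sum => i t.
apply: (@continuous_comp _ _ _ (fun t => z t 0 i) (fun u => u ^+ 2)).
  apply: (@continuous_comp _ _ _ z (fun u : 'rV[R]_d => u 0 i)); first exact: cz.
  exact: coord_continuous.
exact: exprn_continuous.
Qed.

End sqn.

(** * Solutions driven by a continuous noise *)

Section solutions.
Context {R : realType} {d : nat}.
Implicit Types (eta z x : R -> 'rV[R]_d) (p q : 'rV[R]_d) (t : R).

(** The noise is only continuous, so each coordinate of [z] is split into a differentiable part [c]
    and the noise [eta]. Two solutions with the same [eta] then have a differentiable difference. *)
Definition sol p eta z :=
  continuous z /\ forall i, exists c : R -> R,
  [/\ c 0 = p 0 i, forall t, 0 <= t -> is_derive t 1 c (drift (z t) 0 i) &
      forall t, 0 <= t -> z t 0 i = c t + eta t 0 i].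

Lemma drift_coord_continuous z i : continuous z ->
  continuous (fun t => drift (z t) 0 i).
Proof.
move=> cz t; under eq_fun do rewrite driftE.
apply: cvgM.
  by apply: cvgB; [exact: cvg_cst|exact: sqn_continuous].
apply: (@continuous_comp _ _ _ z (fun u : 'rV[R]_d => u 0 i)); first exact: cz.
exact: coord_continuous.
Qed.

(** Time is frozen at 0 on the negative axis: the flow is continuous on [0, +oo[, and the clamped
    curve is continuous on the whole line. *)
Definition traj {n} (phi : R -> wiener_space R n -> 'rV[R]_d -> 'rV[R]_d) w p (t : R) :=
  phi (Num.max t 0) w p.

Lemma traj_continuous {n} (phi : R -> wiener_space R n -> 'rV[R]_d -> 'rV[R]_d) w p :
  {within `[0, +oo[, continuous (fun t => phi t w p)} -> continuous (traj phi w p).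
Proof.
move=> /subspace_continuousP cphi t.
have cm : {for t, continuous (fun t : R => Num.max t 0)}.
  by apply: continuous_max; [exact: cvg_id|exact: cvg_cst].
have h : (fun t : R => Num.max t 0) @ t --> within [set` `[0, +oo[] (nbhs (Num.max t 0)).
  move=> Q HQ; change (nbhs t (fun u => Q (Num.max u 0))).
  apply: (@filterS _ (nbhs t) _ _ _ _ (cm _ HQ)) => u; apply.
  by rewrite /= in_itv/= andbT le_max lexx orbT.
apply: (@cvg_comp _ _ _ (fun t : R => Num.max t 0) (fun s => phi s w p) _ _ _ h).
apply: cphi.
by rewrite /= in_itv/= andbT le_max lexx orbT.
Qed.

Lemma sde_sol {n} sigma (phi : R -> wiener_space R n -> 'rV[R]_d -> 'rV[R]_d) w p :
  is_sde_rds sigma phi -> sol p (fun t => sigma *: pad ((w : wiener_space R n) t)) (traj phi w p).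
Proof.
move=> /(_ w p)[cphi E].
have ct := traj_continuous cphi; split => // i.
have cd := @drift_coord_continuous _ i ct.
exists (fun t => p 0 i + prim (fun t => drift (traj phi w p t) 0 i) t); split.
- by rewrite prim0// addr0.
- move=> t t0; have h := is_derive_prim cd t0.
  by apply: (is_derive_eq (is_deriveD (is_derive_cst (p 0 i) t 1) h)); rewrite add0r.
- move=> t t0; rewrite -integral_prim// {1}/traj max_l// E// !mxE; congr (_ + _ + _).
  apply: eq_Rintegral => s; rewrite inE/= in_itv/= => /andP[s0 _].
  by rewrite /traj max_l.
Qed.

Lemma traj0 {n} sigma (phi : R -> wiener_space R n -> 'rV[R]_d -> 'rV[R]_d) w p :
  is_sde_rds sigma phi -> traj phi w p 0 = p.
Proof.
move=> h; have [_ hc] := sde_sol w p h; apply/rowP => i.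
have [c [c0 _ /(_ 0 (lexx _)) ->]] := hc i; rewrite c0 path0 !mxE.
by case: insubP => [j _ _|_]; rewrite ?mxE mulr0 addr0.
Qed.

(** The noise cancels in [z - x]. The function [v] is built from the differentiable parts and is
    identified with the squared distance for t >= 0 only, which gives it a two-sided derivative at
    0. *)
Lemma sol_pair p q eta z x : sol p eta z -> sol q eta x ->
  exists v : R -> R, (forall t, 0 <= t -> v t = sqn (z t - x t)) /\
  forall t, 0 <= t -> is_derive t 1 v
    ((2 - sqn (z t) - sqn (x t)) * v t - (sqn (z t) - sqn (x t)) ^+ 2).
Proof.
move=> [_ /choice[c hc]] [_ /choice[e he]].
pose v := \sum_i (c i - e i) ^+ 2; exists v.
have vE t : 0 <= t -> v t = sqn (z t - x t).
  move=> t0; rewrite /v /sqn fct_sumE; apply: eq_bigr => i _.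
  have [_ _ /(_ _ t0) h1] := hc i; have [_ _ /(_ _ t0) h2] := he i.
  by rewrite !mxE h1 h2 !fctE; ring.
split => // t t0; rewrite vE// -drift_inner.
have h i : is_derive t 1 ((c i - e i) ^+ 2)
   (2 * ((z t 0 i - x t 0 i) * (drift (z t) 0 i - drift (x t) 0 i))).
  have [_ /(_ _ t0) h1 /(_ _ t0) E1] := hc i.
  have [_ /(_ _ t0) h2 /(_ _ t0) E2] := he i.
  by apply: is_derive_eq; rewrite E1 E2 !fctE /= expr1 /GRing.scale/=; ring.
rewrite mulr_sumr; exact: is_derive_sum.
Qed.

End solutions.

(** * Pathwise estimates *)

Section gronwall.
Context {R : realType}.

(** [v] times exp (- A) is nonincreasing. There is no sign condition on [v]: the bound is also
    applied to a function that starts at a negative value. *)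
Lemma gronwall (v v' A a : R -> R) (s t : R) : s <= t ->
  (forall r, s <= r <= t -> is_derive r 1 v (v' r)) ->
  (forall r, s <= r <= t -> is_derive r 1 A (a r)) ->
  (forall r, s <= r <= t -> v' r <= a r * v r) ->
  v t <= v s * expR (A t - A s).
Proof.
move=> st dv dA va.
have H r : s <= r <= t ->
    is_derive r 1 (fun r => - (v r * expR (- A r))) ((a r * v r - v' r) * expR (- A r)).
  move=> rst; have h1 := dv _ rst; have h2 := dA _ rst.
  have h3 := is_derive_expR_comp (is_deriveN h2).
  apply: (is_derive_eq (is_deriveN (is_deriveM h1 h3))).
  by rewrite /GRing.scale/=; ring.
have h : v t * expR (- A t) <= v s * expR (- A s).
  rewrite -lerN2; apply: (derive_ndecr st H) => r rst.
  by rewrite mulr_ge0 ?expR_ge0// subr_ge0 va.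
have := ler_wpM2r (expR_ge0 (A t)) h.
by rewrite -!mulrA -!expRD addNr expR0 mulr1 [- A s + _]addrC.
Qed.

End gronwall.

Section pathwise.
Context {R : realType} {d : nat}.
Variables (p q : 'rV[R]_d) (eta z x : R -> 'rV[R]_d).
Hypotheses (sz : sol q eta z) (sx : sol p eta x).
Implicit Types (s t : R) (k m : nat).

Definition growth (y : R -> 'rV[R]_d) : R -> R := prim (fun t => 1 - sqn (y t)).

Lemma growth_cont (y : R -> 'rV[R]_d) : continuous y -> continuous (fun t => 1 - sqn (y t)).
Proof. by move=> cy t; apply: cvgB; [exact: cvg_cst|exact: sqn_continuous]. Qed.

Lemma growth0 (y : R -> 'rV[R]_d) : continuous y -> growth y 0 = 0.
Proof. by move=> cy; rewrite /growth prim0//; exact: growth_cont. Qed.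

Lemma is_derive_growth (y : R -> 'rV[R]_d) t : continuous y -> 0 <= t ->
  is_derive t 1 (growth y) (1 - sqn (y t)).
Proof. by move=> cy t0; apply: (is_derive_prim (growth_cont cy) t0). Qed.

(** Dropping the square in [drift_inner] leaves (2 - |z|^2 - |x|^2) v, whose factor is the
    derivative of [growth z + growth x]. *)
Lemma dist_growth t : 0 <= t ->
  sqn (z t - x t) <= sqn (z 0 - x 0) * expR (growth z t + growth x t).
Proof.
move=> t0; have [v [vE dv]] := sol_pair sz sx.
rewrite -!vE//.
have H r : 0 <= r <= t -> is_derive r 1 (growth z + growth x) (2 - sqn (z r) - sqn (x r)).
  move=> /andP[r0 _].
  apply: (is_derive_eq (is_deriveD (is_derive_growth sz.1 r0) (is_derive_growth sx.1 r0))).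
  by ring.
have -> : growth z t + growth x t = (growth z + growth x) t - (growth z + growth x) 0.
  by rewrite !fctE (growth0 sz.1) (growth0 sx.1) addr0 subr0.
apply: (gronwall t0 _ H).
- by move=> r /andP[r0 _]; exact: dv.
- by move=> r /andP[r0 _] /=; rewrite lerBlDr lerDl sqr_ge0.
Qed.

Lemma dist_expR s t : 0 <= s <= t ->
  sqn (z t - x t) <= sqn (z s - x s) * expR (2 * (t - s)).
Proof.
move=> /andP[s0 st]; have [v [vE dv]] := sol_pair sz sx.
have t0 := le_trans s0 st; rewrite -!vE//.
have H r : s <= r <= t -> is_derive r 1 (fun r : R => 2 * r) 2.
  by move=> _; apply: is_derive_eq; rewrite /GRing.scale/=; ring.
rewrite mulrBr; apply: (gronwall st _ H).
- by move=> r /andP[r0 _]; apply: dv; exact: le_trans r0.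
- move=> r /andP[r0 _]; have {}r0 := le_trans s0 r0.
  have := sqn_ge0 (z r); have := sqn_ge0 (x r); have := sqr_ge0 (sqn (z r) - sqn (x r)).
  have := sqn_ge0 (z r - x r); rewrite -vE//; nra.
Qed.

Lemma coord_growth i t : (forall s, eta s 0 i = 0) -> 0 <= t ->
  x t 0 i = p 0 i * expR (growth x t).
Proof.
move=> e0 t0; have [cx /(_ i)[c [c0 dc cE]]] := sx.
rewrite cE// e0 addr0.
suff : c 0 * expR (- growth x 0) = c t * expR (- growth x t).
  rewrite growth0// oppr0 expR0 mulr1 c0 expRN => ->.
  by rewrite divfK// expR_eq0.
apply: (@derive_const _ (fun t => c t * expR (- growth x t))) => // r /andP[r0 _].
have h1 := dc _ r0; have h3 := is_derive_expR_comp (is_deriveN (is_derive_growth cx r0)).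
apply: (is_derive_eq (is_deriveM h1 h3)).
by rewrite /GRing.scale/= driftE cE// e0; ring.
Qed.

End pathwise.

(** * Two solutions at distance one in a direction without noise *)

Section separation.
Context {R : realType} {d : nat}.
Variables (p q : 'rV[R]_d) (eta z x : R -> 'rV[R]_d) (i : 'I_d).
Hypotheses (sz : sol q eta z) (sx : sol p eta x).
Implicit Types (s t : R) (k m : nat).
Hypotheses (eta0 : eta 0 = 0) (etai : forall s, eta s 0 i = 0).
Hypotheses (pi0 : p 0 i = 0) (qi1 : q 0 i = 1) (pq1 : sqn (q - p) = 1).

Lemma sol0 (r : 'rV[R]_d) y : sol r eta y -> y 0 = r.
Proof.
move=> [_ h]; apply/rowP => j; have [c [c0 _ /(_ 0 (lexx _)) ->]] := h j.
by rewrite eta0 c0 mxE addr0.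
Qed.

Let D (t : R) := sqn (z t - x t).

(** Coordinate [i] of [z - x] is exp (growth z), because that of [x] stays 0; a single coordinate
    bounds the distance from below. *)
Lemma dist_pos t : 0 <= t -> 0 < D t /\ growth z t <= ln (D t) / 2.
Proof.
move=> t0.
have zi := coord_growth sz etai t0; rewrite qi1 mul1r in zi.
have xi := coord_growth sx etai t0; rewrite pi0 mul0r in xi.
have := ler_sqn (z t - x t) i; rewrite !mxE zi xi subr0 => h.
have D0 : 0 < D t by rewrite (lt_le_trans _ h)// exprn_gt0// expR_gt0.
split=> //; rewrite ler_pdivlMr//.
rewrite -(expRK (growth z t * 2)) ler_ln ?posrE ?expR_gt0//.
by rewrite mulrC expRM_natl.
Qed.

(** Since v <= 2 (|z|^2 + |x|^2), the squared distance satisfies v' <= 2 v - v^2 / 2, a logistic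
    inequality with equilibrium 4. The substitution 1/4 - 1/v makes it linear with rate -2, and the
    initial value 1/4 - 1 is negative, so the sign persists. *)
Lemma dist_le4 t : 0 <= t -> D t <= 4.
Proof.
move=> t0; have [v [vE dv]] := sol_pair sz sx.
have vp r : 0 <= r -> 0 < v r by move=> r0; rewrite vE//; have [] := dist_pos r0.
have H r : 0 <= r <= t -> is_derive r 1 (fun r => - (v r)^-1)
   (((2 - sqn (z r) - sqn (x r)) * v r - (sqn (z r) - sqn (x r)) ^+ 2) / v r ^+ 2).
  move=> /andP[r0 _]; have h := dv _ r0.
  have n0 := lt0r_neq0 (vp _ r0).
  have h2 := is_deriveV n0 h.
  by apply: (is_derive_eq (is_deriveN h2)); rewrite /GRing.scale/=; field.
have H2 r : 0 <= r <= t -> is_derive r 1 (fun r : R => - 2 * r) (- 2).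
  by move=> _; apply: is_derive_eq; rewrite /GRing.scale/=; ring.
pose A (r : R) := 4^-1 - (v r)^-1.
have H3 r : 0 <= r <= t -> is_derive r 1 A
   (((2 - sqn (z r) - sqn (x r)) * v r - (sqn (z r) - sqn (x r)) ^+ 2) / v r ^+ 2).
  move=> rt; have h := is_deriveD (is_derive_cst (4^-1 : R) r 1) (H r rt).
  by apply: (is_derive_eq h); rewrite add0r.
have /(gronwall t0 H3 H2) : forall r, 0 <= r <= t -> ((2 - sqn (z r) - sqn (x r)) * v r -
    (sqn (z r) - sqn (x r)) ^+ 2) / v r ^+ 2 <= - 2 * A r.
  move=> r /andP[r0 _]; rewrite /A.
  have n0 := vp _ r0.
  rewrite ler_pdivrMr ?exprn_gt0//.
  rewrite (_ : - 2 * (4^-1 - (v r)^-1) * v r ^+ 2 = 2 * v r - v r ^+ 2 / 2); last first.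
    by field; rewrite lt0r_neq0.
  have := sqnB_le (z r) (x r); rewrite -vE// => h.
  have := sqr_ge0 (sqn (z r) - sqn (x r)).
  nra.
rewrite /A !vE// (sol0 sz) (sol0 sx) pq1 => h.
have : 4^-1 <= (D t)^-1.
  rewrite -subr_le0; apply: le_trans h _; rewrite mulr_le0_ge0 ?expR_ge0//; lra.
by rewrite lef_pV2// posrE -?vE ?vp// /D -vE ?vp.
Qed.

(** The weights are chosen so that the constants cancel in the derivative of 3 growth z - growth x -
    ln v; with s = |z|^2 - |x|^2, adding v leaves s^2 / v - 2 s + v, a square divided by v. *)
Lemma growth_le_dist t : 0 <= t ->
  growth x t <= ln 2 + prim D t.
Proof.
move=> t0; have [v [vE dv]] := sol_pair sz sx.
have vp r : 0 <= r -> 0 < v r by move=> r0; rewrite vE//; have [] := dist_pos r0.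
have cD : continuous D.
  by apply: sqn_continuous => r; apply: cvgB; [exact: sz.1|exact: sx.1].
have H r : 0 <= r <= t -> is_derive r 1
    (fun r => growth z r * 3 - growth x r - ln (v r) + prim D r)
    ((sqn (z r) - sqn (x r)) ^+ 2 / v r - 2 * (sqn (z r) - sqn (x r)) + v r).
  move=> /andP[r0 _].
  have h1 := is_derive_growth sz.1 r0.
  have h2 := is_derive_growth sx.1 r0.
  have h3 := is_derive_ln_comp (vp _ r0) (dv _ r0).
  have h4 := is_derive_prim cD r0.
  have h5 := is_deriveM h1 (is_derive_cst (3 : R) r 1).
  apply: (is_derive_eq (is_deriveD (is_deriveD (is_deriveD h5 (is_deriveN h2)) (is_deriveN h3)) h4)).
  have -> : D r = v r by rewrite vE.
  by rewrite /GRing.scale/= /cst/=; field; rewrite lt0r_neq0// vp.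
have /(derive_ndecr t0 H) : forall r, 0 <= r <= t ->
    0 <= (sqn (z r) - sqn (x r)) ^+ 2 / v r - 2 * (sqn (z r) - sqn (x r)) + v r.
  move=> r /andP[r0 _].
  have n0 := vp _ r0.
  rewrite (_ : _ + v r = ((sqn (z r) - sqn (x r)) - v r) ^+ 2 / v r); last first.
    by field; rewrite lt0r_neq0.
  by rewrite divr_ge0 ?sqr_ge0// ltW.
rewrite (growth0 sz.1) (growth0 sx.1) prim0// vE// (sol0 sz) (sol0 sx) pq1 ln1.
rewrite mul0r !subr0 addr0 vE// -/(D t).
(* As growth z <= (ln v) / 2, the combination 3 growth z - ln v is at most (ln v) / 2, and v <= 4
   turns this into ln 2. *)
have [D0 h] := dist_pos t0.
have h4 : ln (D t) <= ln 4 by rewrite ler_ln ?posrE// dist_le4.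
have E4 : ln 4 = 2 * ln 2 :> R.
  by rewrite (_ : 4 = 2 ^+ 2) ?lnXn// ?mulr_natl//; ring.
rewrite E4 in h4 => h5.
by lra.
Qed.

(** On [k, k + 1] the squared distance is at most e^2 times its value at k. Only integer times
    remain, so that expectations are taken of finite sums. *)
Lemma growth_le_sum m :
  growth x m%:R <= ln 2 + expR 2 * \sum_(k < m) D k%:R.
Proof.
apply: le_trans (growth_le_dist (ler0n _ m)) _; rewrite lerD2l.
have cD : continuous D.
  by apply: sqn_continuous => r; apply: cvgB; [exact: sz.1|exact: sx.1].
elim: m => [|m IH]; first by rewrite prim0// big_ord0 mulr0.
rewrite big_ord_recr/= mulrDr -lerBlDl; apply: le_trans (lerB _ IH) _ => //.
have mm : (m%:R : R) <= m.+1%:R by rewrite ler_nat.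
have [|c /andP[c1 c2] ->] := @derive_mvt _ (prim D) D m%:R m.+1%:R mm.
  by move=> r /andP[r0 _]; apply: is_derive_prim => //; exact: le_trans r0.
rewrite -natrB// subSnn mulr1 mulrC.
apply: (le_trans (dist_expR sz sx (s := m%:R) _)); first by rewrite ler0n.
rewrite ler_wpM2l ?sqn_ge0// ler_expR.
by move: c2; rewrite -natr1; lra.
Qed.

End separation.

(** * Uniform continuity on segments and pathwise convergence of the Euler scheme *)

Section segment.
Context {R : realType}.
Implicit Types (g : R -> R) (s t T : R).

Lemma segment_unif_continuous g T eps : continuous g -> 0 < eps ->
  \forall h \near 0^'+, forall s t, 0 <= s <= T -> `|s - t| <= h -> `|g s - g t| <= eps.
Proof.
move=> cg e0.
have := @segment_compact R 0 T; rewrite compact_near_coveringP => cov.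
have := cov R (0^'+) (fun h s => forall t, `|s - t| <= h -> `|g s - g t| <= eps) _ _.
move=> H; suff : \forall h \near 0^'+, `[0, T]%classic `<=`
    (fun s => forall t, `|s - t| <= h -> `|g s - g t| <= eps).
  by apply: filterS => h hh s t sT; apply: hh; rewrite /= in_itv.
apply: H => x _.
have /cvgrPdist_lt/(_ (eps / 2)) := cg x.
rewrite divr_gt0// => /(_ isT)/nbhs_ballP[dl /= d0 hd].
exists (ball x (dl / 2), [set h | h < dl / 2]); first split => /=.
- by apply: nbhsx_ballx; rewrite divr_gt0.
- by apply: nbhs_right_lt; rewrite divr_gt0.
- move=> [y h] /= [yx hdl] t yt.
  have h1 : `|g x - g y| < eps / 2.
    by apply: hd; apply: le_ball yx; rewrite ler_pdivrMr// mulr_natr mulr2n lerDl ltW.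
  have h2 : `|g x - g t| < eps / 2.
    apply: hd; apply: (@ball_split _ _ y) => //.
    by rewrite /ball/=; exact: le_lt_trans hdl.
  rewrite (_ : g y - g t = (g x - g t) - (g x - g y)); last by ring.
  by apply: le_trans (ler_normB _ _) _; rewrite (splitr eps) lerD// ltW.
Qed.

Lemma segment_bounded g T : continuous g -> exists B, forall t, 0 <= t <= T -> g t <= B.
Proof.
move=> cg; have [T0|T0] := leP 0 T; last first.
  by exists 0 => t /andP[h1 h2]; have := le_lt_trans (le_trans h1 h2) T0; rewrite ltxx.
have [|c cT hc] := @EVT_max R g 0 T T0; first exact: continuous_subspaceT.
by exists (g c) => t tT; apply: hc; rewrite in_itv.
Qed.

End segment.

Lemma cvg_mesh {R : realType} (T : R) : 0 < T -> (T / N%:R) @[N --> \oo] --> 0^'+.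
Proof.
move=> T0 A /nbhs_ballP[e /= ep hA].
apply: filterS2 (nbhs_infty_gtr (T / e)) (nbhs_infty_gt 0) => N h1 N0; apply: hA.
  rewrite /ball/= sub0r normrN ger0_norm; last by rewrite divr_ge0// ltW.
  by rewrite ltr_pdivrMr ?ltr0n// mulrC -ltr_pdivrMr.
by rewrite divr_gt0// ltr0n.
Qed.

Section euler.
Context {R : realType} {d n : nat}.
Implicit Types (p x y : 'rV[R]_d) (h sigma : R) (xi : nat -> 'rV[R]_n).

(** The increments [xi] are an arbitrary sequence, so that the same function is evaluated along a
    path, along its shift, and under the law of the increments. *)
Fixpoint euler h sigma p xi j : 'rV[R]_d :=
  if j is j'.+1 then
    euler h sigma p xi j' + h *: drift (euler h sigma p xi j') + sigma *: pad (xi j')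
  else p.

Definition incr (w : R -> 'rV[R]_n) tau h (j : nat) : 'rV[R]_n :=
  w (tau + j.+1%:R * h) - w (tau + j%:R * h).

Lemma eulerS h sigma p xi j i : euler h sigma p xi j.+1 0 i =
  euler h sigma p xi j 0 i + h * drift (euler h sigma p xi j) 0 i + sigma * pad (xi j) 0 i.
Proof.
have E (a b c : 'rV[R]_d) : (a + h *: b + sigma *: c) 0 i = a 0 i + h * b 0 i + sigma * c 0 i.
  by rewrite !mxE.
exact: E.
Qed.

Lemma drift_lipschitz (M e : R) x y i : 0 <= M -> 0 <= e ->
  (forall k, `|x 0 k| <= M) -> (forall k, `|y 0 k| <= M) ->
  (forall k, `|x 0 k - y 0 k| <= e) ->
  `|drift x 0 i - drift y 0 i| <= (1 + 3 * d%:R * M ^+ 2) * e.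
Proof.
move=> M0 e0 xM yM xy; rewrite !driftE.
have sM (u : 'rV[R]_d) : (forall k, `|u 0 k| <= M) -> sqn u <= d%:R * M ^+ 2.
  move=> uM; rewrite /sqn -[d in d%:R]card_ord -sumr_const mulr_suml; apply: ler_sum => k _.
  by rewrite mul1r -real_normK ?num_real// lerXn2r ?nnegrE.
have sB : `|sqn x - sqn y| <= d%:R * (2 * M * e).
  rewrite /sqn -sumrB -[d in d%:R]card_ord -sumr_const mulr_suml.
  apply: le_trans (ler_norm_sum _ _ _) _; apply: ler_sum => k _.
  rewrite mul1r subr_sqr mulrC normrM; apply: ler_pM => //.
  by apply: le_trans (ler_normD _ _) _; rewrite mulr2n mulrDl mul1r lerD.
rewrite (_ : _ - _ = (1 - sqn x) * (x 0 i - y 0 i) - y 0 i * (sqn x - sqn y)); last by ring.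
apply: le_trans (ler_normB _ _) _; rewrite !normrM.
have s0 := sqn_ge0 x.
have h1 : `|1 - sqn x| <= 1 + d%:R * M ^+ 2.
  by apply: le_trans (ler_normB _ _) _; rewrite normr1 lerD2l ger0_norm// sM.
have h2 : `|1 - sqn x| * `|x 0 i - y 0 i| <= (1 + d%:R * M ^+ 2) * e by apply: ler_pM.
have h3 : `|y 0 i| * `|sqn x - sqn y| <= M * (d%:R * (2 * M * e)) by apply: ler_pM.
by apply: le_trans (lerD h2 h3) _; rewrite le_eqVlt; apply/orP; left; apply/eqP; ring.
Qed.

(** The local error is o(h): the noise is reproduced exactly, and the mean value theorem evaluates
    the drift at a nearby time, where uniform continuity along the path compares it with its value
    at [t]. *)
Lemma sol_step p (w z : R -> _) sigma T (eps : R) :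
  sol p (fun t => sigma *: pad ((w : R -> 'rV[R]_n) t)) z -> 0 < eps ->
  \forall h \near 0^'+, forall t i, 0 <= t -> t + h <= T ->
  `|z (t + h) 0 i - (z t 0 i + h * drift (z t) 0 i
      + sigma * (pad (w (t + h)) 0 i - pad (w t) 0 i :> R))| <= h * eps.
Proof.
move=> [cz hz] e0.
have : \forall h \near 0^'+, forall i s t, 0 <= s <= T -> `|s - t| <= h ->
    `|drift (z s) 0 i - drift (z t) 0 i| <= eps.
  apply: filter_forall => i.
  exact: (segment_unif_continuous T (@drift_coord_continuous _ _ z i cz) e0).
move=> H; near=> h => t i t0 tT.
have h0 : 0 < h by near: h; exact: nbhs_right_gt.
have [c [_ dc cE]] := hz i.
rewrite !cE ?addr_ge0 ?(ltW h0)//.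
have [||u /andP[u1 u2]] := @derive_mvt _ c (fun t => drift (z t) 0 i) t (t + h).
- by rewrite lerDl ltW.
- by move=> r /andP[r0 _]; apply: dc; exact: le_trans r0.
rewrite [t + h]addrC addrK => Ec.
have -> : c (h + t) = c t + drift (z u) 0 i * h by rewrite -Ec; ring.
have Ep u' : (sigma *: pad (w u')) 0 i = sigma * pad (w u') 0 i :> R by rewrite mxE.
rewrite !Ep (_ : _ - _ = h * (drift (z u) 0 i - drift (z t) 0 i)); last by ring.
rewrite normrM ger0_norm ?(ltW h0)// ler_wpM2l ?(ltW h0)//.
apply: (near H h) => //.
  by rewrite (le_trans t0)//= (le_trans u2).
by rewrite ger0_norm ?subr_ge0// lerBlDl.
Unshelve. all: by end_near. Qed.

(** The drift is Lipschitz on bounded sets only. The induction keeps the error below 1, hence the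
    iterates where the Lipschitz constant [L] is valid, and the local errors accumulate to eta t exp
    (L t). *)
Lemma euler_cvg p (w z : R -> _) sigma T (eps : R) : 0 < T -> 0 < eps ->
  sol p (fun t => sigma *: pad ((w : R -> 'rV[R]_n) t)) z -> z 0 = p ->
  \forall N \near \oo, forall j i, (j <= N)%N ->
    `|euler (T / N%:R) sigma p (incr w 0 (T / N%:R)) j 0 i - z (j%:R * (T / N%:R)) 0 i|
      <= eps.
Proof.
move=> T0 e0 sz z0.
have [B hB] := segment_bounded T (sqn_continuous sz.1).
(* The path stays within [M - 1] in each coordinate, which leaves room 1 for the error; this is why
   the tolerance [e1] is capped at 1. *)
pose M := 2 + `|B|; have M0 : 0 <= M by rewrite /M addr_ge0.
have zM t i : 0 <= t <= T -> `|z t 0 i| <= M - 1.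
  move=> /hB h; have := ler_sqn (z t) i; have := ler_norm B.
  rewrite /M -[z t 0 i ^+ 2]real_normK ?num_real//; have := normr_ge0 (z t 0 i); nra.
pose L := 1 + 3 * d%:R * M ^+ 2.
have L0 : 0 <= L by rewrite /L addr_ge0// !mulr_ge0// sqr_ge0.
pose e1 := Num.min eps 1; have e10 : 0 < e1 by rewrite /e1 lt_min e0 ltr01.
pose eta := e1 / (T * expR (L * T)).
have eta0 : 0 < eta by rewrite /eta divr_gt0// mulr_gt0// expR_gt0.
have /sol_step -/(_ T eta eta0) H := sz.
have := cvg_mesh T0 H; apply: filterS2 (nbhs_infty_gt 0) => N N0 {}H.
set h := T / N%:R in H *.
have h0 : 0 < h by rewrite divr_gt0// ltr0n.
have jT j : (j <= N)%N -> j%:R * h <= T.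
  by move=> jN; rewrite /h mulrCA ger_pMr// ler_pdivrMr ?ltr0n// mul1r ler_nat.
pose X := euler h sigma p (incr w 0 h).
suff K j i : (j <= N)%N -> `|X j 0 i - z (j%:R * h) 0 i| <= eta * (j%:R * h) * expR (L * (j%:R * h)).
  move=> j i jN; apply: le_trans (K j i jN) _.
  have : eta * (T * expR (L * T)) <= eps.
    by rewrite /eta divfK ?gt_eqF ?mulr_gt0 ?expR_gt0// /e1 ge_min lexx.
  apply: le_trans; rewrite -mulrA ler_wpM2l ?(ltW eta0)//.
  apply: ler_pM; [by rewrite mulr_ge0// ltW|exact: expR_ge0|exact: jT|].
  by rewrite ler_expR ler_wpM2l// jT.
elim: j i => [|j IH] i jN.
  by rewrite mul0r z0 /X/= subrr normr0 mulr0 mul0r.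
have {}IH k := IH k (ltnW jN).
set t := j%:R * h in IH.
have t0 : 0 <= t by rewrite mulr_ge0// ltW.
have tS : j.+1%:R * h = t + h by rewrite -natr1 mulrDl mul1r.
have tT : t + h <= T by rewrite -tS jT.
set E := eta * t * expR (L * t) in IH.
have E0 : 0 <= E by apply: mulr_ge0; [apply: mulr_ge0 => //; exact: ltW|exact: expR_ge0].
have E1 : E <= 1.
  have : eta * (T * expR (L * T)) <= 1.
    by rewrite /eta divfK ?gt_eqF ?mulr_gt0 ?expR_gt0// /e1 ge_min lexx orbT.
  apply: le_trans; rewrite /E -mulrA ler_wpM2l ?(ltW eta0)//.
  have tT' : t <= T by apply: le_trans tT; rewrite lerDl ltW.
  apply: ler_pM; [exact: t0|exact: expR_ge0|exact: tT'|].
  by rewrite ler_expR ler_wpM2l.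
have ztM k : `|z t 0 k| <= M - 1.
  by apply: zM; rewrite t0/=; apply: le_trans tT; rewrite lerDl ltW.
have dr := @drift_lipschitz M E (X j) (z t) i M0 E0 _ _ IH.
have {}dr : `|drift (X j) 0 i - drift (z t) 0 i| <= L * E.
  apply: dr => k; last by apply: le_trans (ztM k) _; rewrite lerBlDr lerDl.
  rewrite -[X j 0 k](subrK (z t 0 k)); apply: le_trans (ler_normD _ _) _.
  by have := IH k; have := ztM k; lra.
have := H t i t0 tT.
have ES : X j.+1 0 i = X j 0 i + h * drift (X j) 0 i + sigma * pad (incr w 0 h j) 0 i.
  exact: eulerS.
rewrite -/(X j.+1) ES tS.
set r := z (t + h) 0 i; set D := drift _ 0 i in dr *; set D' := drift _ 0 i in dr *.
have -> : pad (incr w 0 h j) 0 i = pad (w (t + h)) 0 i - pad (w t) 0 i :> R.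
  by rewrite /pad !mxE; case: insubP => [k _ _|_]; rewrite ?subr0// !mxE /incr !add0r tS.
set P := pad _ 0 i - _ => Hr.
rewrite (_ : _ - r = (X j 0 i - z t 0 i) + h * (D - D') - (r - (z t 0 i + h * D' + sigma * P))); last by ring.
have i1 := ler_normB ((X j 0 i - z t 0 i) + h * (D - D')) (r - (z t 0 i + h * D' + sigma * P)).
have i2 := ler_normD (X j 0 i - z t 0 i) (h * (D - D')).
have i3 : `|h * (D - D')| <= h * (L * E) by rewrite normrM ger0_norm ?(ltW h0)// ler_wpM2l ?(ltW h0).
have i4 := IH i.
have : E + h * (L * E) + h * eta <= eta * (t + h) * expR (L * (t + h)).
  have x1 : 1 + L * h <= expR (L * h) by exact: expR_ge1Dx.
  have x2 : E * (1 + L * h) <= E * expR (L * h) by rewrite ler_wpM2l.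
  have x3 : E * expR (L * h) = eta * t * expR (L * (t + h)).
    by rewrite /E -mulrA -expRD mulrDr.
  have x4 : 1 <= expR (L * (t + h)) by rewrite -expR0 ler_expR mulr_ge0// addr_ge0// ltW.
  have x5 : h * eta * 1 <= h * eta * expR (L * (t + h)) by rewrite ler_wpM2l// mulr_ge0// ltW.
  lra.
by rewrite -/h in Hr; lra.
Qed.

End euler.

(** * Gaussian increments and measurability of the flow *)

Section law.
Context d (T : measurableType d) (R : realType) (P : probability T R).
Local Open Scope ereal_scope.

Lemma eq_law_integral d' (Y : measurableType d') (f g : T -> Y) (G : set (set Y))
    (phi : Y -> \bar R) :
  measurable_fun setT f -> measurable_fun setT g ->
  d'.-measurable = <<s G >> -> setI_closed G -> G setT ->
  (forall A, G A -> P (f @^-1` A) = P (g @^-1` A)) ->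
  measurable_fun setT phi -> (forall y, 0 <= phi y) ->
  \int[P]_w phi (f w) = \int[P]_w phi (g w).
Proof.
move=> mf mg mG GI GT fg mphi phi0.
pose m1 := measure_function_pushforward__canonical__measure_function_Measure P mf.
pose m2 := measure_function_pushforward__canonical__measure_function_Measure P mg.
have E A : measurable A -> m1 A = m2 A.
  apply: (@measure_unique _ R Y G (fun=> setT)) => //.
  - by rewrite bigcup_const//; exists 0%N.
  - move=> k; change (P (f @^-1` setT) < +oo).
    by rewrite preimage_setT probability_setT ltry.
transitivity (\int[m1]_y phi y).
  by rewrite ge0_integral_pushforward.
transitivity (\int[m2]_y phi y).
  by apply: (eq_measure_integral m2) => A mA _; exact: E.
by rewrite ge0_integral_pushforward.
Qed.

(** Independence makes the joint law of [f] and [g] a product measure; Tonelli then integrates over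
    the second variable with the first one frozen. *)
Lemma indep_integral d1 d2 (Y : measurableType d1) (Z : measurableType d2)
    (f : T -> Y) (g : T -> Z) (nu : {sigma_finite_measure set Z -> \bar R})
    (phi : Y * Z -> \bar R) :
  measurable_fun setT f -> measurable_fun setT g ->
  (forall A B, measurable A -> measurable B ->
    P (f @^-1` A `&` g @^-1` B) = P (f @^-1` A) * nu B) ->
  measurable_fun setT phi -> (forall y, 0 <= phi y) ->
  \int[P]_w phi (f w, g w) = \int[P]_w \int[nu]_z phi (f w, z).
Proof.
move=> mf mg fg mphi phi0.
have mfg : measurable_fun setT (fun w => (f w, g w)) by exact: measurable_fun_pair.
pose m := measure_function_pushforward__canonical__measure_function_Measure P mfg.
pose m1 := measure_function_pushforward__canonical__measure_function_Measure P mf.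
have m1fin : fin_num_fun m1.
  move=> A mA; change (P (f @^-1` A) \is a fin_num).
  apply: fin_num_measure; rewrite -[X in measurable X]setTI; exact: (mf measurableT _ mA).
pose m1' : {finite_measure set Y -> \bar R} := HB.pack (Measure.sort m1)
  (Measure_isFinite.Build _ _ _ (Measure.sort m1) m1fin).
transitivity (\int[m]_y phi y).
  by rewrite ge0_integral_pushforward.
transitivity (\int[m1' \x nu]_y phi y).
  apply: eq_measure_integral => A mA _; apply/esym.
  exact: (@product_measure_unique _ _ _ _ R m1' nu m).
rewrite fubini_tonelli1//.
change (\int[m1]_x (fubini_F nu phi x) = \int[P]_w \int[nu]_z phi (f w, z)).
rewrite ge0_integral_pushforward//.
- by apply: (@measurable_fun_fubini_tonelli_F _ _ _ _ _ nu).
- by move=> y _; apply: integral_ge0.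
Qed.

End law.

Section increments.
Context {R : realType} {n : nat}.
Implicit Types (k : nat) (tau h : R).
Local Notation Omega := (wiener_space R n).

Definition box k (B : nat -> 'I_n -> set R) : set (nat -> 'rV[R]_n) :=
  [set xi | forall j i, (j < k)%N -> B j i (xi j 0 i)].

(** All sequences share one type and [k] selects the sigma-algebra of the first [k] increments.
    Boxes form a pi-system, and [is_wiener_measure] prescribes exactly their probabilities. *)
Definition boxes k : set (set (nat -> 'rV[R]_n)) :=
  [set box k B | B in [set B | forall j i, measurable (B j i)]].

Local Notation incs k := (g_sigma_algebraType (boxes k)).

Lemma boxesI k : setI_closed (boxes k).
Proof.
move=> _ _ [B mB <-] [C mC <-]; exists (fun j i => B j i `&` C j i).
  by move=> j i; exact: measurableI.
apply/seteqP; split=> [xi h|xi [h1 h2] j i jk]; last by split; [exact: h1|exact: h2].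
by split=> j i jk; have [] := h j i jk.
Qed.

Lemma boxesT k : boxes k setT.
Proof. by exists (fun _ _ => setT) => //; apply/seteqP; split. Qed.

(** Evaluation at [t] is continuous for the compact-open topology because a point is compact. *)
Lemma measurable_path t i :
  measurable_fun [set: borel Omega] ((fun w => w t 0 i) : borel Omega -> R).
Proof.
apply: (measurability _ (measurable_realfun.RGenOpens.measurableE R)).
move=> _ [_ [a [b ->]] <-]; rewrite setTI; apply: sub_sigma_algebra.
have cw : continuous (fun w : Omega => w t 0 i).
  have c1 : continuous (@path_of R n : Omega -> {compact-open, R -> 'rV[R]_n}).
    exact: initial_continuous.
  have c2 : continuous ((fun f => f t) : {compact-open, R -> 'rV[R]_n} -> 'rV[R]_n).
    apply/continuousP => U oU.
    have -> : (fun f : {compact-open, R -> 'rV[R]_n} => f t) @^-1` U =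
        [set f | f @` [set t] `<=` U].
      apply/seteqP; split => [f ft _ [_ -> <-]//|f]; apply; exists t => //.
    by apply: compact_open_open => //; exact: compact_set1.
  move=> w; apply: (@continuous_comp _ _ _ (fun w : Omega => w t) (fun v : 'rV[R]_n => v 0 i)).
    exact: (@continuous_comp _ _ _ (@path_of R n : Omega -> {compact-open, R -> 'rV[R]_n})
      (fun f : {compact-open, R -> 'rV[R]_n} => f t) w (c1 w) (c2 _)).
  exact: coord_continuous.
by move/continuousP : cw; apply; exact: interval_open.
Qed.

Lemma measurable_incr k tau h :
  measurable_fun [set: borel Omega] ((fun w => incr w tau h) : borel Omega -> incs k).
Proof.
apply: (@measurability _ _ _ (incs k) _ _ (boxes k)) => //.
move=> _ [_ [B mB <-] <-]; rewrite setTI.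
rewrite (_ : _ @^-1` _ = \bigcap_(ji in [set: 'I_k * 'I_n])
   [set w : borel Omega | B ji.1 ji.2 (incr w tau h ji.1 0 ji.2)]); last first.
  apply/seteqP; split => w hw; first by move=> [j i] _; exact: hw.
  by move=> j i jk; apply: (hw (Ordinal jk, i)).
apply: fin_bigcap_measurable => [|[j i] _]; first exact: finite_finset.
have mf : measurable_fun [set: borel Omega] ((fun w => incr w tau h j 0 i) : borel Omega -> R).
  under eq_fun do rewrite !mxE.
  by apply: measurable_funB; exact: measurable_path.
by rewrite -[X in measurable X]setTI; exact: (mf measurableT _ (mB j i)).
Qed.

Lemma measurable_inc k j i : (j < k)%N ->
  measurable_fun [set: incs k] ((fun xi => xi j 0 i) : incs k -> R).
Proof.
move=> jk _ A mA; rewrite setTI; apply: sub_sigma_algebra.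
exists (fun j' i' => if (j' == j) && (i' == i) then A else setT).
  by move=> j' i'; case: ifP.
apply/seteqP; split => xi /=.
  by move=> /(_ j i jk); rewrite !eqxx.
by move=> Ax j' i' _; case: ifP => // /andP[/eqP -> /eqP ->].
Qed.

Lemma measurable_euler {d} k h sigma (p : 'rV[R]_d) j i : (j <= k)%N ->
  measurable_fun [set: incs k] ((fun xi => euler h sigma p xi j 0 i) : incs k -> R).
Proof.
elim: j i => [|j IH] i jk; first exact: measurable_cst.
have {}IH i' := IH i' (ltnW jk).
apply: (eq_measurable_fun (fun xi : incs k => euler h sigma p xi j 0 i +
    h * ((1 - sqn (euler h sigma p xi j)) * euler h sigma p xi j 0 i) + sigma * pad (xi j) 0 i)).
  by move=> xi _; rewrite eulerS driftE.
apply: measurable_funD; first apply: measurable_funD => //.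
- apply: measurable_funM => //; apply: measurable_funM => //.
  apply: measurable_funB => //; rewrite /sqn.
  by apply: measurable_sum => l; exact: measurable_funX.
- apply: measurable_funM => //; rewrite /pad.
  apply: (eq_measurable_fun (fun xi : incs k =>
      if insub (i : nat) is Some l then xi j 0 l else 0)); first by move=> xi _; rewrite mxE.
  by case: insubP => [l _ _|_]; [exact: measurable_inc|exact: measurable_cst].
Qed.

Variables (P : probability (borel Omega) R) (hP : is_wiener_measure P).

Lemma box_prob k tau h (B : nat -> 'I_n -> set R) : 0 < h ->
  (forall j i, measurable (B j i)) ->
  P ((fun w => incr w tau h) @^-1` box k B) =
  (\prod_(j < k) \prod_(i < n) normal_prob 0 (Num.sqrt h) (B j i))%E.
Proof.
move=> h0 mB.
have := hP (k := k) (t := fun j => tau + j%:R * h) (B := fun j i => B j i) _ _.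
rewrite (_ : mkset _ = (fun w : Omega => incr w tau h) @^-1` box k B); last first.
  apply/seteqP; split => w /= hw j i; last by have := hw j i (ltn_ord j); rewrite !mxE.
  by move=> jk; rewrite !mxE; exact: (hw (Ordinal jk) i).
move=> ->; first last.
- by move=> j i; exact: mB.
- by move=> j; rewrite ltrD2l ltr_pM2r// ltr_nat.
have E (j : nat) : tau + j.+1%:R * h - (tau + j%:R * h) = h by rewrite -natr1; ring.
by apply: eq_bigr => j _; apply: eq_bigr => i _; rewrite E.
Qed.

(** The probability of a box depends on the mesh [h] and not on the starting time [tau]; the
    pi-system argument extends this to nonnegative measurable functions. *)
Lemma incr_shift k tau h (phi : incs k -> \bar R) : 0 < h ->
  measurable_fun setT phi -> (forall y, (0 <= phi y)%E) ->
  (\int[P]_w phi (incr w tau h) = \int[P]_w phi (incr w 0 h))%E.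
Proof.
move=> h0 mphi phi0.
apply: (@eq_law_integral _ _ R P _ (incs k) (fun w => incr w tau h) (fun w => incr w 0 h)
   (boxes k)) => //.
- exact: measurable_incr.
- exact: measurable_incr.
- exact: boxesI.
- exact: boxesT.
- by move=> _ [B mB <-]; rewrite !box_prob.
Qed.

End increments.

(** * Euclidean distance and distance to a random set *)

Section enorm.
Context {R : realType} {d : nat}.
Implicit Types (x y : 'rV[R]_d) (D : set 'rV[R]_d).

Lemma enorm_ge0 x : 0 <= enorm x. Proof. exact: sqrtr_ge0. Qed.

Lemma cauchy_schwarz x y : (\sum_i x 0 i * y 0 i) ^+ 2 <= sqn x * sqn y.
Proof.
set C := \sum_i _.
have h : 0 <= sqn y * (sqn x * sqn y - C ^+ 2).
  have : 0 <= \sum_i (sqn y * x 0 i - C * y 0 i) ^+ 2.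
    by apply: sumr_ge0 => i _; exact: sqr_ge0.
  have E b c : \sum_i (b * x 0 i - c * y 0 i) ^+ 2 =
      b ^+ 2 * sqn x - 2 * b * c * (\sum_i x 0 i * y 0 i) + c ^+ 2 * sqn y.
    rewrite /sqn !mulr_sumr -sumrB -big_split/=; apply: eq_bigr => i _; ring.
  by rewrite E -/C; congr (0 <= _); ring.
have := sqn_ge0 y; rewrite le_eqVlt => /predU1P[y0|y0]; last first.
  by rewrite -subr_ge0 -(pmulr_rge0 _ y0).
have yi i : y 0 i = 0.
  have := ler_sqn y i; rewrite -y0 => h2; apply/eqP; rewrite -sqrf_eq0.
  by rewrite eq_le h2 sqr_ge0.
rewrite -y0 mulr0 /C big1 ?expr0n// => i _; by rewrite yi mulr0.
Qed.

Lemma enormD x y : enorm (x + y) <= enorm x + enorm y.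
Proof.
rewrite -(@ler_pXn2r _ 2)// ?nnegrE ?addr_ge0 ?enorm_ge0//.
rewrite sqrrD !enorm_sqr.
have -> : sqn (x + y) = sqn x + sqn y + 2 * \sum_i x 0 i * y 0 i.
  rewrite /sqn mulr_sumr -!big_split /=; apply: eq_bigr => i _.
  by rewrite !mxE; ring.
have h : \sum_i x 0 i * y 0 i <= enorm x * enorm y.
  rewrite /enorm -sqrtrM ?sqn_ge0//; apply: le_trans (ler_norm _) _.
  by rewrite -sqrtr_sqr ler_sqrt ?mulr_ge0 ?sqn_ge0//; exact: cauchy_schwarz.
lra.
Qed.

Lemma dist_to_lb x D : has_lbound [set enorm (x - y) | y in D].
Proof. by exists 0 => _ [y _ <-]; exact: enorm_ge0. Qed.

Lemma dist_to_lip x y D : D !=set0 -> dist_to x D <= enorm (x - y) + dist_to y D.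
Proof.
move=> [a Da]; rewrite -lerBlDl; apply: lb_le_inf; first by exists (enorm (y - a)), a.
move=> _ [z Dz <-]; rewrite lerBlDl.
apply: le_trans (_ : enorm (x - z) <= _).
  by apply: ge_inf; [exact: dist_to_lb|exists z].
by rewrite (_ : x - z = (x - y) + (y - z)) ?enormD// addrA subrK.
Qed.

Lemma dist_to1 x y : dist_to x [set y] = enorm (x - y).
Proof. by rewrite /dist_to image_set1 inf1. Qed.

Lemma rat_dense x (e : R) : 0 < e -> exists r : 'rV[rat]_d, enorm (x - map_mx ratr r) < e.
Proof.
move=> e0; pose dl := e / d.+1%:R.
have d0 : 0 < dl by rewrite divr_gt0.
have H i : exists q : rat, `|x 0 i - ratr q| < dl.
  have [|q] := @rat_in_itvoo R (x 0 i - dl) (x 0 i + dl).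
    by rewrite ltrBlDr -addrA ltrDl addr_gt0.
  rewrite in_itv /= => /andP[q1 q2]; exists q.
  by rewrite distrC ltr_distl q1 q2.
have [q hq] := choice H; exists (\row_i q i).
rewrite -(@ltr_pXn2r _ 2)// ?nnegrE ?enorm_ge0 ?(ltW e0)// enorm_sqr.
apply: (@le_lt_trans _ _ (d%:R * dl ^+ 2)).
  rewrite /sqn -[d in d%:R]card_ord -sumr_const mulr_suml; apply: ler_sum => i _.
  have h := hq i; rewrite mul1r !mxE -real_normK ?num_real//.
  by rewrite lerXn2r ?nnegrE// ltW.
rewrite /dl expr_div_n mulrCA -[ltRHS]mulr1 ltr_pM2l ?exprn_gt0//.
rewrite ltr_pdivrMr ?exprn_gt0// mul1r -natrX ltr_nat.
by rewrite (leq_trans (ltnSn d))// leq_pmulr.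
Qed.

End enorm.

Lemma measurable_sqn {dd} {T : measurableType dd} {R : realType} {d} (u : T -> 'rV[R]_d) :
  (forall i, measurable_fun setT (fun w => u w 0 i)) ->
  measurable_fun setT (fun w => sqn (u w)).
Proof. by move=> mu; apply: measurable_sum => i; exact: measurable_funX. Qed.

(** Measurability is given for the distance to fixed points. For a random point [u] the distance is
    below [c] exactly when some rational point [r] has |u - r| + dist (r, A) < c, because the
    distance is 1-Lipschitz and rational points are dense. *)
Lemma measurable_dist_to {dd} {T : measurableType dd} {R : realType} {d}
    (A : T -> set 'rV[R]_d) (u : T -> 'rV[R]_d) :
  (forall w, A w !=set0) ->
  (forall x, measurable_fun setT (fun w => dist_to x (A w))) ->
  (forall i, measurable_fun setT (fun w => u w 0 i)) ->
  measurable_fun setT (fun w => dist_to (u w) (A w)).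
Proof.
move=> A0 mA mu.
apply: (measurability _ (RGenInftyO.measurableE R)).
move=> _ [_ [c ->] <-]; rewrite setTI.
rewrite (_ : _ @^-1` _ = \bigcup_(r : 'rV[rat]_d)
   [set w | enorm (u w - map_mx ratr r) + dist_to (map_mx ratr r) (A w) < c]).
  apply: countable_bigcupT_measurable => // r.
  have m1 : measurable_fun setT (fun w => enorm (u w - map_mx ratr r) + dist_to (map_mx ratr r) (A w)).
    apply: measurable_funD => //.
    have ms : measurable_fun setT (@Num.sqrt R).
      by apply: continuous_measurable_fun; exact: sqrt_continuous.
    apply: (measurableT_comp ms); apply: measurable_sqn => i; under eq_fun do rewrite !mxE.
    exact: measurable_funB.
  rewrite -[X in measurable X]setTI.
  rewrite (_ : [set w | _] = (fun w => enorm (u w - map_mx ratr r) +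
     dist_to (map_mx ratr r) (A w)) @^-1` `]-oo, c[%classic).
    by apply: m1.
  by apply/seteqP; split => w /=; rewrite in_itv.
apply/seteqP; split => w /=; rewrite in_itv/=.
  move=> h; have e0 : 0 < (c - dist_to (u w) (A w)) / 2 by rewrite divr_gt0// subr_gt0.
  have [r hr] := rat_dense (u w) e0; exists r => //=.
  have := dist_to_lip (map_mx ratr r) (u w) (A0 w).
  have -> : enorm (map_mx ratr r - u w) = enorm (u w - map_mx ratr r).
    by rewrite /enorm; congr Num.sqrt; apply: eq_bigr => i _; rewrite !mxE; ring.
  lra.
by move=> [r _ /=]; apply: le_lt_trans; exact: dist_to_lip.
Qed.

Lemma wiener_space_eq {R : realType} {n} (w w' : wiener_space R n) :
  path_of w = path_of w' -> w = w'.
Proof.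
case: w w' => [f cf f0] [g cg g0] /= fg; rewrite -fg in cg g0 *.
by rewrite (Prop_irrelevance cf cg) (Prop_irrelevance f0 g0).
Qed.

Lemma theta_0 {R : realType} {n} (w : wiener_space R n) : theta 0 w = w.
Proof. by apply: wiener_space_eq; apply/funext => s /=; rewrite addr0 path0 subr0. Qed.

(** * Measurability and shift invariance of the flow *)

Section flow.
Context {R : realType} {d n : nat}.
Local Notation Omega := (wiener_space R n).
Variables (sigma : R) (phi : R -> Omega -> 'rV[R]_d -> 'rV[R]_d).
Hypothesis hphi : is_sde_rds sigma phi.
Variables (P : probability (borel Omega) R) (hP : is_wiener_measure P).
Implicit Types (p q : 'rV[R]_d) (t : R) (w : Omega).

Lemma flow0 w p : phi 0 w p = p.
Proof. by have := traj0 w p hphi; rewrite /traj max_l. Qed.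

Lemma euler_flow t w p i : 0 < t ->
  euler (t / N%:R) sigma p (incr w 0 (t / N%:R)) N 0 i @[N --> \oo] --> phi t w p 0 i.
Proof.
move=> t0; apply/cvgrPdist_le => e e0.
have := euler_cvg t0 e0 (sde_sol w p hphi) (traj0 w p hphi).
apply: filterS2 (nbhs_infty_gt 0) => N N0 /(_ N i (leqnn N)).
rewrite distrC mulrCA divff ?mulr1 ?pnatr_eq0 -?lt0n// /traj max_l//.
exact: ltW.
Qed.

(** A pointwise limit of Euler iterates, each a measurable function of finitely many increments. *)
Lemma measurable_flow t p i : 0 <= t ->
  measurable_fun [set: borel Omega] ((fun w => phi t w p 0 i) : borel Omega -> R).
Proof.
rewrite le_eqVlt => /predU1P[<-|t0].
  apply: (eq_measurable_fun (cst (p 0 i))); last exact: measurable_cst.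
  by move=> w _; rewrite flow0.
apply: (@measurable_fun_cvg _ (borel Omega) R setT (fun N w => euler (t / N%:R) sigma p (incr w 0 (t / N%:R)) N 0 i)).
  move=> N; exact: (measurableT_comp (@measurable_euler R n d N (t / N%:R) sigma p N i (leqnn N))
    (@measurable_incr R n N 0 (t / N%:R))).
by move=> w _; exact: euler_flow.
Qed.

Lemma incr_theta tau w h : incr (theta tau w) 0 h = incr w tau h.
Proof.
apply/funext => j; rewrite /incr /= !add0r ![_ + tau]addrC.
by rewrite opprB addrA subrK.
Qed.

Lemma euler_flow_theta tau t w p i : 0 < t ->
  euler (t / N%:R) sigma p (incr w tau (t / N%:R)) N 0 i @[N --> \oo]
    --> phi t (theta tau w) p 0 i.
Proof.
move=> t0; have := @euler_flow t (theta tau w) p i t0.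
by under eq_fun do rewrite incr_theta.
Qed.

Lemma measurable_flow_theta tau t p i : 0 <= t ->
  measurable_fun [set: borel Omega] ((fun w => phi t (theta tau w) p 0 i) : borel Omega -> R).
Proof.
rewrite le_eqVlt => /predU1P[<-|t0].
  apply: (eq_measurable_fun (cst (p 0 i))); last exact: measurable_cst.
  by move=> w _; rewrite flow0.
apply: (@measurable_fun_cvg _ (borel Omega) R setT (fun N w => euler (t / N%:R) sigma p (incr w tau (t / N%:R)) N 0 i)).
  move=> N; exact: (measurableT_comp (@measurable_euler R n d N (t / N%:R) sigma p N i (leqnn N))
    (@measurable_incr R n N tau (t / N%:R))).
by move=> w _; exact: euler_flow_theta.
Qed.

Definition gap t w p q := sqn (phi t w q - phi t w p).

Lemma gap_ge0 t w p q : 0 <= gap t w p q. Proof. exact: sqn_ge0. Qed.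

Lemma measurable_gap t p q : 0 <= t ->
  measurable_fun [set: borel Omega] ((fun w => gap t w p q) : borel Omega -> R).
Proof.
move=> t0; apply: (@measurable_sqn _ (borel Omega)) => i; under eq_fun do rewrite !mxE.
by apply: measurable_funB; exact: measurable_flow.
Qed.

Lemma measurable_gap_theta tau t p q : 0 <= t ->
  measurable_fun [set: borel Omega] ((fun w => gap t (theta tau w) p q) : borel Omega -> R).
Proof.
move=> t0; apply: (@measurable_sqn _ (borel Omega)) => i; under eq_fun do rewrite !mxE.
by apply: measurable_funB; exact: measurable_flow_theta.
Qed.

Lemma cvg_sqn (u : nat -> 'rV[R]_d) (l : 'rV[R]_d) :
  (forall i, u N 0 i @[N --> \oo] --> l 0 i) -> sqn (u N) @[N --> \oo] --> sqn l.
Proof.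
move=> h; rewrite /sqn; elim: (index_enum _) => [|i s IH].
  by rewrite big_nil; under eq_fun do rewrite big_nil; exact: cvg_cst.
rewrite big_cons; under eq_fun do rewrite big_cons.
apply: cvgD => //; apply: (@continuous_cvg _ _ _ _ _ _ (fun x : R => x ^+ 2)) (h i).
exact: exprn_continuous.
Qed.

(** For each [N] the Euler approximations of both sides have the same expectation by [incr_shift].
    The Euler gap is unbounded, so it is cut at [M] to allow dominated convergence; the limit is at
    most [M] and is not affected. *)
Lemma gap_shift (M tau t : R) p q : 0 < t -> (forall w, gap t w p q <= M) ->
  (\int[P]_w (gap t (theta tau w) p q)%:E = \int[P]_w (gap t w p q)%:E)%E.
Proof.
move=> t0 gM.
have M0 : 0 <= M by exact: le_trans (gap_ge0 t point p q) (gM point).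
pose G N (xi : nat -> 'rV[R]_n) : R := Num.min M
  (sqn (euler (t / N%:R) sigma q xi N - euler (t / N%:R) sigma p xi N)).
have G0 N xi : 0 <= G N xi by rewrite /G le_min M0 sqn_ge0.
have mG N : measurable_fun [set: g_sigma_algebraType (boxes N)]
    ((G N) : g_sigma_algebraType (boxes N) -> R).
  apply: (@measurable_minr _ (g_sigma_algebraType (boxes N)) R setT (cst M) (fun xi =>
    sqn (euler (t / N%:R) sigma q xi N - euler (t / N%:R) sigma p xi N))).
    exact: measurable_cst.
  apply: (@measurable_sqn _ (g_sigma_algebraType (boxes N))) => i.
  apply: (eq_measurable_fun (fun xi : g_sigma_algebraType (boxes N) =>
    euler (t / N%:R) sigma q xi N 0 i - euler (t / N%:R) sigma p xi N 0 i)).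
    by move=> xi _; rewrite !mxE.
  by apply: measurable_funB; apply: (@measurable_euler R n d N).
have L s : (\int[P]_w (G N (incr w s (t / N%:R)))%:E)%E @[N --> \oo] -->
    (\int[P]_w (gap t (theta s w) p q)%:E)%E.
  have [] := @dominated_convergence _ (borel Omega) R P setT measurableT
    (fun N w => (G N (incr w s (t / N%:R)))%:E) (fun w => (gap t (theta s w) p q)%:E) (cst M%:E).
  - move=> N; apply/measurable_EFinP.
    exact: (measurableT_comp (mG N) (@measurable_incr R n N s (t / N%:R))).
  - by apply/measurable_EFinP; apply: measurable_gap_theta; exact: ltW.
  - apply/aeW => w _; apply: cvg_EFin; first by near=> N.
    rewrite (_ : gap _ _ _ _ = Num.min M (gap t (theta s w) p q)); last first.
      by rewrite min_r.
    apply: (@continuous_cvg _ _ _ _ _ _ (fun x => Num.min M x)).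
      by apply: continuous_min; [exact: cvg_cst|exact: cvg_id].
    apply: cvg_sqn => i; under eq_fun do rewrite !mxE; rewrite !mxE.
    by apply: cvgB; exact: euler_flow_theta.
  - exact: finite_measure_integrable_cst.
  - apply/aeW => w N _; rewrite gee0_abs ?lee_fin// /G ge_min lexx//.
  - by [].
have E : {near \oo, (fun N => \int[P]_w (G N (incr w tau (t / N%:R)))%:E)%E =1
     (fun N => \int[P]_w (G N (incr w 0 (t / N%:R)))%:E)%E}.
  near=> N; have N0 : (0 < N)%N by near: N; exact: nbhs_infty_gt.
  apply: (@incr_shift R n P hP N tau (t / N%:R) (fun xi => (G N xi)%:E)).
  - by rewrite divr_gt0// ltr0n.
  - by apply/measurable_EFinP; exact: mG.
  - by move=> y; rewrite lee_fin.
have h : (\int[P]_w (G N (incr w 0 (t / N%:R)))%:E)%E @[N --> \oo] -->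
    (\int[P]_w (gap t (theta tau w) p q)%:E)%E.
  by apply: cvg_trans (L tau); apply: near_eq_cvg E.
rewrite (cvg_unique _ h (L 0)).
by apply: eq_integral => w _; rewrite theta_0.
Unshelve. all: by end_near. Qed.

End flow.

(** * Synchronization and time averages *)

Section contraction.
Context {R : realType} {d n : nat}.
Local Notation Omega := (wiener_space R n).
Variables (sigma : R) (phi : R -> Omega -> 'rV[R]_d -> 'rV[R]_d).
Hypothesis hphi : is_sde_rds sigma phi.
Variables (P : probability (borel Omega) R) (hP : is_wiener_measure P).

Lemma synchronization_weak : synchronization P phi -> weak_synchronization P phi.
Proof.
move=> [A [[h1 h2 h3] hA]]; exists A; split => //; split => // x eps e0.
have := h3 [set x] (@compact_set1 _ x) eps e0.
by under eq_fun do under eq_fun do rewrite image_set1 sup1.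
Qed.

(** Outside the events where the image of [p] or [q] is farther than eps from the attractor, both
    pullback images are within eps of the same point and the gap is at most 4 eps^2; on these events
    it is at most [M], and their probability tends to 0. [gap_shift] carries the estimate from the
    pullback to the forward gap. *)
Lemma weak_sync_gap (p q : 'rV[R]_d) (M : R) : weak_synchronization P phi ->
  (forall t w, 0 <= t -> gap phi t w p q <= M) ->
  (\int[P]_w (gap phi k%:R w p q)%:E)%E @[k --> \oo] --> 0%E.
Proof.
move=> [A [[[A0 _ mA] _ hA] [N [mN PN hN]]]] gM.
have M0 : 0 <= M by exact: le_trans (gap_ge0 phi 0 point p q) (gM 0 point (lexx _)).
pose X x (t : R) w := dist_to (phi t (theta (- t) w) x) (A w).
pose E x t eps := [set w : borel Omega | eps < `|X x t w|].
have mE x t eps : 0 <= t -> measurable (E x t eps).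
  move=> t0.
  have mX : measurable_fun [set: borel Omega] ((fun w => X x t w) : borel Omega -> R).
    apply: (@measurable_dist_to _ (borel Omega)) => // i.
    exact: (measurable_flow_theta hphi).
  have mX' : measurable_fun [set: borel Omega] ((fun w => `|X x t w|) : borel Omega -> R).
    exact: (measurableT_comp (@normr_measurable _ _) mX).
  rewrite -[X in measurable X]setTI.
  rewrite (_ : E x t eps = (fun w => `|X x t w|) @^-1` `]eps, +oo[%classic).
    by apply: mX'.
  by apply/seteqP; split => w /=; rewrite in_itv/= andbT.
have bound k eps : 0 < eps -> (0 < k)%N ->
    (\int[P]_w (gap phi k%:R w p q)%:E <=
     (4 * eps ^+ 2)%:E + M%:E * (P (E p k%:R eps) + P (E q k%:R eps)))%E.
  move=> e0 k0.
  have kR : (0 : R) <= k%:R by [].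
  have kR1 : (0 : R) < k%:R by rewrite ltr0n.
  rewrite -(gap_shift hphi hP (M := M) (- k%:R) kR1); last by move=> w; exact: gM.
  pose F := E p k%:R eps `|` E q k%:R eps `|` N.
  have mF : measurable F by apply: measurableU => //; apply: measurableU; exact: mE.
  apply: (@le_trans _ _ (\int[P]_w ((4 * eps ^+ 2)%:E + M%:E * (\1_F w)%:E)%E)%E).
    apply: ge0_le_integral => //.
    - by move=> w _; rewrite lee_fin gap_ge0.
    - by apply/measurable_EFinP; exact: (measurable_gap_theta hphi).
    - apply: emeasurable_funD => //; apply: emeasurable_funM => //.
      by apply/measurable_EFinP; exact: measurable_indic.
    - move=> w _; rewrite -EFinM -EFinD lee_fin indicE.
      have [wF|wF] := boolP (w \in F).
        rewrite mulr1; apply: le_trans (gM _ _ kR) _; rewrite lerDr.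
        by rewrite mulr_ge0// sqr_ge0.
      rewrite mulr0 addr0; move/negP : wF; rewrite inE => wF.
      have wN : ~ N w by move=> h; apply: wF; right.
      have [a Aa] : exists a, A w = [set a].
        by apply: contrapT => h; apply: wN; exact: hN.
      have S x : ~ E x k%:R eps w -> sqn (phi k%:R (theta (- k%:R) w) x - a) <= eps ^+ 2.
        rewrite /E/= /X Aa dist_to1 => /negP; rewrite -leNgt ger0_norm ?enorm_ge0// => h.
        by rewrite -enorm_sqr lerXn2r ?nnegrE ?enorm_ge0// ltW.
      have h1 : sqn (phi k%:R (theta (- k%:R) w) p - a) <= eps ^+ 2.
        by apply: S => h; apply: wF; left; left.
      have h2 : sqn (phi k%:R (theta (- k%:R) w) q - a) <= eps ^+ 2.
        by apply: S => h; apply: wF; left; right.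
      have := sqnB_le (phi k%:R (theta (- k%:R) w) q - a) (phi k%:R (theta (- k%:R) w) p - a).
      rewrite opprB addrA subrK /gap; lra.
  rewrite ge0_integralD//; last 3 first.
  - by move=> w _; rewrite lee_fin mulr_ge0// sqr_ge0.
  - by move=> w _; rewrite -EFinM lee_fin mulr_ge0// indicE.
  - apply: emeasurable_funM => //.
    by apply/measurable_EFinP; exact: measurable_indic.
  rewrite integral_cst// [X in (_ * X + _)%E](probability_setT P) mule1 leeD2l//.
  rewrite ge0_integralZl//; last first.
  - by apply/measurable_EFinP; exact: measurable_indic.
  rewrite lee_wpmul2l ?lee_fin// integral_indic// setIT.
  apply: le_trans (measureU2 _ _ _) _ => //.
    by apply: measurableU; exact: mE.
  by rewrite [X in (_ + X <= _)%E]PN adde0; apply: measureU2; exact: mE.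
have cE x eps : 0 < eps -> P (E x k%:R eps) @[k --> \oo] --> 0%E.
  move=> e0; have := hA x eps e0.
  exact: (cvg_comp _ _ (@cvgr_idn R)).
apply/fine_cvgP; split.
  near=> k; have k0 : (0 < k)%N by near: k; exact: nbhs_infty_gt.
  rewrite ge0_fin_numE ?integral_ge0//; last by move=> w _; rewrite lee_fin gap_ge0.
  apply: le_lt_trans (bound k 1 ltr01 k0) _.
  by rewrite lte_add_pinfty ?ltry// lte_mul_pinfty// lte_add_pinfty//;
    apply: le_lt_trans (probability_le1 P (mE _ _ _ _)) _; rewrite ?ltry.
apply/cvgrPdist_le => e e0.
(* The error is split into 4 eps^2 = e / 2 and 2 M dl <= e / 2; dividing by [M + 1] covers the case
   M = 0. *)
pose eps := Num.sqrt (e / 8); have eps0 : 0 < eps by rewrite sqrtr_gt0 divr_gt0.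
have epsE : 4 * eps ^+ 2 = e / 2 by rewrite sqr_sqrtr ?divr_ge0 ?(ltW e0)//; field.
pose dl := e / 4 / (M + 1).
have M1 : 0 < M + 1 by rewrite ltr_wpDl.
have dl0 : 0 < dl by rewrite !divr_gt0.
have small x : \forall k \near \oo, (P (E x k%:R eps) <= dl%:E)%E.
  have /fine_cvgP[f1 f2] := cE x eps eps0.
  have /cvgrPdist_le/(_ dl dl0) := f2; apply: filterS2 f1 => k fk.
  rewrite sub0r normrN => h; rewrite -(fineK fk) lee_fin.
  exact: le_trans (ler_norm _) h.
near=> k.
have k0 : (0 < k)%N by near: k; exact: nbhs_infty_gt.
rewrite sub0r normrN ger0_norm; last first.
  by apply: fine_ge0; apply: integral_ge0 => w _; rewrite lee_fin gap_ge0.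
have b : (\int[P]_w (gap phi k%:R w p q)%:E <= e%:E)%E.
  apply: le_trans (bound k eps eps0 k0) _.
  have h1 : (P (E p k%:R eps) <= dl%:E)%E by near: k; exact: small.
  have h2 : (P (E q k%:R eps) <= dl%:E)%E by near: k; exact: small.
  apply: (@le_trans _ _ ((e / 2)%:E + M%:E * (dl%:E + dl%:E))%E).
    by rewrite epsE leeD2l// lee_wpmul2l ?lee_fin// leeD.
  rewrite -[leLHS]/((e / 2 + M * (dl + dl))%:E) lee_fin.
  have : M * dl <= e / 4.
    rewrite /dl mulrCA ger_pMr ?divr_gt0// ler_pdivrMr// mul1r lerDl//.
  lra.
rewrite -lee_fin fineK// ge0_fin_numE; first exact: le_lt_trans b (ltry _).
by apply: integral_ge0 => w _; rewrite lee_fin gap_ge0.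
Unshelve. all: by end_near. Qed.

End contraction.

(** By Tonelli the measures of the sections of a null set integrate to 0, so almost every section is
    null. *)
Lemma ae_section d1 d2 (T1 : measurableType d1) (T2 : measurableType d2) (R : realType)
    (m1 : probability T1 R) (m2 : probability T2 R) (Q : T1 * T2 -> Prop) :
  {ae (m1 \x m2)%E, forall z, Q z} -> {ae m2, forall y, {ae m1, forall x, Q (x, y)}}.
Proof.
move=> [N [mN N0 hN]].
have mf : measurable_fun setT (EFin \o (\1_N : T1 * T2 -> R)).
  by apply/measurable_EFinP; exact: measurable_indic.
have f0 (z : T1 * T2) : (0 <= (EFin \o (\1_N : T1 * T2 -> R)) z)%E.
  by rewrite /= lee_fin indicE.
have := @fubini_tonelli2 _ _ T1 T2 R m1 m2 _ mf f0.
rewrite integral_indic// setIT [LHS]N0 => /esym E.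
have mG : measurable_fun setT (fubini_G m1 (EFin \o (\1_N : T1 * T2 -> R))).
  exact: measurable_fun_fubini_tonelli_G.
have /(ae_eq_integral_abs m2 measurableT mG) H :
    (\int[m2]_y `|fubini_G m1 (EFin \o (\1_N : T1 * T2 -> R)) y| = 0)%E.
  rewrite -[RHS]E; apply: eq_integral => y _; rewrite gee0_abs//.
  by apply: integral_ge0.
apply: filterS H => y /(_ I) hy.
have mfy : measurable_fun setT (fun x => (EFin \o (\1_N : T1 * T2 -> R)) (x, y)).
  by apply: (measurableT_comp mf); exact: measurable_fun_pair.
have /(ae_eq_integral_abs m1 measurableT mfy) Hy :
    (\int[m1]_x `|(EFin \o (\1_N : T1 * T2 -> R)) (x, y)| = 0)%E.
  rewrite -[RHS]hy; apply: eq_integral => x _; rewrite gee0_abs//.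
apply: filterS Hy => x /(_ I) /= [hx].
apply: contrapT => nQ; have : N (x, y) by exact: hN.
by move: hx; rewrite indicE; case: (boolP (_ \in _)) => [_ /eqP|/negP + _]; rewrite ?oner_eq0// inE.
Qed.

(** The time from which [c <= f m] holds depends on [w]. Cutting at [c] makes min c f_m converge
    boundedly to [c], while the integrals stay below [b]. This confronts an almost sure lower bound
    with an upper bound in mean. *)
Lemma eventually_ge_integral dd (T : measurableType dd) (R : realType) (P : probability T R)
    (f : nat -> T -> R) (c b : R) : 0 <= c ->
  (forall m, measurable_fun setT (f m)) -> (forall m w, 0 <= f m w) ->
  {ae P, forall w, \forall m \near \oo, c <= f m w} ->
  (\forall m \near \oo, (\int[P]_w (f m w)%:E <= b%:E)%E) -> c <= b.
Proof.
move=> c0 mf f0 cf fb.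
have [] := @dominated_convergence _ T R P setT measurableT
  (fun m w => (Num.min c (f m w))%:E) (cst c%:E) (cst c%:E).
- move=> m; apply/measurable_EFinP.
  by apply: (@measurable_minr _ T R setT (cst c) (f m)) => //; exact: measurable_cst.
- exact: measurable_cst.
- apply: filterS cf => w cw _; apply: cvg_near_cst.
  by apply: filterS cw => m cm; rewrite min_l.
- exact: finite_measure_integrable_cst.
- apply/aeW => w m _; rewrite gee0_abs ?lee_fin ?ge_min ?lexx// le_min c0/=; exact: f0.
move=> _ _; rewrite integral_cst// [X in (_ * X)%E](probability_setT P) mule1 => L.
rewrite -lee_fin; apply: (cvge_to_le L); apply: filterS fb => m; apply: le_trans.
apply: ge0_le_integral => //.
- by move=> w _; rewrite lee_fin le_min c0/=.
- apply/measurable_EFinP.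
  by apply: (@measurable_minr _ T R setT (cst c) (f m)) => //; exact: measurable_cst.
- exact/measurable_EFinP.
- by move=> w _; rewrite lee_fin ge_min lexx orbT.
Qed.

Lemma near_infty_pred (Q : nat -> Prop) :
  (\forall m \near \oo, Q m.+1) -> \forall m \near \oo, Q m.
Proof.
move=> [N _ h]; exists N.+1 => // -[|m]//= Nm; exact: h.
Qed.

Lemma pad_out {R : realType} {d n} (x : 'rV[R]_n) (i : 'I_d) : (n <= i)%N -> pad x 0 i = 0.
Proof. by move=> ni; rewrite mxE insubN// -leqNgt. Qed.

Lemma sqn_delta {R : realType} {d} (i : 'I_d) : sqn (delta_mx 0 i : 'rV[R]_d) = 1.
Proof.
rewrite /sqn (bigD1 i)//= big1 ?addr0 => [|j ji]; rewrite mxE !eqxx ?expr1n//=.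
by rewrite (negbTE ji) expr0n.
Qed.

(** * Positive growth excludes weak synchronization *)

Section separation.
Context {R : realType} {d n : nat}.
Local Notation Omega := (wiener_space R n).
Variables (sigma : R) (phi : R -> Omega -> 'rV[R]_d -> 'rV[R]_d).
Hypothesis hphi : is_sde_rds sigma phi.
Variables (P : probability (borel Omega) R) (hP : is_wiener_measure P).
Variables (i0 : 'I_d) (ni0 : (n <= i0)%N) (p : 'rV[R]_d) (pi0 : p 0 i0 = 0).

Let q := p + delta_mx 0 i0.
Let eta (w : Omega) := fun t : R => sigma *: (pad (w t) : 'rV[R]_d).

Let eta0 w : eta w 0 = 0.
Proof.
apply/rowP => j; rewrite /eta path0 !mxE.
by case: insubP => [k _ _|_]; rewrite ?mxE mulr0.
Qed.

Let etai w s : eta w s 0 i0 = 0.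
Proof. by rewrite mxE pad_out// mulr0. Qed.

Let qi1 : q 0 i0 = 1. Proof. by rewrite /q !mxE pi0 !eqxx add0r. Qed.

Let pq1 : sqn (q - p) = 1. Proof. by rewrite /q addrC addKr sqn_delta. Qed.

Lemma gap_le4 t w : 0 <= t -> gap phi t w p q <= 4.
Proof.
move=> t0; have sz := sde_sol w q hphi; have sx := sde_sol w p hphi.
have := dist_le4 sz sx (eta0 w) (etai w) pi0 qi1 pq1 t0.
by rewrite /traj max_l.
Qed.

Lemma growth_le_gap m w : growth (traj phi w p) m%:R <=
  ln 2 + expR 2 * \sum_(k < m) gap phi k%:R w p q.
Proof.
have sz := sde_sol w q hphi; have sx := sde_sol w p hphi.
have := growth_le_sum sz sx (eta0 w) (etai w) pi0 qi1 pq1 m.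
by under eq_bigr do rewrite /traj max_l//.
Qed.

(** A majorant of growth / m that is nonnegative and visibly measurable, as [eventually_ge_integral]
    requires. *)
Definition separation_bound (m : nat) w : R :=
  m%:R^-1 * (ln 2 + expR 2 * \sum_(k < m) gap phi k%:R w p q).

Lemma separation_bound_ge0 m w : 0 <= separation_bound m w.
Proof.
rewrite mulr_ge0// addr_ge0 ?mulr_ge0 ?expR_ge0 ?ln_ge0 ?ler1n//.
by apply: sumr_ge0 => k _; exact: gap_ge0.
Qed.

Lemma growth_le_bound m w : m%:R^-1 * growth (traj phi w p) m%:R <= separation_bound m w.
Proof. by rewrite ler_wpM2l//; exact: growth_le_gap. Qed.

Lemma measurable_separation_bound m :
  measurable_fun [set: borel Omega] (separation_bound m : borel Omega -> R).
Proof.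
apply: measurable_funM => //; apply: measurable_funD => //; apply: measurable_funM => //.
by apply: measurable_sum => k; exact: (measurable_gap hphi).
Qed.

(** The mean is ln 2 / m plus e^2 times the Cesàro mean of the expected gaps, which tend to 0. *)
Lemma sync_separation_bound (e : R) : weak_synchronization P phi -> 0 < e ->
  \forall m \near \oo, (\int[P]_w (separation_bound m w)%:E <= e%:E)%E.
Proof.
move=> ws e0.
have := weak_sync_gap hphi hP ws (fun t w t0 => gap_le4 w t0).
pose a k := (\int[P]_w (gap phi k%:R w p q)%:E)%E.
have a0 k : (0 <= a k)%E by apply: integral_ge0 => w _; rewrite lee_fin gap_ge0.
have afin k : a k \is a fin_num.
  rewrite ge0_fin_numE//; apply: (@le_lt_trans _ _ (\int[P]_w (cst 4%:E w))%E).
    apply: ge0_le_integral => //.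
    - by move=> w _; rewrite lee_fin gap_ge0.
    - by apply/measurable_EFinP; exact: (measurable_gap hphi).
    - by move=> w _; rewrite lee_fin gap_le4.
  by rewrite integral_cst// [X in (_ * X)%E](probability_setT P) mule1 ltry.
move=> /fine_cvgP[_ /cesaro].
pose u k := fine (a k); rewrite -/u => cu.
have E m : (\int[P]_w (separation_bound m w)%:E)%E =
    (m%:R^-1 * (ln 2 + expR 2 * \sum_(k < m) u k))%:E.
  have ms : measurable_fun [set: borel Omega]
      ((fun w => \sum_(k < m) gap phi k%:R w p q) : borel Omega -> R).
    by apply: measurable_sum => k; exact: (measurable_gap hphi).
  have s0 w : 0 <= \sum_(k < m) gap phi k%:R w p q.
    by apply: sumr_ge0 => k _; exact: gap_ge0.
  under eq_integral do rewrite /separation_bound EFinM.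
  rewrite ge0_integralZl//; last 2 first.
  - by apply/measurable_EFinP; apply: measurable_funD => //; apply: measurable_funM.
  - by move=> w _; rewrite lee_fin addr_ge0 ?ln_ge0 ?ler1n// mulr_ge0 ?expR_ge0.
  rewrite EFinM; congr (_ * _)%E.
  under eq_integral do rewrite EFinD.
  rewrite ge0_integralD//; last 3 first.
  - by move=> w _; rewrite lee_fin ln_ge0// ler1n.
  - by move=> w _; rewrite lee_fin mulr_ge0 ?expR_ge0.
  - by apply/measurable_EFinP; apply: measurable_funM.
  rewrite integral_cst// [X in (_ * X + _)%E](probability_setT P) mule1 EFinD; congr (_ + _)%E.
  under eq_integral do rewrite EFinM.
  rewrite ge0_integralZl//; last 2 first.
  - exact/measurable_EFinP.
  - by move=> w _; rewrite lee_fin.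
  rewrite EFinM; congr (_ * _)%E.
  under eq_integral do rewrite -sumEFin.
  rewrite ge0_integral_sum//.
  - by rewrite -sumEFin; apply: eq_bigr => k _; rewrite /u fineK//; exact: afin.
  - by move=> k; apply/measurable_EFinP; exact: (measurable_gap hphi).
  - by move=> k w _; rewrite lee_fin gap_ge0.
(* [arithmetic_mean u m] averages the m + 1 terms up to index m, hence the passage to [m.+1]. *)
apply: near_infty_pred.
have h1 : \forall m \near \oo, m.+1%:R^-1 * ln 2 <= e / 2.
  near=> m; rewrite mulrC ler_pdivrMr ?ltr0n// -ler_pdivrMl ?divr_gt0//.
  apply: (@le_trans _ _ m%:R); last by rewrite ler_nat.
  by near: m; exact: nbhs_infty_ger.
have e2 : 0 < e / 2 / expR 2 by rewrite !divr_gt0// expR_gt0.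
have /cvgrPdist_le/(_ _ e2) h2 := cu.
near=> m; rewrite E lee_fin mulrDr.
have k1 : m.+1%:R^-1 * ln 2 <= e / 2 by near: m.
have : `|0 - arithmetic_mean u m| <= e / 2 / expR 2 by near: m; exact: h2.
rewrite sub0r normrN => /(le_trans (ler_norm _)).
rewrite ler_pdivlMr ?expR_gt0// /arithmetic_mean /= /series/= big_mkord => k2.
have -> : e = e / 2 + e / 2 by rewrite -splitr.
by rewrite lerD// mulrCA mulrC.
Unshelve. all: by end_near. Qed.

Lemma no_weak_sync (l : R) : 0 < l ->
  {ae P, forall w, \forall m \near \oo, l <= m%:R^-1 * growth (traj phi w p) m%:R} ->
  ~ weak_synchronization P phi.
Proof.
move=> l0 hl ws.
have l2 : 0 < l / 2 by rewrite divr_gt0.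
have : l <= l / 2.
  apply: (@eventually_ge_integral _ (borel Omega) R P separation_bound _ _ (ltW l0)
    measurable_separation_bound separation_bound_ge0 _ (sync_separation_bound ws l2)).
  have [N [mN PN hN]] := hl; exists N; split=> // w /= h; apply: hN => /= h2; apply: h.
  by apply: filterS h2 => m /le_trans; apply; exact: growth_le_bound.
lra.
Qed.

End separation.

(** Young's inequality in each coordinate: the coefficient of |x|^2 is as small as desired, at the
    price of 1 / a in front of the perturbation. *)
Lemma sqnB_young {R : realType} {d} (x z : 'rV[R]_d) (a : R) : 0 < a ->
  `|sqn z - sqn x| <= a * sqn x + (a^-1 + 1) * sqn (z - x).
Proof.
move=> a0; rewrite /sqn -sumrB !mulr_sumr -big_split/=.
apply: le_trans (ler_norm_sum _ _ _) _; apply: ler_sum => i _; rewrite !mxE.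
set u := x 0 i; set v := z 0 i; have [e ->] : exists e, v = u + e by exists (v - u); ring.
rewrite (_ : u + e - u = e); last by ring.
have h : 2 * `|u * e| <= a * u ^+ 2 + a^-1 * e ^+ 2.
  have : 0 <= a^-1 * (a * `|u| - `|e|) ^+ 2 by rewrite mulr_ge0 ?sqr_ge0// invr_ge0 ltW.
  rewrite -(real_normK (num_real u)) -(real_normK (num_real e)) normrM.
  move=> h; rewrite -subr_ge0; apply: le_trans h _; rewrite le_eqVlt; apply/orP; left.
  by apply/eqP; field; rewrite lt0r_neq0.
rewrite (_ : _ - _ = 2 * (u * e) + e ^+ 2); last by ring.
apply: le_trans (ler_normD _ _) _; rewrite normrM ger0_norm// (ger0_norm (sqr_ge0 e)).
by lra.
Qed.

(** * Dependence on the starting point and the derivative of the flow *)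

Section growth_close.
Context {R : realType} {d n : nat}.
Local Notation Omega := (wiener_space R n).
Variables (sigma : R) (phi : R -> Omega -> 'rV[R]_d -> 'rV[R]_d).
Hypothesis hphi : is_sde_rds sigma phi.

Lemma gap_expR (t T : R) w (p q : 'rV[R]_d) : 0 <= t <= T ->
  gap phi t w p q <= sqn (q - p) * expR (2 * T).
Proof.
move=> /andP[t0 tT].
have sz := sde_sol w q hphi; have sx := sde_sol w p hphi.
have := dist_expR sz sx (s := 0) (t := t); rewrite lexx => /(_ t0).
rewrite (traj0 _ _ hphi) (traj0 _ _ hphi) /traj max_l// => /le_trans; apply.
by rewrite ler_wpM2l ?sqn_ge0// ler_expR subr0 ler_pM2l.
Qed.

(** Up to time T, squared distances grow by a factor of at most e^(2 T). In [sqnB_young] the choice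
    of [a] absorbs half of the error through the bound [B] on the path, and [dl] absorbs the other
    half. Using [T + 1] keeps the divisors positive at T = 0. *)
Lemma growth_close (T : R) w (p : 'rV[R]_d) (e : R) : 0 <= T -> 0 < e ->
  exists2 dl, 0 < dl & forall q, sqn (q - p) <= dl ->
    `|growth (traj phi w q) T - growth (traj phi w p) T| <= e.
Proof.
move=> T0 e0; have sx := sde_sol w p hphi.
have [B0 hB0] := segment_bounded T (sqn_continuous sx.1).
pose B := 1 + `|B0|; have Bp : 0 < B by rewrite ltr_pwDl.
have hB t : 0 <= t <= T -> sqn (traj phi w p t) <= B.
  by move=> /hB0/le_trans; apply; apply: le_trans (ler_norm _) _; rewrite lerDr.
pose a := e / 2 / ((T + 1) * B).
have T1 : 0 < T + 1 by rewrite ltr_wpDl.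
have a0 : 0 < a by rewrite !divr_gt0// mulr_gt0.
pose K := (a^-1 + 1) * expR (2 * T).
have K0 : 0 < K by rewrite mulr_gt0 ?expR_gt0// addr_gt0// invr_gt0.
exists (e / 2 / ((T + 1) * K)); first by rewrite !divr_gt0// mulr_gt0.
move=> q hq; have sz := sde_sol w q hphi.
have H t : 0 <= t <= T -> is_derive t 1 (growth (traj phi w q) - growth (traj phi w p))
    (sqn (traj phi w p t) - sqn (traj phi w q t)).
  move=> /andP[t0 _].
  apply: (is_derive_eq (is_deriveB (is_derive_growth sz.1 t0) (is_derive_growth sx.1 t0))).
  by ring.
have [c cT] := derive_mvt T0 H.
rewrite !fctE (growth0 sz.1) (growth0 sx.1) !subr0 => ->.
rewrite normrM (ger0_norm T0) distrC.
have h1 := sqnB_young (traj phi w p c) (traj phi w q c) a0.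
have h2 : sqn (traj phi w q c - traj phi w p c) <= sqn (q - p) * expR (2 * T).
  by rewrite /traj max_l; [exact: gap_expR|case/andP: cT].
have h3 : `|sqn (traj phi w q c) - sqn (traj phi w p c)| <= a * B + K * sqn (q - p).
  apply: le_trans h1 _; rewrite lerD ?ler_pM2l ?hB//.
  rewrite /K -mulrA ler_wpM2l ?addr_ge0 ?invr_ge0 ?(ltW a0)//.
  by rewrite mulrC.
have h4 : (T + 1) * (a * B) = e / 2.
  by rewrite /a; field; rewrite !lt0r_neq0.
have h5 : (T + 1) * (K * sqn (q - p)) <= e / 2.
  by rewrite mulrA mulrC -ler_pdivlMr ?(mulr_gt0 T1 K0).
have h6 : 0 <= a * B + K * sqn (q - p).
  by rewrite addr_ge0// mulr_ge0 ?(ltW a0) ?(ltW Bp) ?(ltW K0) ?sqn_ge0.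
rewrite mulrC; apply: le_trans (ler_wpM2l T0 h3) _.
rewrite -[leRHS](_ : e / 2 + e / 2 = e); last by rewrite -splitr.
rewrite -{1}h4; apply: le_trans (lerD (lexx _) h5).
by rewrite -mulrDr ler_wpM2r// lerDl.
Qed.

Lemma gap_growth (t : R) w (p q : 'rV[R]_d) : 0 <= t ->
  gap phi t w p q <=
  sqn (q - p) * expR (growth (traj phi w q) t + growth (traj phi w p) t).
Proof.
move=> t0; have := dist_growth (sde_sol w q hphi) (sde_sol w p hphi) t0.
by rewrite (traj0 _ _ hphi) (traj0 _ _ hphi) /traj max_l.
Qed.

Lemma sqnZ (a : R) (x : 'rV[R]_d) : sqn (a *: x) = a ^+ 2 * sqn x.
Proof. by rewrite /sqn mulr_sumr; apply: eq_bigr => i _; rewrite mxE exprMn. Qed.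

(** In the difference quotients along [v], [gap_growth] gives the exponent growth at h v + p plus
    growth at p; continuity of growth in the starting point replaces the former by the latter up to
    [e]. *)
Lemma diff_growth (t : R) w (p v : 'rV[R]_d) (e : R) : 0 <= t -> 0 < e ->
  sqn ('d (phi t w) p v) <= sqn v * expR (2 * growth (traj phi w p) t + e).
Proof.
move=> t0 e0.
(* ['d] is obtained by choice and is the zero map where no differential exists. *)
have [df|ndf] := pselect (differentiable (phi t w) p); last first.
  have -> : 'd (phi t w) p v = 0.
    rewrite /diff; set Q := (X in get X).
    have [hQ|nQ] := pselect (exists df, Q df); last by rewrite xgetPN// => df Qdf; apply: nQ; exists df.
    by exfalso; apply: ndf; apply/diffP; exact: (xgetPex point hQ).
  rewrite (_ : sqn 0 = 0) ?mulr_ge0 ?sqn_ge0 ?expR_ge0//.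
  by rewrite /sqn big1// => i _; rewrite mxE expr0n.
have /(diff_derivable (v := v)) dv := df.
have cs : continuous (@sqn R d) by exact: (@sqn_continuous _ _ _ id (fun x => cvg_id)).
have L : sqn (h^-1 *: ((phi t w \o shift p) (h *: v) - phi t w p)) @[h --> 0^']
    --> sqn ('d (phi t w) p v).
  by rewrite -deriveE//; exact: (cvg_comp _ _ dv (cs _)).
have [dl dl0 hdl] := growth_close w p t0 e0.
apply: (cvgr_to_le L); near=> h.
have h0 : h != 0 by near: h; exact: nbhs_dnbhs_neq.
have hq : sqn (h *: v) <= dl.
  near: h; have ch : continuous (fun h : R => sqn (h *: v)).
    by move=> h; apply: (@continuous_comp _ _ _ (fun h : R => h *: v) _ h _ (cs _)); exact: scalel_continuous.
  have /cvgrPdist_le/(_ dl dl0) := ch 0.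
  rewrite scale0r (_ : sqn 0 = 0); last by rewrite /sqn big1// => i _; rewrite mxE expr0n.
  move=> /nbhs_dnbhs; apply: filterS => h; rewrite sub0r normrN.
  exact: le_trans (ler_norm _).
have {}hdl := hdl (h *: v + p); rewrite addrK in hdl; have {}hdl := hdl hq.
rewrite /= sqnZ.
have := gap_growth w p (h *: v + p) t0.
rewrite /gap addrK sqnZ => hg.
rewrite exprVn mulrC ler_pdivrMr; last by rewrite exprn_even_gt0//= h0.
apply: le_trans hg _; rewrite -[leLHS]mulrA [leRHS]mulrC.
rewrite ler_wpM2l ?sqr_ge0// ler_wpM2l ?sqn_ge0// ler_expR. have := le_trans (ler_norm _) hdl; lra.
Unshelve. all: by end_near. Qed.

(** A positive quotient excludes a vanishing derivative, for which [ln] takes its default value 0.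
    The loss in [diff_growth] is arbitrary and disappears. *)
Lemma lyapunov_quotient_le w (p v : 'rV[R]_d) (m : nat) : v != 0 ->
  0 < lyapunov_quotient phi w p v m ->
  lyapunov_quotient phi w p v m <=
    m%:R^-1 * (ln (enorm v) + growth (traj phi w p) m%:R).
Proof.
move=> v0; rewrite /lyapunov_quotient => q0.
rewrite ler_wpM2l//; set y := 'd _ _ _ in q0 *.
have s0 : 0 < sqn y.
  rewrite lt_neqAle sqn_ge0 andbT; apply/eqP => s0; move: q0.
  by rewrite /enorm -/(sqn y) -s0 sqrtr0 ln0// mulr0 ltxx.
have v1 : 0 < sqn v.
  rewrite lt_neqAle sqn_ge0 andbT eq_sym; apply: contra v0 => /eqP v0.
  apply/eqP/rowP => i; rewrite mxE; apply/eqP; rewrite -sqrf_eq0 eq_le sqr_ge0 andbT.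
  by rewrite -v0 ler_sqn.
have lnE (u : 'rV[R]_d) : 0 < sqn u -> ln (enorm u) = ln (sqn u) / 2.
  by move=> u0; rewrite -enorm_sqr lnXn ?sqrtr_gt0// -[ln _ *+ 2]mulr_natr mulfK.
rewrite !lnE//; apply/ler_addgt0Pr => e e0.
have := diff_growth w p v (ler0n _ m) (mulr_gt0 (ltr0n _ 2) e0 : 0 < 2 * e).
rewrite -/y -(@ler_ln _ (sqn y)) ?posrE ?mulr_gt0 ?expR_gt0//.
rewrite lnM ?posrE ?expR_gt0// expRK; lra.
Qed.

End growth_close.

(** * A positive top exponent *)

Section part1.
Context {R : realType} {d n : nat}.
Local Notation Omega := (wiener_space R n).
Variables (sigma : R) (phi : R -> Omega -> 'rV[R]_d -> 'rV[R]_d).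
Hypothesis hphi : is_sde_rds sigma phi.
Variables (P : probability (borel Omega) R) (hP : is_wiener_measure P).
Variables (rho : probability (borel 'rV[R]_d) R) (hrho : is_rho n sigma rho).

(** The points with a bad section and the complement of the noise subspace are both [rho]-null, so
    together they do not cover the space: one starting point serves for the rest of the argument. *)
Lemma rho_point (Q : Omega * 'rV[R]_d -> Prop) :
  {ae (P \x rho)%E, forall z : Omega * 'rV[R]_d, Q z} ->
  exists2 x : 'rV[R]_d, (forall i : 'I_d, (n <= i)%N -> x 0 i = 0) &
    {ae P, forall w : Omega, Q (w, x)}.
Proof.
move=> /(@ae_section _ _ (borel Omega) (borel 'rV[R]_d) R P rho Q)[N [mN N0 hN]].
have [_ Z0] := hrho.
set Z := (X in rho X) in Z0.
have mZ : measurable (Z : set (borel 'rV[R]_d)).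
  rewrite (_ : Z = \bigcup_(i in [set i : 'I_d | (n <= i)%N]) [set x : borel 'rV[R]_d | x 0 i != 0]); last first.
    by apply/seteqP; split => x [i ni xi]; exists i.
  apply: fin_bigcup_measurable => [|i _]; first exact: finite_finset.
  rewrite (_ : [set x : borel 'rV[R]_d | _] = (fun x : borel 'rV[R]_d => x 0 i) @^-1` (~` [set 0])).
    rewrite -[X in measurable X]setTI; apply: measurable_coord => //.
    exact: measurableC.
  by apply/seteqP; split => x /= /eqP.
have [x hx] : exists x, ~ (N `|` Z) x.
  apply: contrapT => /forallNP h.
  have : (rho [set: borel 'rV[R]_d] <= rho (N `|` Z))%E.
    apply: le_measure; rewrite ?inE//; first exact: measurableU.
    by move=> x _; apply: contrapT; exact: h.
  rewrite [X in (X <= _)%E](probability_setT rho) => /le_trans -/(_ _ (measureU2 rho mN mZ)).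
  by rewrite [X in (_ <= X + _)%E]N0 [X in (_ <= _ + X)%E]Z0 add0e lee_fin ler10.
exists x.
  move=> i ni; apply: contrapT => /eqP xi; apply: hx; right; by exists i.
by apply: contrapT => h; apply: hx; left; exact: hN.
Qed.

(** A quarter of [lambda] pays for the convergence of the quotient and a quarter for ln |v| / m. In
    between, the quotient is positive, as [lyapunov_quotient_le] requires. *)
Lemma growth_ge (w : Omega) (p v : 'rV[R]_d) (lambda : R) : 0 < lambda -> v != 0 ->
  lyapunov_quotient phi w p v m @[m --> \oo] --> lambda ->
  \forall m \near \oo, lambda / 2 <= m%:R^-1 * growth (traj phi w p) m%:R.
Proof.
move=> l0 v0 L; have l4 : 0 < lambda / 4 by rewrite divr_gt0.
have /cvgrPdist_le/(_ _ l4) H := L.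
near=> m.
have h1 : `|lambda - lyapunov_quotient phi w p v m| <= lambda / 4 by near: m.
have h2 : lambda - lyapunov_quotient phi w p v m <= lambda / 4 := le_trans (ler_norm _) h1.
have m0 : 0 < m%:R :> R by rewrite ltr0n; near: m; exact: nbhs_infty_gt.
have h3 : m%:R^-1 * ln (enorm v) <= lambda / 4.
  rewrite mulrC ler_pdivrMr// -ler_pdivrMl//.
  by near: m; exact: nbhs_infty_ger.
have := lyapunov_quotient_le hphi (w := w) (p := p) (m := m) v0.
rewrite mulrDr; have q0 : 0 < lyapunov_quotient phi w p v m by lra.
move=> /(_ q0); lra.
Unshelve. all: by end_near. Qed.

Lemma positive_exponent_no_sync (i0 : 'I_d) (lambda : R) : (n <= i0)%N ->
  is_top_lyapunov_exponent P rho phi lambda -> 0 < lambda ->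
  ~ weak_synchronization P phi.
Proof.
move=> ni0 [s [_ /rho_point[p hp [N [mN N0 hN]]]]] l0.
have l2 : 0 < lambda / 2 by rewrite divr_gt0.
apply: (no_weak_sync hphi hP ni0 (hp _ ni0) l2).
exists N; split => // w /= h; apply: hN => /= -[_ h2]; apply: h.
have [v v0 L] := h2 lambda (mem_head _ _).
exact: growth_ge L.
Qed.

End part1.

(** * A Lyapunov function for one-dimensional noise *)

Section gaussian.
Context {R : realType}.
Local Notation mu := (@lebesgue_measure R).
Implicit Types (m s t x z v : R).

(** The Radon-Nikodym derivative is the Gaussian density almost everywhere, since both have the same
    integral over every measurable set. *)
Lemma integral_normal_prob m s (f : R -> \bar R) : s != 0 ->
  measurable_fun setT f -> (forall x, (0 <= f x)%E) ->
  (\int[normal_prob m s]_x f x = \int[mu]_x (f x * (normal_pdf m s x)%:E))%E.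
Proof.
move=> s0 mf f0.
have dom := normal_prob_dominates m s.
have mp : measurable_fun setT (EFin \o normal_pdf m s).
  by apply/measurable_EFinP; exact: measurable_normal_pdf.
have rn0 := Radon_Nikodym_SigmaFinite.f_ge0 dom.
have irn := Radon_Nikodym_SigmaFinite.f_integrable dom.
have mrn := measurable_int _ irn.
rewrite -(Radon_Nikodym_SigmaFinite.change_of_variables dom f0 measurableT mf).
apply: ge0_ae_eq_integral => //.
- exact: emeasurable_funM.
- exact: emeasurable_funM.
- by move=> x _; rewrite mule_ge0.
- by move=> x _; rewrite mule_ge0// lee_fin normal_pdf_ge0.
- apply: ae_eqe_mul2l; apply: (integral_ae_eq measurableT irn mp) => E _ mE.
  by rewrite -(Radon_Nikodym_SigmaFinite.f_integral dom mE).
Qed.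

(** Completing the square turns exp (t x) times the centered density into a constant times the
    density centered at t s^2. *)
Lemma normal_mgf s t : 0 < s ->
  (\int[normal_prob 0 s]_x (expR (t * x))%:E = (expR (t ^+ 2 * s ^+ 2 / 2))%:E)%E.
Proof.
move=> s0; have n0 := lt0r_neq0 s0.
have me : measurable_fun setT (fun x : R => expR (t * x)).
  by apply: (measurableT_comp (@measurable_expR _)); exact: measurable_funM.
have mE : measurable_fun setT (fun x : R => (expR (t * x))%:E) by exact/measurable_EFinP.
have E0 x : (0 <= (expR (t * x))%:E)%E by rewrite lee_fin expR_ge0.
rewrite (integral_normal_prob 0 n0 mE E0).
transitivity (\int[mu]_x ((expR (t ^+ 2 * s ^+ 2 / 2))%:E *
    (normal_pdf (t * s ^+ 2) s x)%:E))%E.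
  apply: eq_integral => x _; rewrite -!EFinM; congr (_%:E).
  rewrite !normal_pdfE// /normal_fun mulrCA [RHS]mulrCA; congr (_ * _).
  rewrite -!expRD; congr expR; field.
  by rewrite n0.
have mp : measurable_fun setT (fun x => (normal_pdf (t * s ^+ 2) s x)%:E).
  by apply/measurable_EFinP; exact: measurable_normal_pdf.
have p0 x : setT x -> (0 <= (normal_pdf (t * s ^+ 2) s x)%:E)%E.
  by rewrite lee_fin normal_pdf_ge0.
rewrite (ge0_integralZl mu measurableT mp p0) ?lee_fin ?expR_ge0//.
by rewrite integral_normal_pdf mule1.
Qed.

Lemma integrable_normal_expR s t : 0 < s ->
  (normal_prob 0 s).-integrable setT (fun x : R => (expR (t * x))%:E).
Proof.
move=> s0; apply/integrableP; split.
  apply/measurable_EFinP.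
  by apply: (measurableT_comp (@measurable_expR _)); exact: measurable_funM.
under eq_integral do rewrite gee0_abs ?lee_fin ?expR_ge0//.
by rewrite normal_mgf// ltry.
Qed.

(* [2 sinh (z / 2)]: a substitute for [z] whose powers are combinations of
   exponentials, hence have explicit Gaussian expectations. *)
Definition dsinh z := expR (z / 2) - expR (- z / 2).

Lemma dsinhN z : dsinh (- z) = - dsinh z.
Proof. by rewrite /dsinh opprK opprB. Qed.

(** The derivative of [dsinh] is c = cosh (t / 2) >= 1, whence the first bound. For the second,
    dsinh^2 = 4 c^2 - 4 turns the derivative of the difference into (c - 1) (6 c (c + 1) - 1). *)
Lemma dsinh_bound z : 0 <= z -> z <= dsinh z /\ dsinh z - z <= dsinh z ^+ 3 / 2.
Proof.
move=> z0.
pose c t := (expR (t / 2) + expR (- t / 2)) / 2.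
have c1 t : 1 <= c t.
  rewrite /c mulNr expRN; have := expR_gt0 (t / 2); set e := expR _ => e0.
  rewrite ler_pdivlMr// mul1r -subr_ge0.
  rewrite (_ : _ - 2 = (e - 1) ^+ 2 / e); last by field; rewrite lt0r_neq0.
  by rewrite divr_ge0 ?sqr_ge0// ltW.
have dd t : is_derive t 1 dsinh (c t).
  have h1 : is_derive t 1 (fun t : R => t / 2) (2^-1).
    by apply: is_derive_eq; rewrite /GRing.scale/=; ring.
  have h2 : is_derive t 1 (fun t : R => - t / 2) (- 2^-1).
    by apply: is_derive_eq; rewrite /GRing.scale/=; ring.
  apply: (is_derive_eq (is_deriveB (is_derive_expR_comp h1) (is_derive_expR_comp h2))).
  by rewrite /c; ring.
have d0 : dsinh 0 = 0 by rewrite /dsinh oppr0 subrr.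
split.
  have H t : 0 <= t <= z -> is_derive t 1 (fun t : R => dsinh t - t) (c t - 1).
    by move=> _; exact: (is_deriveB (dd t) (is_derive_id t 1)).
  have := derive_ndecr z0 H; rewrite d0 !subr0 subr_ge0; apply.
  by move=> t _; rewrite subr_ge0.
have H t : 0 <= t <= z -> is_derive t 1 (fun t : R => dsinh t ^+ 3 * 2^-1 - (dsinh t - t))
    (3 * dsinh t ^+ 2 * c t * 2^-1 - (c t - 1)).
  move=> _; have h1 := is_deriveX 3 (dd t).
  have h2 := is_deriveM h1 (is_derive_cst (2^-1 : R) t 1).
  apply: (is_derive_eq (is_deriveB h2 (is_deriveB (dd t) (is_derive_id t 1)))).
  by rewrite /GRing.scale/= /cst/=; ring.
have := derive_ndecr z0 H; rewrite d0 !subr0 expr0n mul0r subr_ge0; apply.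
move=> t _.
have -> : dsinh t ^+ 2 = 4 * c t ^+ 2 - 4.
  rewrite /c /dsinh mulNr expRN; have := expR_gt0 (t / 2); set e := expR _ => e0.
  by field; rewrite lt0r_neq0.
have := c1 t; nra.
Qed.

Lemma dsinh_cube z : `|z - dsinh z| <= `|dsinh z| ^+ 3 / 2.
Proof.
wlog z0 : z / 0 <= z.
  move=> H; have [/H//|z0] := leP 0 z.
  by have := H (- z); rewrite oppr_ge0 ltW// => /(_ isT); rewrite dsinhN -opprD !normrN.
have [h1 h2] := dsinh_bound z0.
by rewrite distrC (ger0_norm (le_trans z0 h1)) ger0_norm ?subr_ge0.
Qed.

Lemma dsinh_norm z : `|z| <= `|dsinh z|.
Proof.
wlog z0 : z / 0 <= z.
  move=> H; have [/H//|z0] := leP 0 z.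
  by have := H (- z); rewrite oppr_ge0 ltW// => /(_ isT); rewrite dsinhN !normrN.
have [h1 h2] := dsinh_bound z0.
by rewrite (ger0_norm (le_trans z0 h1)) ger0_norm.
Qed.

Lemma dsinh_sqr z : `|z ^+ 2 - dsinh z ^+ 2| <= dsinh z ^+ 4.
Proof.
have h1 := dsinh_cube z; have h2 := dsinh_norm z.
rewrite subr_sqr normrM.
have h3 : `|z + dsinh z| <= 2 * `|dsinh z|.
  by apply: le_trans (ler_normD _ _) _; lra.
apply: le_trans (ler_pM _ _ h1 h3) _ => //.
rewrite -[leRHS]ger0_norm ?exprn_even_ge0// normrX.
by rewrite le_eqVlt; apply/orP; left; apply/eqP; field.
Qed.

End gaussian.

(** * The polynomial test function and its generator *)

Section test_function.
Context {R : realType}.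
Implicit Types (x y z w u M K eta h sigma : R).

(* A polynomial Lyapunov function playing the role of [ln |x|]: its generator
   is at most 1 - x^2 - c on the whole line. *)
Definition lyap x : R := 23 / 20 * x ^+ 2 - 9 / 20 * x ^+ 4 + x ^+ 6 / 12.
Definition lyap1 x : R := 23 / 10 * x - 9 / 5 * x ^+ 3 + x ^+ 5 / 2.
Definition lyap2 x : R := 23 / 10 - 27 / 5 * x ^+ 2 + 5 / 2 * x ^+ 4.
(** The terms of order three to six; [lyap] has degree six, so the expansion is exact. *)
Definition lyap_rest x z : R := (- (9 / 5) * x + 5 / 3 * x ^+ 3) * z ^+ 3 +
  (- (9 / 20) + 5 / 4 * x ^+ 2) * z ^+ 4 + x / 2 * z ^+ 5 + z ^+ 6 / 12.

Lemma lyap_taylor x z :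
  lyap (x + z) = lyap x + lyap1 x * z + lyap2 x / 2 * z ^+ 2 + lyap_rest x z.
Proof. by rewrite /lyap /lyap1 /lyap2 /lyap_rest; field. Qed.

(** Makes [lyap] nonnegative and the region [lyap x < K] bounded, on which the truncation relies. *)
Lemma lyap_ge x : x ^+ 2 / 2 <= lyap x.
Proof.
rewrite /lyap -subr_ge0.
rewrite (_ : _ - _ = x ^+ 2 * ((x ^+ 2 - 27 / 10) ^+ 2 / 12 + 17 / 400)); last by field.
apply: mulr_ge0; first exact: sqr_ge0.
have := sqr_ge0 (x ^+ 2 - 27 / 10); lra.
Qed.

(** With u = x^2 the right side minus the left is (1 - u)^2 s - sigma^2 b / 2. The double root at u
    = 1 is built into the coefficients by lyap1 1 = 1, as for the logarithm: otherwise the part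
    without noise would change sign there. Both s > 0 and b / 8 <= (1 - u)^2 s hold by completing
    squares, and sigma <= 1/2 gives sigma^2 / 2 <= 1/8. *)
Lemma lyap_generator x sigma : 0 <= sigma <= 1 / 2 ->
  (1 - x ^+ 2) * x * lyap1 x + sigma ^+ 2 / 2 * lyap2 x <= 1 - sigma ^+ 2 / 5 - x ^+ 2.
Proof.
move=> /andP[s0 s1].
have s2 : sigma ^+ 2 <= 1 / 4.
  by apply: le_trans (_ : (1 / 2) ^+ 2 <= _); [rewrite lerXn2r ?nnegrE|lra].
rewrite /lyap1 /lyap2; set u := x ^+ 2.
pose s := 1 - 13 / 10 * u + u ^+ 2 / 2.
pose b := 27 / 10 - 27 / 5 * u + 5 / 2 * u ^+ 2.
have h1 : b / 8 <= (1 - u) ^+ 2 * s.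
  rewrite -subr_ge0 /b /s.
  rewrite (_ : _ - _ = (u ^+ 2 - 23 / 10 * u + 11 / 10) ^+ 2 / 2 +
    ((17 / 400) * (u - 19 / 17) ^+ 2 + 3 / 680)); last by field.
  have := sqr_ge0 (u ^+ 2 - 23 / 10 * u + 11 / 10); have := sqr_ge0 (u - 19 / 17).
  lra.
have h2 : 0 <= (1 - u) ^+ 2 * s.
  apply: mulr_ge0; first exact: sqr_ge0.
  rewrite /s.
  rewrite (_ : _ + _ = (u - 13 / 10) ^+ 2 / 2 + 31 / 200); last by field.
  have := sqr_ge0 (u - 13 / 10); lra.
have h3 : sigma ^+ 2 / 2 * b <= (1 - u) ^+ 2 * s.
  have [b0|b0] := leP b 0.
    by apply: le_trans h2; rewrite mulr_ge0_le0 ?divr_ge0 ?sqr_ge0.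
  apply: le_trans h1; rewrite mulrC ler_wpM2l ?(ltW b0)//; lra.
rewrite -subr_ge0.
rewrite (_ : _ - _ = (1 - u) ^+ 2 * s - sigma ^+ 2 / 2 * b); first by rewrite subr_ge0.
by rewrite /s /b /u; field.
Qed.

Section bounds.
Variables (M : R) (M1 : 1 <= M).

Let pw w k : `|w| <= M -> (k <= 5)%N -> - M ^+ 5 <= w ^+ k <= M ^+ 5.
Proof.
move=> wM k5; rewrite -ler_norml normrX.
apply: le_trans (_ : M ^+ k <= _); last exact: ler_weXn2l.
by rewrite lerXn2r ?nnegrE// (le_trans _ M1).
Qed.

Lemma lyap1_bound w : `|w| <= M -> `|lyap1 w| <= 11 * M ^+ 5.
Proof.
move=> wM; rewrite ler_norml /lyap1.
have /andP[a1 a2] := pw wM (isT : (1 <= 5)%N); rewrite expr1 in a1 a2.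
have /andP[a3 a4] := pw wM (isT : (3 <= 5)%N).
have /andP[a5 a6] := pw wM (isT : (5 <= 5)%N).
by apply/andP; split; lra.
Qed.

Lemma lyap2_bound w : `|w| <= M -> `|lyap2 w| <= 11 * M ^+ 5.
Proof.
move=> wM; rewrite ler_norml /lyap2.
have M5 : 1 <= M ^+ 5 by exact: exprn_ege1.
have /andP[a3 a4] := pw wM (isT : (2 <= 5)%N).
have /andP[a5 a6] := pw wM (isT : (4 <= 5)%N).
by apply/andP; split; lra.
Qed.

Lemma lyap_rest_bound w z : `|w| <= M -> `|z| <= 1 ->
  `|lyap_rest w z| <= 11 * M ^+ 5 * `|z| ^+ 3.
Proof.
move=> wM z1.
have M5 : 1 <= M ^+ 5 by exact: exprn_ege1.
have zk k : `|z ^+ k * z ^+ 3| <= `|z| ^+ 3.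
  by rewrite normrM !normrX ler_piMl ?exprn_ge0// exprn_ile1.
have /andP[a1 a2] := pw wM (isT : (1 <= 5)%N); rewrite expr1 in a1 a2.
have /andP[a3 a4] := pw wM (isT : (3 <= 5)%N).
have /andP[a5 a6] := pw wM (isT : (2 <= 5)%N).
have B (c : R) (k : nat) (C : R) : `|c| <= C -> `|c * (z ^+ k * z ^+ 3)| <= C * `|z| ^+ 3.
  by move=> cC; rewrite normrM; apply: ler_pM.
have b0 := B (- (9 / 5) * w + 5 / 3 * w ^+ 3) 0%N (4 * M ^+ 5) _.
have b1 := B (- (9 / 20) + 5 / 4 * w ^+ 2) 1%N (2 * M ^+ 5) _.
have b2 := B (w / 2) 2%N (M ^+ 5) _.
have b3 := B (1 / 12) 3%N (M ^+ 5) _.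
have {}b0 := b0 ltac:(rewrite ler_norml; apply/andP; split; lra).
have {}b1 := b1 ltac:(rewrite ler_norml; apply/andP; split; lra).
have {}b2 := b2 ltac:(rewrite ler_norml; apply/andP; split; lra).
have {}b3 := b3 ltac:(rewrite ger0_norm; lra).
rewrite (_ : lyap_rest w z = (- (9 / 5) * w + 5 / 3 * w ^+ 3) * (z ^+ 0 * z ^+ 3) +
  (- (9 / 20) + 5 / 4 * w ^+ 2) * (z ^+ 1 * z ^+ 3) + w / 2 * (z ^+ 2 * z ^+ 3) +
  1 / 12 * (z ^+ 3 * z ^+ 3)); last by rewrite /lyap_rest; field.
apply: le_trans (ler_normD _ _) _.
apply: le_trans (lerD (le_trans (ler_normD _ _) (lerD (le_trans (ler_normD _ _) (lerD b0 b1)) b2)) b3) _.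
have : 0 <= M ^+ 5 * `|z| ^+ 3 by rewrite mulr_ge0 ?exprn_ge0// (le_trans ler01 M1).
by lra.
Qed.

Lemma lyap2_lip w y : `|w| <= M -> `|y| <= M ->
  lyap2 w <= lyap2 y + 22 * M ^+ 5 * `|w - y|.
Proof.
move=> wM yM.
have /andP[a1 a2] := pw wM (isT : (1 <= 5)%N); rewrite expr1 in a1 a2.
have /andP[a3 a4] := pw wM (isT : (3 <= 5)%N).
have /andP[b1 b2] := pw yM (isT : (1 <= 5)%N); rewrite expr1 in b1 b2.
have /andP[b3 b4] := pw yM (isT : (3 <= 5)%N).
have mixed : `|w| ^+ 2 * `|y| <= M ^+ 5 /\ `|w| * `|y| ^+ 2 <= M ^+ 5.
  have M0 : 0 <= M by exact: le_trans M1.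
  have M35 : M ^+ 3 <= M ^+ 5 by exact: ler_weXn2l.
  split; apply: le_trans M35.
    by rewrite (exprSr M 2); apply: ler_pM => //; rewrite ?exprn_ge0// lerXn2r ?nnegrE.
  by rewrite (exprS M 2); apply: ler_pM => //; rewrite ?exprn_ge0// lerXn2r ?nnegrE.
rewrite -lerBlDl.
rewrite (_ : _ - _ = (- (27 / 5) * w - 27 / 5 * y + 5 / 2 * w ^+ 3 + 5 / 2 * (w ^+ 2 * y) +
   5 / 2 * (w * y ^+ 2) + 5 / 2 * y ^+ 3) * (w - y)); last by rewrite /lyap2; field.
apply: le_trans (ler_norm _) _; rewrite normrM ler_wpM2r//.
have [m1 m2] := mixed.
have : `|w ^+ 2 * y| <= M ^+ 5 by rewrite normrM normrX.
have : `|w * y ^+ 2| <= M ^+ 5 by rewrite normrM normrX.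
rewrite !ler_norml => /andP[c1 c2] /andP[c3 c4].
by apply/andP; split; lra.
Qed.

End bounds.

End test_function.

(** * Gaussian means of powers of [dsinh] *)

Section mean.
Context {R : realType}.
Variables (s : R) (s0 : 0 < s).
Local Notation N := (normal_prob (0 : R) s).
Implicit Types (f g : R -> R) (c t : R).

(** Integrability is carried along because the functions take both signs and are combined
    linearly. *)
Definition has_mean f c :=
  N.-integrable setT (EFin \o f) /\ (\int[N]_x (f x)%:E = c%:E)%E.

Lemma has_meanD f g c e : has_mean f c -> has_mean g e ->
  has_mean (fun x => f x + g x) (c + e).
Proof.
move=> [If Ef] [Ig Eg]; split; first exact: (integrableD measurableT If Ig).
by under eq_integral do rewrite EFinD; rewrite integralD// Ef Eg.
Qed.

Lemma has_meanZ a f c : has_mean f c -> has_mean (fun x => a * f x) (a * c).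
Proof.
move=> [If Ef]; split; first exact: (integrableZl measurableT a If).
by under eq_integral do rewrite EFinM; rewrite integralZl// Ef.
Qed.

Lemma has_mean_exp t : has_mean (fun x => expR (t * x)) (expR (t ^+ 2 * s ^+ 2 / 2)).
Proof. by split; [exact: integrable_normal_expR|exact: normal_mgf]. Qed.

Lemma has_mean_cst c : has_mean (fun=> c) c.
Proof.
have := has_meanZ c (has_mean_exp 0).
rewrite expr0n !mul0r expR0 mulr1; congr has_mean; apply/funext => x.
by rewrite mul0r expR0 mulr1.
Qed.

Lemma has_mean_eq f g c e : has_mean f c -> f =1 g -> c = e -> has_mean g e.
Proof. by move=> h /funext <- <-. Qed.

Variable sigma : R.
Let w := expR (sigma ^+ 2 * s ^+ 2 / 4 / 2).

Let wX (k : R) (n : nat) : k = n%:R -> expR ((k * (sigma / 2)) ^+ 2 * s ^+ 2 / 2) = w ^+ (n ^ 2).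
Proof.
by move=> ->; rewrite /w -expRM_natl natrX; congr expR; field.
Qed.

(** The powers expand into exponentials exp (k sigma x / 2), whose mean is w^(k^2); the linear term
    has mean 0 by symmetry. *)
Lemma has_mean_dsinh a b c e :
  has_mean (fun x => a + b * dsinh (sigma * x) + c * dsinh (sigma * x) ^+ 2
    + e * dsinh (sigma * x) ^+ 4)
   (a + c * (2 * w ^+ 4 - 2) + e * (2 * w ^+ 16 - 8 * w ^+ 4 + 6)).
Proof.
have E k := has_mean_exp (k * (sigma / 2)).
have h := has_meanD (has_meanD (has_meanD (has_meanD (has_meanD (has_meanD
  (has_mean_cst (a - 2 * c + 6 * e)) (has_meanZ b (E 1))) (has_meanZ (- b) (E (-1))))
  (has_meanZ (c - 4 * e) (E 2))) (has_meanZ (c - 4 * e) (E (-2))))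
  (has_meanZ e (E 4))) (has_meanZ e (E (-4))).
apply: (has_mean_eq h) => [x|].
  set u := expR (sigma * x / 2).
  have u0 : u != 0 by rewrite gt_eqF// expR_gt0.
  have Ek (k : R) (n : nat) : k = n%:R -> expR (k * (sigma / 2) * x) = u ^+ n.
    by move=> ->; rewrite /u -expRM_natl; congr expR; field.
  have Ek' (k : R) (n : nat) : k = - n%:R -> expR (k * (sigma / 2) * x) = u ^- n.
    by move=> ->; rewrite /u -expRM_natl -expRN; congr expR; field.
  rewrite (Ek 1 1%N)// (Ek 2 2%N)// (Ek 4 4%N)// (Ek' (-1) 1%N)// (Ek' (-2) 2%N)// (Ek' (-4) 4%N)//.
  have -> : dsinh (sigma * x) = u - u^-1 by rewrite /dsinh mulNr expRN.
  by field.
have W (k : R) (n : nat) : k = n%:R -> expR ((- k * (sigma / 2)) ^+ 2 * s ^+ 2 / 2) = w ^+ (n ^ 2).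
  by move=> kn; rewrite -(wX kn) mulNr sqrrN.
rewrite (wX (k := 1) (n := 1))// (wX (k := 2) (n := 2))// (wX (k := 4) (n := 4))//.
rewrite (W 1 1%N)// (W 2 2%N)// (W 4 4%N)//.
rewrite -[(1 ^ 2)%N]/1%N -[(2 ^ 2)%N]/4%N -[(4 ^ 2)%N]/16%N.
by ring.
Qed.

Hypothesis v1 : sigma ^+ 2 * s ^+ 2 <= 1.

(** With W = exp (v / 2) the second moment is 2 W - 2 and the fourth is 2 (W - 1)^2 (W^2 + 2 W + 3).
    The upper bound on W comes from W^-1 >= 1 - v / 2; then W <= 2, and 22 is twice 4 + 4 + 3. *)
Lemma dsinh_moments (v := sigma ^+ 2 * s ^+ 2) :
  v <= 2 * w ^+ 4 - 2 <= v + v ^+ 2 /\ 2 * w ^+ 16 - 8 * w ^+ 4 + 6 <= 22 * v ^+ 2.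
Proof.
have v0 : 0 <= v by rewrite mulr_ge0 ?sqr_ge0.
have vle : v <= 1 by [].
set W := w ^+ 4.
have WE : W = expR (v / 2) by rewrite /W /w -expRM_natl; congr expR; rewrite /v; field.
have l1 : 1 + v / 2 <= W by rewrite WE; exact: expR_ge1Dx.
have l2 : 1 - v / 2 <= W^-1 by rewrite WE -expRN; apply: expR_ge1Dx.
have W0 : 0 < W by rewrite WE expR_gt0.
have l3 : W * (1 - v / 2) <= 1.
  by rewrite -[leRHS](mulfV (lt0r_neq0 W0)) ler_wpM2l// ltW.
have l4 : W <= 1 + v / 2 + v ^+ 2 / 2.
  have : (1 - v / 2) * W <= (1 - v / 2) * (1 + v / 2 + v ^+ 2 / 2).
    rewrite mulrC; apply: le_trans l3 _; rewrite -subr_ge0.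
    rewrite (_ : _ - 1 = v ^+ 2 / 4 * (1 - v)); last by field.
    by rewrite mulr_ge0 ?subr_ge0// divr_ge0 ?sqr_ge0.
  by rewrite ler_pM2l//; lra.
have W16 : w ^+ 16 = W ^+ 4 by rewrite /W -exprM.
split; first by apply/andP; split; lra.
rewrite W16.
rewrite (_ : _ + 6 = 2 * (W - 1) ^+ 2 * (W ^+ 2 + 2 * W + 3)); last by ring.
have l5 : W <= 2 by nra.
have l6 : W - 1 <= v by nra.
have l7 : (W - 1) ^+ 2 <= v ^+ 2 by rewrite lerXn2r ?nnegrE//; lra.
have l8 : W ^+ 2 + 2 * W + 3 <= 11 by nra.
have l9 : 0 <= W ^+ 2 + 2 * W + 3 by nra.
apply: le_trans (_ : 2 * v ^+ 2 * 11 <= _); last by lra.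
apply: ler_pM => //; first by rewrite mulr_ge0 ?sqr_ge0.
by rewrite ler_pM2l.
Qed.

End mean.

(** * One Euler step of the truncated test function *)

Section one_step.
Context {R : realType}.
Implicit Types (x y z w u M K eta h sigma : R).

(** Errors must be paid by terms of known mean: the square, of mean about h, gets the small factor
    [eta], and the fourth power, of mean of order h^2, gets 1 / eta. *)
Lemma young_cube (Q eta : R) : 0 <= Q -> 0 < eta <= 1 ->
  2 * Q ^+ 3 <= eta * Q ^+ 2 + Q ^+ 4 / eta /\ Q ^+ 4 <= eta * Q ^+ 2 + Q ^+ 4 / eta.
Proof.
move=> Q0 /andP[e0 e1]; split.
  rewrite -subr_ge0 (_ : _ - _ = Q ^+ 2 * (eta - Q) ^+ 2 / eta); last first.
    by field; rewrite lt0r_neq0.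
  by apply: divr_ge0 (ltW e0); apply: mulr_ge0; exact: sqr_ge0.
have : Q ^+ 4 <= Q ^+ 4 / eta.
  by rewrite ler_pdivlMr// ler_piMr ?exprn_ge0.
by have : 0 <= eta * Q ^+ 2; [rewrite mulr_ge0 ?sqr_ge0// ltW|lra].
Qed.

(** For |z| <= 1 the Taylor expansion applies, with [z] replaced by [dsinh z] up to cubic and
    quartic errors; for |z| > 1 the left side is at most K and the fourth power of [dsinh z] exceeds
    1. The right side has an explicit Gaussian mean. *)
Lemma lyap_trunc M K eta w z : 1 <= M -> `|w| <= M -> 0 < K -> 0 < eta <= 1 ->
  Num.min (lyap (w + z)) K <= lyap w + lyap1 w * dsinh z + lyap2 w / 2 * dsinh z ^+ 2 +
    (K + 44 * M ^+ 5) * (eta * dsinh z ^+ 2 + dsinh z ^+ 4 / eta).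
Proof.
move=> M1 wM K0 eta01.
set G := 44 * M ^+ 5; pose g := 11 * M ^+ 5.
have GE : G = 4 * g by rewrite /G /g; ring.
have g0 : 0 <= g by rewrite /g mulr_ge0// exprn_ge0// (le_trans ler01 M1).
have b1 := lyap1_bound M1 wM; have b2 := lyap2_bound M1 wM.
rewrite -/g in b1 b2.
have zc := dsinh_cube z; have zn := dsinh_norm z; have zs := dsinh_sqr z.
have qe k : ~~ odd k -> dsinh z ^+ k = `|dsinh z| ^+ k.
  by move=> ok; rewrite -normrX ger0_norm// exprn_even_ge0.
have E2 := qe 2%N isT; have E4 := qe 4%N isT.
set q := dsinh z in b1 b2 zc zn zs E2 E4 *; pose Q := `|q|; rewrite -/Q in zc zn E2 E4.
have Q0 : 0 <= Q by exact: normr_ge0.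
have [y1 y2] := young_cube Q0 eta01.
rewrite E2 E4 in zs *; set T := eta * Q ^+ 2 + _ in y1 y2 *.
have [z1|z1] := leP `|z| 1.
  apply: (@le_trans _ _ (lyap (w + z))); first by rewrite ge_min lexx.
  rewrite lyap_taylor.
  have r := lyap_rest_bound M1 wM z1; rewrite -/g in r.
  have r3 : `|z| ^+ 3 <= Q ^+ 3 by rewrite lerXn2r ?nnegrE.
  have r4 : lyap_rest w z <= g * Q ^+ 3.
    by apply: le_trans (ler_norm _) _; apply: le_trans r _; rewrite ler_wpM2l.
  have l1 : lyap1 w * z <= lyap1 w * q + g * (Q ^+ 3 / 2).
    rewrite -lerBlDl -mulrBr; apply: le_trans (ler_norm _) _; rewrite normrM.
    exact: ler_pM.
  have l2 : lyap2 w / 2 * z ^+ 2 <= lyap2 w / 2 * Q ^+ 2 + g / 2 * Q ^+ 4.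
    rewrite -lerBlDl -mulrBr; apply: le_trans (ler_norm _) _; rewrite !normrM.
    rewrite (@ger0_norm _ 2^-1) ?invr_ge0//; apply: ler_pM => //.
    by rewrite ler_pM2r ?invr_gt0.
  have m3 : g * (2 * Q ^+ 3) <= g * T by rewrite ler_wpM2l.
  have m4 : g * Q ^+ 4 <= g * T by rewrite ler_wpM2l.
  have T0 : 0 <= T by apply: le_trans y2; rewrite exprn_ge0.
  have : 0 <= g * T by rewrite mulr_ge0.
  have : 0 <= K * T by rewrite mulr_ge0// ltW.
  rewrite GE; lra.
apply: (@le_trans _ _ K); first by rewrite ge_min lexx orbT.
have Q1 : 1 <= Q by exact: le_trans (ltW z1) zn.
have Q4 : 1 <= Q ^+ 4 by rewrite exprn_ege1.
have QQ : Q <= Q ^+ 4 by rewrite ler_eXnr.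
have Q2 : Q ^+ 2 <= Q ^+ 4 by rewrite ler_weXn2l.
have F0 : 0 <= lyap w by apply: le_trans (lyap_ge w); rewrite divr_ge0 ?sqr_ge0.
have l1 : - (g * T) <= lyap1 w * q.
  have : `|lyap1 w * q| <= g * T.
    by rewrite normrM; apply: ler_pM => //; apply: le_trans QQ y2.
  by rewrite ler_norml => /andP[].
have l2 : - (g * T) <= lyap2 w / 2 * Q ^+ 2.
  have : `|lyap2 w / 2 * Q ^+ 2| <= g * T.
    rewrite normrM; apply: ler_pM => //.
      rewrite normrM (@ger0_norm _ 2^-1) ?invr_ge0//; apply: le_trans b2.
      by rewrite ler_pdivrMr// ler_peMr// ler1n.
    by rewrite ger0_norm ?exprn_ge0//; apply: le_trans Q2 y2.
  by rewrite ler_norml => /andP[].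
have T1 : 1 <= T by exact: le_trans Q4 y2.
have : K * 1 <= K * T by rewrite ler_pM2l.
have : 0 <= g * T by rewrite mulr_ge0// (le_trans ler01 T1).
rewrite GE; lra.
Qed.

Lemma measurable_lyap : measurable_fun setT (@lyap R).
Proof.
apply: measurable_funD; first apply: measurable_funB.
- by apply: measurable_funM => //; exact: measurable_funX.
- by apply: measurable_funM => //; exact: measurable_funX.
- by apply: measurable_funM => //; exact: measurable_funX.
Qed.

Definition ltrunc K y : R := Num.min (lyap y) K.
(** Cut to 0 where the truncation is active: there [ltrunc] offers no decrease that could pay for
    the energy. *)
Definition lsqr K y : R := if lyap y < K then y ^+ 2 else 0.
Definition step1 h sigma y x : R := y + h * ((1 - y ^+ 2) * y) + sigma * x.

Lemma measurable_ltrunc K : measurable_fun setT (ltrunc K).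
Proof.
apply: (@measurable_minr _ _ R setT (@lyap R) (cst K)); first exact: measurable_lyap.
exact: measurable_cst.
Qed.

Lemma measurable_lsqr K : measurable_fun setT (lsqr K).
Proof.
apply: measurable_fun_ifT.
- apply: (@measurable_fun_ltr _ _ R setT (@lyap R) (cst K)); first exact: measurable_lyap.
  exact: measurable_cst.
- exact: measurable_funX.
- exact: measurable_cst.
Qed.

Lemma lyap_ge0 y : 0 <= lyap y.
Proof. by apply: le_trans (lyap_ge y); rewrite divr_ge0 ?sqr_ge0. Qed.

Lemma ltrunc_ge0 K y : 0 < K -> 0 <= ltrunc K y.
Proof. by move=> K0; rewrite /ltrunc le_min lyap_ge0 ltW. Qed.

Lemma lsqr_ge0 K y : 0 <= lsqr K y.
Proof. by rewrite /lsqr; case: ifP => // _; exact: sqr_ge0. Qed.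

(** If lyap y >= K, the truncated value is already K and cannot increase. Otherwise [y] is bounded
    in terms of [K], and [lyap_trunc] at w = y + h b gives the generator bound up to an error of
    order h (h + eta + h / eta), uniformly in [y]. *)
Lemma one_step K sigma (e : R) : 0 < sigma <= 1 / 2 -> 0 < K -> 0 < e ->
  exists2 h0, 0 < h0 & forall h, 0 < h < h0 -> forall y,
    (\int[normal_prob 0%R (Num.sqrt h)]_x (ltrunc K (step1 h sigma y x))%:E + (h * lsqr K y)%:E
      <= (ltrunc K y + h * (1 - sigma ^+ 2 / 5 + e))%:E)%E.
Proof.
move=> /andP[s0 s1] K0 e0.
have s2 : sigma ^+ 2 <= 1 / 4.
  by apply: le_trans (_ : (1 / 2) ^+ 2 <= _); [rewrite lerXn2r ?nnegrE ?(ltW s0)//|]; lra.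
(* From y^2 / 2 <= lyap y < K comes |y| <= B; [M] leaves room 1 for the displacement by the drift,
   and [b0] below bounds the drift. *)
pose B := 1 + 2 * K; have B1 : 1 <= B by rewrite /B lerDl mulr_ge0// ltW.
pose M := B + 1; have M1 : 1 <= M by rewrite /M lerDr (le_trans ler01 B1).
pose g := 11 * M ^+ 5; have g0 : 0 < g by rewrite /g mulr_gt0// exprn_gt0// (lt_le_trans ltr01 M1).
pose C := K + 44 * M ^+ 5.
have C0 : 0 < C by rewrite /C addr_gt0// mulr_gt0// exprn_gt0// (lt_le_trans ltr01 M1).
pose b0 := B + B ^+ 3.
have b01 : 1 <= b0 by rewrite /b0 (le_trans B1)// lerDl exprn_ge0// (le_trans ler01 B1).
have b00 : 0 < b0 by exact: lt_le_trans b01.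
pose D := 2 * g * b0 ^+ 2 + g * b0 + g + 22 * C.
have D0 : 0 < D.
  have d1 : 0 < g * b0 ^+ 2 by rewrite mulr_gt0 ?exprn_gt0.
  have d2 : 0 < g * b0 by exact: mulr_gt0.
  by rewrite /D; lra.
(* [eta] is fixed before [h0], so that h / eta is small as well: each of D eta, D h and D h / eta is
   at most e / 4. *)
pose eta := Num.min 1 (e / (4 * D)).
have eta0 : 0 < eta by rewrite /eta lt_min ltr01 divr_gt0 ?mulr_gt0.
have eta1 : eta <= 1 by rewrite /eta ge_min lexx.
have etaD : D * eta <= e / 4.
  have : eta <= e / (4 * D) by rewrite /eta ge_min lexx orbT.
  rewrite -(ler_pM2l D0) => /le_trans; apply.
  by rewrite le_eqVlt; apply/orP; left; apply/eqP; field; rewrite lt0r_neq0.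
pose h0 := Num.min (b0^-1) (eta * (e / (4 * D))).
have h00 : 0 < h0 by rewrite /h0 lt_min invr_gt0 b00/= mulr_gt0// divr_gt0 ?mulr_gt0.
exists h0 => // h /andP[hp hh] y.
have hb : h * b0 <= 1.
  by rewrite -ler_pdivlMr// mul1r; apply/ltW/(lt_le_trans hh); rewrite /h0 ge_min lexx.
have h1 : h <= 1 by apply: le_trans hb; rewrite ler_peMr// ltW.
have hE : D * (h / eta) <= e / 4.
  have : h <= eta * (e / (4 * D)).
    by apply/ltW/(lt_le_trans hh); rewrite /h0 ge_min lexx orbT.
  move=> hle; have : h / eta <= e / (4 * D) by rewrite mulrC ler_pdivrMl.
  rewrite -(ler_pM2l D0) => /le_trans; apply.
  by rewrite le_eqVlt; apply/orP; left; apply/eqP; field; rewrite lt0r_neq0.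
have hE' : D * h <= e / 4.
  apply: le_trans hE; rewrite ler_pM2l// ler_pdivlMr// ler_piMr// ltW//.
have sh : 0 < Num.sqrt h by rewrite sqrtr_gt0.
have c0 : 0 <= 1 - sigma ^+ 2 / 5 + e by nra.
have mstep : measurable_fun setT (fun x : R => ltrunc K (step1 h sigma y x)).
  apply: (measurableT_comp (measurable_ltrunc K)).
  by apply: measurable_funD => //; exact: measurable_funM.
have [yK|yK] := ltP (lyap y) K; last first.
  rewrite /lsqr ltNge yK/= mulr0 adde0 /ltrunc (min_r yK).
  apply: (@le_trans _ _ (\int[normal_prob 0%R (Num.sqrt h)]_x (cst K%:E x))%E).
    apply: ge0_le_integral => //.
    - by move=> x _; rewrite lee_fin ltrunc_ge0.
    - exact/measurable_EFinP.
    - by move=> x _; rewrite lee_fin ge_min lexx orbT.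
  rewrite integral_cst// [X in (_ * X)%E]probability_setT mule1 lee_fin lerDl.
  by rewrite mulr_ge0// ltW.
rewrite /lsqr yK {2}/ltrunc (min_l (ltW yK)).
set b := (1 - y ^+ 2) * y; pose w := y + h * b.
have yB : `|y| <= B.
  have := lyap_ge y; have := real_normK (num_real y) => <-; have := normr_ge0 y.
  rewrite /B; nra.
have bb : `|b| <= b0.
  rewrite /b normrM mulrC; apply: le_trans (_ : `|y| * (1 + `|y| ^+ 2) <= _).
    rewrite ler_wpM2l//; apply: le_trans (ler_normB _ _) _; rewrite normr1 normrX//.
  rewrite mulrDr mulr1 -exprS /b0 lerD// lerXn2r ?nnegrE// (le_trans ler01 B1)//.
have yM : `|y| <= M by apply: le_trans yB _; rewrite /M lerDl.
have hb1 : `|h * b| <= 1.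
  by apply: le_trans hb; rewrite normrM (gtr0_norm hp) ler_pM2l.
have wM : `|w| <= M.
  by apply: le_trans (ler_normD _ _) _; rewrite /M lerD.
have eta01 : 0 < eta <= 1 by rewrite eta0 eta1.
pose v := sigma ^+ 2 * Num.sqrt h ^+ 2.
have vE : v = sigma ^+ 2 * h by rewrite /v sqr_sqrtr// ltW.
have vh : v <= h * (1 / 4) by rewrite vE mulrC ler_wpM2l// ltW.
have v1 : v <= 1 by lra.
have v0 : 0 <= v by rewrite vE mulr_ge0 ?sqr_ge0// ltW.
have [/andP[m1 m2] m4] := dsinh_moments v1; rewrite -/v in m1 m2 m4.
have [Im Em] := has_mean_dsinh sh sigma (lyap w) (lyap1 w) (lyap2 w / 2 + C * eta) (C / eta).
set E2 := 2 * _ - 2 in m1 m2 Em; set E4 := _ + 6 in m4 Em.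
have I1 : (\int[normal_prob 0%R (Num.sqrt h)]_x (ltrunc K (step1 h sigma y x))%:E <=
    (lyap w + (lyap2 w / 2 + C * eta) * E2 + C / eta * E4)%:E)%E.
  rewrite -Em; apply: ge0_le_integral => //.
  - by move=> x _; rewrite lee_fin ltrunc_ge0.
  - exact/measurable_EFinP.
  - exact: measurable_int Im.
  - move=> x _; rewrite lee_fin /step1 /ltrunc.
    apply: le_trans (lyap_trunc (sigma * x) M1 wM K0 eta01) _.
    by rewrite -/C le_eqVlt; apply/orP; left; apply/eqP; ring.
apply: le_trans (leeD2r _ I1) _; rewrite -EFinD lee_fin.
(* [t1] handles the displacement by the drift, [t2] the second moment of the noise, [t3] the cost of
   truncation and of the Taylor errors. *)
have t1 : lyap w <= lyap y + h * (b * lyap1 y) + h * (2 * g * b0 ^+ 2 * h).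
  have r := lyap_rest_bound M1 yM hb1; rewrite -/g in r.
  have l2 := lyap2_bound M1 yM; rewrite -/g in l2.
  have hb2 : (h * b) ^+ 2 <= h * (b0 ^+ 2 * h).
    rewrite exprMn (_ : h * _ = h ^+ 2 * b0 ^+ 2); last by ring.
    rewrite ler_wpM2l ?sqr_ge0// -(real_normK (num_real b)) lerXn2r ?nnegrE// ltW//.
  have r1 : lyap_rest y (h * b) <= g * (h * b) ^+ 2.
    apply: le_trans (ler_norm _) _; apply: le_trans r _; rewrite (ler_pM2l g0).
    by rewrite -(real_normK (num_real (h * b))) exprS ler_piMl// exprn_ge0.
  have r2 : lyap2 y / 2 * (h * b) ^+ 2 <= g * (h * b) ^+ 2.
    rewrite ler_wpM2r ?sqr_ge0//; move: l2; rewrite ler_norml => /andP[_ l2].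
    by clear -l2 g0; lra.
  have r3 : g * (h * b) ^+ 2 <= g * (h * (b0 ^+ 2 * h)) by rewrite ler_pM2l.
  by rewrite /w lyap_taylor; clear -g0 r1 r2 r3 hp; lra.
have t2 : lyap2 w / 2 * E2 <= h * (sigma ^+ 2 / 2 * lyap2 y) + h * ((g * b0 + g) * h).
  have l2 := lyap2_bound M1 wM; rewrite -/g in l2.
  have l3 := lyap2_lip M1 wM yM.
  have l4 : `|w - y| <= h * b0.
    by rewrite /w addrC addKr normrM (gtr0_norm hp) ler_pM2l.
  have l5 : lyap2 w / 2 <= lyap2 y / 2 + g * (h * b0).
    have l6 : g * `|w - y| <= g * (h * b0) by rewrite ler_pM2l.
    rewrite (_ : 22 * M ^+ 5 = 2 * g) in l3; last by rewrite /g; ring.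
    by clear -l3 l6; lra.
  have l6 : lyap2 w / 2 * v <= (lyap2 y / 2 + g * (h * b0)) * v by rewrite ler_wpM2r.
  have l7 : lyap2 w / 2 * (E2 - v) <= g * v ^+ 2.
    move: l2; rewrite ler_norml => /andP[_ l2].
    have k1 : 0 <= E2 - v by rewrite subr_ge0.
    have k2 : E2 - v <= v ^+ 2 by rewrite lerBlDl.
    apply: le_trans (_ : g * (E2 - v) <= _); last by rewrite ler_pM2l.
    by rewrite ler_wpM2r//; clear -l2 g0; lra.
  have l9 : v <= h by clear -vh hp; lra.
  have l8 : v ^+ 2 <= h * h by rewrite expr2; apply: ler_pM.
  have k1 : g * v ^+ 2 <= g * (h * h) by rewrite ler_pM2l.
  have k2 : g * (h * b0) * v <= g * (h * b0) * h.
    by apply: ler_wpM2l => //; apply: ltW; apply: mulr_gt0 => //; exact: mulr_gt0.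
  rewrite (_ : lyap2 w / 2 * E2 = lyap2 w / 2 * v + lyap2 w / 2 * (E2 - v)); last by ring.
  have E : (lyap2 y / 2 + g * (h * b0)) * v =
      h * (sigma ^+ 2 / 2 * lyap2 y) + g * (h * b0) * v by rewrite vE; field.
  rewrite E in l6; apply: le_trans (lerD l6 l7) _; clear -k1 k2; lra.
have t3 : C * eta * E2 + C / eta * E4 <= h * (22 * C * (eta + h / eta)).
  have k1 : E2 <= 22 * h.
    have l8 : v ^+ 2 <= v by rewrite expr2 ler_piMl.
    by clear -l8 m2 vh hp; lra.
  have k2 : E4 <= 22 * (h * h).
    have l9 : v <= h by clear -vh hp; lra.
    have l8 : v ^+ 2 <= h * h by rewrite expr2; apply: ler_pM.
    by clear -l8 m4; lra.
  have k3 : C * eta * E2 <= C * eta * (22 * h) by rewrite ler_pM2l// mulr_gt0.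
  have k4 : C / eta * E4 <= C / eta * (22 * (h * h)) by rewrite ler_pM2l// divr_gt0.
  apply: le_trans (lerD k3 k4) _.
  by rewrite le_eqVlt; apply/orP; left; apply/eqP; ring.
have gen := lyap_generator y (sigma := sigma); rewrite (ltW s0) s1 in gen.
have {}gen := gen isT; rewrite -/b in gen.
have gen' : h * (b * lyap1 y + sigma ^+ 2 / 2 * lyap2 y) <= h * (1 - sigma ^+ 2 / 5 - y ^+ 2).
  by rewrite ler_pM2l.
have fin : h * (2 * g * b0 ^+ 2 * h + (g * b0 + g) * h + 22 * C * (eta + h / eta)) <= h * e.
  rewrite ler_pM2l//.
  have d1 : 2 * g * b0 ^+ 2 * h + (g * b0 + g) * h + 22 * C * (eta + h / eta) <= D * (h + eta + h / eta).
    have p1 : 0 <= h / eta by rewrite divr_ge0 ?(ltW hp) ?(ltW eta0).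
    have p2 : 0 <= (2 * g * b0 ^+ 2 + g * b0 + g) * (eta + h / eta).
      have q1 : 0 < g * b0 ^+ 2 by rewrite mulr_gt0 ?exprn_gt0.
      have q2 : 0 < g * b0 by exact: mulr_gt0.
      apply: mulr_ge0; last by rewrite addr_ge0// ltW.
      by clear -q1 q2 g0; lra.
    have p3 : 0 <= C * h by rewrite mulr_ge0 ?(ltW C0) ?(ltW hp).
    by rewrite /D; clear -p1 p2 p3; lra.
  by apply: le_trans d1 _; clear -e0 hE hE' etaD; lra.
clear -t1 t2 t3 gen' fin.
by lra.
Qed.

End one_step.

(** * Riemann sums and energy along the noise axis *)

Section riemann.
Context {R : realType}.

Lemma riemann_sum (g : R -> R) (T e : R) : continuous g -> 0 < T -> 0 < e ->
  \forall N \near \oo,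
    `|T / N%:R * \sum_(j < N) g (j%:R * (T / N%:R)) - prim g T| <= e.
Proof.
move=> cg T0 e0; have eT : 0 < e / T by rewrite divr_gt0.
have := cvg_mesh T0 (segment_unif_continuous T cg eT).
apply: filterS2 (nbhs_infty_gt 0) => N N0.
set h := T / N%:R => H.
have h0 : 0 < h by rewrite divr_gt0// ltr0n.
have TE : N%:R * h = T by rewrite /h mulrCA divff ?mulr1// pnatr_eq0 -lt0n.
suff K j : (j <= N)%N ->
    `|h * \sum_(i < j) g (i%:R * h) - prim g (j%:R * h)| <= j%:R * h * (e / T).
  by have := K N (leqnn N); rewrite TE mulrCA divff ?mulr1// lt0r_neq0.
elim: j => [|j IH] jN; first by rewrite big_ord0 mulr0 !mul0r prim0// subr0 normr0.
have {}IH := IH (ltnW jN).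
have jT : j.+1%:R * h <= T by rewrite -TE ler_pM2r// ler_nat.
have j0 : 0 <= j%:R * h by rewrite mulr_ge0// ltW.
have jj : j%:R * h <= j.+1%:R * h by rewrite ler_pM2r// ler_nat.
have [|c /andP[c1 c2] Ec] := @derive_mvt _ (prim g) g (j%:R * h) (j.+1%:R * h) jj.
  by move=> t /andP[t0 _]; apply: is_derive_prim => //; exact: le_trans t0.
have E : j.+1%:R * h - j%:R * h = h by rewrite -natr1; ring.
rewrite E in Ec.
have gc : `|g c - g (j%:R * h)| <= e / T.
  apply: H; first by rewrite (le_trans j0)//= (le_trans c2).
  by rewrite ger0_norm ?subr_ge0// -/h -[leRHS]E lerD2r.
rewrite big_ord_recr/=.
rewrite (_ : _ - _ = (h * (\sum_(i < j) g (i%:R * h)) - prim g (j%:R * h)) - h * (g c - g (j%:R * h))); last first.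
  by rewrite (_ : prim g (j.+1%:R * h) = prim g (j%:R * h) + g c * h); [ring|rewrite -Ec; ring].
apply: le_trans (ler_normB _ _) _; rewrite -natr1 mulrDl mul1r mulrDl lerD//.
by rewrite normrM gtr0_norm// ler_pM2l.
Qed.

End riemann.

Section axis.
Context {R : realType} {d : nat}.
Local Notation Omega := (wiener_space R 1).
Implicit Types (h sigma x : R) (xi : nat -> 'rV[R]_1).

Fixpoint euler1 h sigma x xi j : R :=
  if j is j'.+1 then step1 h sigma (euler1 h sigma x xi j') (xi j' 0 0) else x.

Variables (j0 : 'I_d) (j00 : j0 = 0%N :> nat).

Lemma sqn_axis (p : 'rV[R]_d) : (forall i : 'I_d, (1 <= i)%N -> p 0 i = 0) ->
  sqn p = p 0 j0 ^+ 2.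
Proof.
move=> hp; rewrite /sqn (bigD1 j0)//= big1 ?addr0// => i ij.
rewrite hp ?expr0n// lt0n; apply: contra ij => /eqP i0.
by apply/eqP/val_inj; rewrite /= i0 j00.
Qed.

Lemma pad_axis (v : 'rV[R]_1) : pad v 0 j0 = v 0 0 :> R.
Proof.
rewrite /pad mxE; case: insubP => [k _ kE|]; last by rewrite j00.
by congr (v _ _); apply/val_inj; rewrite /= kE j00.
Qed.

Lemma euler_axis h sigma (p : 'rV[R]_d) xi j :
  (forall i : 'I_d, (1 <= i)%N -> p 0 i = 0) ->
  (forall i : 'I_d, (1 <= i)%N -> euler h sigma p xi j 0 i = 0) /\
  euler h sigma p xi j 0 j0 = euler1 h sigma (p 0 j0) xi j.
Proof.
move=> hp; elim: j => [//|j [IH1 IH2]]; split.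
  by move=> i i1; rewrite eulerS driftE IH1// pad_out// !mulr0 !addr0.
by rewrite eulerS driftE (sqn_axis IH1) IH2 pad_axis.
Qed.

Variables (sigma : R) (phi : R -> Omega -> 'rV[R]_d -> 'rV[R]_d).
Hypothesis hphi : is_sde_rds sigma phi.
Variables (p : 'rV[R]_d) (hp : forall i : 'I_d, (1 <= i)%N -> p 0 i = 0).

Lemma traj_axis w (t : R) (i : 'I_d) : 0 <= t -> (1 <= i)%N -> traj phi w p t 0 i = 0.
Proof.
move=> t0 i1; rewrite (coord_growth (sde_sol w p hphi) (i := i))//.
  by rewrite hp// mul0r.
by move=> s; rewrite mxE pad_out// mulr0.
Qed.

(** Carries the same information as growth, but is nonnegative, as the lemma of Fatou requires. *)
Definition energy w (T : R) := prim (fun s => sqn (traj phi w p s)) T.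

Lemma energy_growth w (T : R) : 0 <= T -> energy w T = T - growth (traj phi w p) T.
Proof.
move=> T0; have [ct _] := sde_sol w p hphi.
have cs := sqn_continuous ct.
have H t : 0 <= t <= T -> is_derive t 1
    (fun t => energy w t - (t - growth (traj phi w p) t)) 0.
  move=> /andP[t0 _]; have h1 := is_derive_prim cs t0.
  have h2 := is_derive_growth ct t0.
  apply: (is_derive_eq (is_deriveB h1 (is_deriveB (is_derive_id t (1 : R)) h2))).
  by ring.
have := derive_const T0 H; rewrite /energy prim0// growth0// !subr0 => /esym/eqP.
by rewrite subr_eq0 => /eqP.
Qed.

Definition euler_energy K T N w : R :=
  T / N%:R * \sum_(j < N) lsqr K (euler1 (T / N%:R) sigma (p 0 j0) (incr w 0 (T / N%:R)) j).

Lemma lyap_le_bound (y M : R) : 1 <= M -> `|y| <= M -> lyap y <= 2 * M ^+ 6.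
Proof.
move=> M1 yM.
have h2 : y ^+ 2 <= M ^+ 6.
  rewrite -(real_normK (num_real y)); apply: le_trans (_ : M ^+ 2 <= _); last exact: ler_weXn2l.
  by rewrite lerXn2r ?nnegrE// (le_trans ler01 M1).
have h6 : y ^+ 6 <= M ^+ 6.
  have -> : y ^+ 6 = `|y| ^+ 6 by rewrite -normrX ger0_norm// exprn_even_ge0.
  by rewrite lerXn2r ?nnegrE// (le_trans ler01 M1).
have h4 : 0 <= y ^+ 4 by rewrite exprn_even_ge0.
have h0 : 0 <= M ^+ 6 by rewrite exprn_even_ge0.
by rewrite /lyap; lra.
Qed.

(** Along a fixed path the scheme is eventually bounded by B + 1, so the truncation is inactive once
    [K] exceeds a bound depending on the path. The relative speed of [K] and [N] is therefore
    free. *)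
Lemma euler_energy_cvg (w : Omega) (T : R) (K : nat -> R) (N : nat -> nat) : 0 < T ->
  (forall A, \forall k \near \oo, A <= K k) ->
  (forall A, \forall k \near \oo, (A <= N k)%N) ->
  euler_energy (K k) T (N k) w @[k --> \oo] --> energy w T.
Proof.
move=> T0 Koo Noo; apply/cvgrPdist_le => e e0.
have sz := sde_sol w p hphi; have [ct _] := sz.
have cs := sqn_continuous ct.
have [B0 hB0] := segment_bounded T cs.
pose B := 1 + `|B0|; have B1 : 1 <= B by rewrite lerDl.
have hB t : 0 <= t <= T -> `|traj phi w p t 0 j0| <= B.
  move=> tT; have := hB0 t tT; have := ler_sqn (traj phi w p t) j0; have := ler_norm B0.
  rewrite /B -[traj phi w p t 0 j0 ^+ 2]real_normK ?num_real//.
  have := normr_ge0 (traj phi w p t 0 j0); nra.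
(* Squares at distance [dl] differ by at most dl (2 B + 1), which over the length T gives e / 2; dl
   <= 1 keeps the scheme within B + 1. *)
pose dl := Num.min 1 (e / 2 / (T * (2 * B + 1))).
have TB : 0 < T * (2 * B + 1) by rewrite mulr_gt0//; lra.
have dl0 : 0 < dl by rewrite /dl lt_min ltr01 !divr_gt0.
have e2 : 0 < e / 2 by rewrite divr_gt0.
have near_N (Q : nat -> Prop) : (\forall N \near \oo, Q N) -> \forall k \near \oo, Q (N k).
  by move=> [A _ hA]; apply: filterS (Noo A) => k; exact: hA.
have H1 := near_N _ (euler_cvg T0 dl0 sz (traj0 w p hphi)).
have H2 := near_N _ (riemann_sum cs T0 e2).
have H3 := near_N _ (nbhs_infty_gt 0).
near=> k.
have N0 : (0 < N k)%N by near: k.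
have E1 : forall j i, (j <= N k)%N ->
    `|euler (T / (N k)%:R) sigma p (incr w 0 (T / (N k)%:R)) j 0 i -
      traj phi w p (j%:R * (T / (N k)%:R)) 0 i| <= dl by near: k.
have E2 : `|T / (N k)%:R * \sum_(j < N k) sqn (traj phi w p (j%:R * (T / (N k)%:R))) -
   energy w T| <= e / 2 by near: k.
have E3 : 2 * (B + 1) ^+ 6 + 1 <= K k by near: k; exact: Koo.
set h := T / (N k)%:R in E1 E2 *.
have h0 : 0 < h by rewrite divr_gt0// ltr0n.
have TE : (N k)%:R * h = T by rewrite /h mulrCA divff ?mulr1// pnatr_eq0 -lt0n.
set Y := euler1 h sigma (p 0 j0) (incr w 0 h).
have term j : (j < N k)%N ->
    `|lsqr (K k) (Y j) - sqn (traj phi w p (j%:R * h))| <= dl * (2 * B + 1).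
  move=> jN; have t0 : 0 <= j%:R * h by rewrite mulr_ge0// ltW.
  have tT : j%:R * h <= T by rewrite -TE ler_pM2r// ler_nat ltnW.
  have xB : `|traj phi w p (j%:R * h) 0 j0| <= B by apply: hB; rewrite t0.
  have := E1 j j0 (ltnW jN); rewrite (euler_axis h sigma (incr w 0 h) j hp).2 -/(Y j).
  have -> : sqn (traj phi w p (j%:R * h)) = traj phi w p (j%:R * h) 0 j0 ^+ 2.
    by apply: sqn_axis => i; exact: traj_axis.
  set X := traj _ _ _ _ _ _ in xB * => YX.
  have dl1 : dl <= 1 by rewrite /dl ge_min lexx.
  have YB : `|Y j| <= B + 1.
    rewrite -(subrK X (Y j)); apply: le_trans (ler_normD _ _) _.
    by rewrite addrC lerD// (le_trans YX).
  rewrite /lsqr ifT; last first.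
    apply: le_lt_trans (lyap_le_bound _ YB) _; first by rewrite lerDr (le_trans ler01 B1).
    by apply: lt_le_trans E3; rewrite ltrDl.
  rewrite subr_sqr normrM; apply: ler_pM => //.
  by apply: le_trans (ler_normD _ _) _; lra.
have E4 : `|euler_energy (K k) T (N k) w - h * \sum_(j < N k) sqn (traj phi w p (j%:R * h))| <= e / 2.
  rewrite /euler_energy -/h -/Y -mulrBr -sumrB normrM gtr0_norm//.
  apply: (@le_trans _ _ (h * ((N k)%:R * (dl * (2 * B + 1))))).
    rewrite ler_pM2l//; apply: le_trans (ler_norm_sum _ _ _) _.
    rewrite -[N k in leRHS]card_ord -sumr_const mulr_suml; apply: ler_sum => j _.
    by rewrite mul1r term.
  rewrite (mulrA h) (mulrC h) TE.
  have : dl <= e / 2 / (T * (2 * B + 1)) by rewrite /dl ge_min lexx orbT.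
  by rewrite ler_pdivlMr// mulrCA.
rewrite distrC (_ : _ - _ = (euler_energy (K k) T (N k) w -
   h * \sum_(j < N k) sqn (traj phi w p (j%:R * h))) +
   (h * \sum_(j < N k) sqn (traj phi w p (j%:R * h)) - energy w T)); last by ring.
by apply: le_trans (ler_normD _ _) _; rewrite (splitr e) lerD.
Unshelve. all: by end_near. Qed.

End axis.

(** * Mean energy along the Euler scheme *)

Section energy_mean.
Context {R : realType}.
Local Notation Omega := (wiener_space R 1).
Local Notation incs k := (g_sigma_algebraType (@boxes R 1 k)).
Variables (P : probability (borel Omega) R) (hP : is_wiener_measure P).
Implicit Types (h sigma x K : R).

Let inc h k (w : Omega) : R := incr w 0 h k 0 0.

Let measurable_inc1 h k : measurable_fun [set: borel Omega] (inc h k : borel Omega -> R).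
Proof.
exact: (measurableT_comp (@measurable_inc R 1 k.+1 k 0 (ltnSn k))
  (@measurable_incr R 1 k.+1 0 h)).
Qed.

(** Both sides are measures in [A] and agree on boxes, because a box of [k] increments and a
    condition on the next one form a box of [k + 1]. *)
Lemma incr_indep h k (A : set (incs k)) (C : set R) : 0 < h ->
  measurable A -> measurable C ->
  (P ((fun w : Omega => incr w 0 h) @^-1` A `&` inc h k @^-1` C) =
   P ((fun w : Omega => incr w 0 h) @^-1` A) * normal_prob 0 (Num.sqrt h) C)%E.
Proof.
move=> h0 mA mC.
have mE : measurable (inc h k @^-1` C : set (borel Omega)).
  by rewrite -[X in measurable X]setTI; exact: measurable_inc1.
have mf : measurable_fun [set: borel Omega] ((fun w => incr w 0 h) : borel Omega -> incs k).
  exact: measurable_incr.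
have c0 : (0 <= fine (normal_prob (0 : R) (Num.sqrt h) C))%R by rewrite fine_ge0.
have cE : (fine (normal_prob (0 : R) (Num.sqrt h) C))%:E = normal_prob (0 : R) (Num.sqrt h) C.
  by rewrite fineK// fin_num_measure.
pose m1 := measure_function_pushforward__canonical__measure_function_Measure (mrestr P mE) mf.
pose m2 := mscale (NngNum c0)
  (measure_function_pushforward__canonical__measure_function_Measure P mf).
suff E : m1 A = m2 A.
  rewrite muleC -cE; exact: E.
apply: (@measure_unique _ R (incs k) (boxes k) (fun=> setT)) => //.
- exact: boxesI.
- by move=> _; exact: boxesT.
- by rewrite bigcup_const//; exists 0%N.
- move=> _ [B mB <-].
  pose B' j (i : 'I_1) := if (j < k)%N then B j i else C.
  have mB' j i : measurable (B' j i) by rewrite /B'; case: ifP.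
  have E : P ((fun w : Omega => incr w 0 h) @^-1` box k.+1 B') =
      (P ((fun w : Omega => incr w 0 h) @^-1` box k B) * normal_prob 0 (Num.sqrt h) C)%E.
    rewrite box_prob// big_ord_recr/= big_ord1 {2}/B' ltnn box_prob//.
    by congr (_ * _)%E; apply: eq_bigr => j _; apply: eq_bigr => i _; rewrite /B' ltn_ord.
  change (P ((fun w : Omega => incr w 0 h) @^-1` box k B `&` inc h k @^-1` C) =
    (fine (normal_prob (0 : R) (Num.sqrt h) C))%:E * P ((fun w : Omega => incr w 0 h) @^-1` box k B))%E.
  rewrite cE muleC -E; congr (P _).
  apply/seteqP; split => w /=.
    move=> [h1 h2] j i; rewrite ltnS /B' leq_eqVlt => /predU1P[->|jk].
      by rewrite ltnn ord1.
    by rewrite jk; exact: h1.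
  move=> hw; split; last by have := hw k 0 (ltnSn k); rewrite /B' ltnn.
  by move=> j i jk; have := hw j i (ltnW jk); rewrite /B' jk.
- move=> _; apply: (@le_lt_trans _ _ (P setT)); last by rewrite probability_setT ltry.
  by apply: le_measure; rewrite ?inE// preimage_setT setTI.
Qed.

Lemma measurable_euler1 h sigma x k j : (j <= k)%N ->
  measurable_fun [set: incs k] ((fun xi => euler1 h sigma x xi j) : incs k -> R).
Proof.
elim: j => [|j IH] jk; first exact: measurable_cst.
have {}IH := IH (ltnW jk).
rewrite /= /step1; apply: measurable_funD; last first.
  by apply: measurable_funM => //; exact: measurable_inc.
apply: measurable_funD => //; apply: measurable_funM => //; apply: measurable_funM => //.
by apply: measurable_funB => //; exact: measurable_funX.
Qed.

Let pos h sigma x j (w : Omega) := euler1 h sigma x (incr w 0 h) j.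

Let measurable_pos h sigma x j :
  measurable_fun [set: borel Omega] (pos h sigma x j : borel Omega -> R).
Proof.
exact: (measurableT_comp (@measurable_euler1 h sigma x j j (leqnn j))
  (@measurable_incr R 1 j 0 h)).
Qed.

(** Summation of [one_step]: the position after j steps depends on the first j increments and is
    independent of the next one, so the inequality applies inside the expectation. *)
Lemma euler_drift K sigma (e : R) : 0 < sigma <= 1 / 2 -> 0 < K -> 0 < e ->
  exists2 h0, 0 < h0 & forall h, 0 < h < h0 -> forall x j,
    (\int[P]_w (ltrunc K (pos h sigma x j w))%:E +
       \sum_(i < j) \int[P]_w (h * lsqr K (pos h sigma x i w))%:E
     <= (lyap x + j%:R * (h * (1 - sigma ^+ 2 / 5 + e)))%:E)%E.
Proof.
move=> hs K0 e0; have [h0 h00 hstep] := one_step hs K0 e0; exists h0 => // h hh x.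
have hp : 0 < h by case/andP: hh.
have {}hstep := hstep h hh.
set c := h * (1 - sigma ^+ 2 / 5 + e) in hstep *.
have c0 : 0 <= c.
  rewrite /c mulr_ge0 ?(ltW hp)//; case/andP: hs => s0 s1.
  by rewrite addr_ge0 ?(ltW e0)// subr_ge0 ler_pdivrMr// mul1r; nra.
have mtr j : measurable_fun [set: borel Omega] (fun w => (ltrunc K (pos h sigma x j w))%:E).
  by apply/measurable_EFinP; exact: (measurableT_comp (measurable_ltrunc K)).
have msq j : measurable_fun [set: borel Omega] (fun w => (h * lsqr K (pos h sigma x j w))%:E).
  apply/measurable_EFinP; apply: measurable_funM => //.
  exact: (measurableT_comp (measurable_lsqr K)).
elim=> [|j IH].
  rewrite big_ord0 adde0 mul0r addr0 (eq_integral (cst (ltrunc K x)%:E))// integral_cst// [X in (_ * X)%E](probability_setT P) mule1.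
  by rewrite lee_fin /ltrunc ge_min lexx.
rewrite big_ord_recr/= [X in (_ + X <= _)%E]addeC addeA.
have -> : lyap x + j.+1%:R * c = lyap x + j%:R * c + c by rewrite -natr1; ring.
apply: (@le_trans _ _ (\int[P]_w (ltrunc K (pos h sigma x j w))%:E + c%:E +
   \sum_(i < j) \int[P]_w (h * lsqr K (pos h sigma x i w))%:E)%E); last first.
  by rewrite addeAC EFinD leeD2r.
rewrite leeD2r//.
pose nu : probability _ R := normal_prob (0 : R) (Num.sqrt h).
pose psi (yz : R * R) := (ltrunc K (step1 h sigma yz.1 yz.2))%:E.
have mpsi : measurable_fun [set: R * R] psi.
  apply/measurable_EFinP; apply: (measurableT_comp (measurable_ltrunc K)).
  apply: measurable_funD; last by apply: measurable_funM => //; exact: measurable_snd.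
  have m1 : measurable_fun [set: R * R] (fst : R * R -> R) by exact: measurable_fst.
  apply: measurable_funD => //; apply: measurable_funM => //; apply: measurable_funM => //.
  by apply: measurable_funB => //; exact: measurable_funX.
have psi0 yz : (0 <= psi yz)%E by rewrite lee_fin ltrunc_ge0.
have E : (\int[P]_w (ltrunc K (pos h sigma x j.+1 w))%:E =
   \int[P]_w \int[nu]_z psi (pos h sigma x j w, z))%E.
  transitivity (\int[P]_w psi (pos h sigma x j w, inc h j w))%E; first by [].
  have fg (A B : set R) : measurable A -> measurable B ->
      (P ((pos h sigma x j : borel Omega -> R) @^-1` A `&` inc h j @^-1` B) = P (pos h sigma x j @^-1` A) * nu B)%E.
    move=> mA mB.
    have mA' : measurable ((fun xi => euler1 h sigma x xi j) @^-1` A : set (incs j)).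
      by rewrite -[X in measurable X]setTI; exact: measurable_euler1.
    exact: (incr_indep hp mA' mB).
  exact: (@indep_integral _ (borel Omega) R P _ _ (measurableTypeR R) (measurableTypeR R) (pos h sigma x j : borel Omega -> R) (inc h j) nu psi
    (measurable_pos _ _ _ _) (measurable_inc1 _ _) fg mpsi psi0).
have mG : measurable_fun [set: borel Omega]
    (fun w => (\int[nu]_z psi (pos h sigma x j w, z))%E).
  exact: (measurableT_comp (@measurable_fun_fubini_tonelli_F _ _ (measurableTypeR R)
    (measurableTypeR R) R nu psi mpsi psi0) (measurable_pos h sigma x j)).
rewrite E -ge0_integralD//; last 2 first.
- by move=> w _; apply: integral_ge0.
- by move=> w _; rewrite lee_fin mulr_ge0 ?(ltW hp) ?lsqr_ge0.
apply: (@le_trans _ _ (\int[P]_w ((ltrunc K (pos h sigma x j w))%:E + cst c%:E w))%E).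
  apply: ge0_le_integral => //.
  - move=> w _; apply: adde_ge0; first exact: integral_ge0.
    by rewrite lee_fin mulr_ge0 ?(ltW hp) ?lsqr_ge0.
  - exact: emeasurable_funD.
  - exact: emeasurable_funD.
  - by move=> w _; rewrite /= -EFinD; exact: hstep.
rewrite ge0_integralD//; last by move=> w _; rewrite lee_fin ltrunc_ge0.
by rewrite integral_cst// [X in (_ * X)%E](probability_setT P) mule1.
Qed.

End energy_mean.

(** * Mean energy of the flow *)

Section energy_bound.
Context {R : realType} {d : nat}.
Local Notation Omega := (wiener_space R 1).
Variables (P : probability (borel Omega) R) (hP : is_wiener_measure P).
Variables (sigma : R) (phi : R -> Omega -> 'rV[R]_d -> 'rV[R]_d).
Hypotheses (hphi : is_sde_rds sigma phi) (hsigma : 0 < sigma <= 1 / 2).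
Variables (j0 : 'I_d) (j00 : j0 = 0%N :> nat).
Variables (p : 'rV[R]_d) (hp : forall i : 'I_d, (1 <= i)%N -> p 0 i = 0).

Lemma measurable_euler_energy K T N :
  measurable_fun [set: borel Omega] (euler_energy j0 sigma p K T N : borel Omega -> R).
Proof.
apply: measurable_funM => //; apply: measurable_sum => j.
apply: (measurableT_comp (measurable_lsqr K)).
exact: (measurableT_comp (@measurable_euler1 _ (T / N%:R) sigma (p 0 j0) j j (leqnn j))
  (@measurable_incr R 1 j 0 (T / N%:R))).
Qed.

Lemma euler_energy_mean (K T e : R) : 0 < K -> 0 < T -> 0 < e ->
  \forall N \near \oo, (\int[P]_w (euler_energy j0 sigma p K T N w)%:E <=
    (lyap (p 0 j0) + T * (1 - sigma ^+ 2 / 5 + e))%:E)%E.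
Proof.
move=> K0 T0 e0; have [h0 h00 H] := euler_drift hP hsigma K0 e0.
apply: filterS2 (nbhs_infty_gtr (T / h0)) (nbhs_infty_gt 0) => N h1 N0.
set h := T / N%:R in H *.
have hh : 0 < h < h0.
  by rewrite divr_gt0 ?ltr0n//= /h ltr_pdivrMr ?ltr0n// mulrC -ltr_pdivrMr.
have TE : N%:R * h = T by rewrite /h mulrCA divff ?mulr1// pnatr_eq0 -lt0n.
have := H h hh (p 0 j0) N; rewrite mulrA TE; apply: le_trans.
under eq_integral do rewrite /euler_energy -/h mulr_sumr -sumEFin.
rewrite ge0_integral_sum//.
- by rewrite leeDr// integral_ge0// => w _; rewrite lee_fin ltrunc_ge0.
- move=> j; apply/measurable_EFinP; apply: measurable_funM => //.
  apply: (measurableT_comp (measurable_lsqr K)).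
  exact: (measurableT_comp (@measurable_euler1 _ h sigma (p 0 j0) j j (leqnn j))
    (@measurable_incr R 1 j 0 h)).
- move=> j w _; rewrite lee_fin mulr_ge0 ?lsqr_ge0//.
  by case/andP: hh => /ltW.
Qed.

Lemma energy_ge0 w (T : R) : 0 <= T -> 0 <= energy phi p w T.
Proof.
move=> T0; have [ct _] := sde_sol w p hphi; have cs := sqn_continuous ct.
have H t : 0 <= t <= T -> is_derive t 1 (energy phi p w) (sqn (traj phi w p t)).
  by move=> /andP[t0 _]; exact: is_derive_prim.
have := derive_ndecr T0 H; rewrite {1}/energy prim0//; apply => t _; exact: sqn_ge0.
Qed.

(** The admissible mesh depends on the truncation level, so [N k] is chosen after [K k]; requiring k
    <= N k makes both tend to infinity. *)
Lemma energy_approx (T e : R) : 0 < T -> 0 < e -> exists K : nat -> R, exists N : nat -> nat,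
  (forall w : Omega, euler_energy j0 sigma p (K k) T (N k) w @[k --> \oo] --> energy phi p w T) /\
  forall k, (\int[P]_w (euler_energy j0 sigma p (K k) T (N k) w)%:E <=
    (lyap (p 0 j0) + T * (1 - sigma ^+ 2 / 5 + e))%:E)%E.
Proof.
move=> T0 e0; pose K (k : nat) : R := k.+1%:R.
have K0 k : 0 < K k by rewrite ltr0n.
have /choice[N hN] : forall k, exists N, (k <= N)%N /\
    (\int[P]_w (euler_energy j0 sigma p (K k) T N w)%:E <=
    (lyap (p 0 j0) + T * (1 - sigma ^+ 2 / 5 + e))%:E)%E.
  move=> k; have [M _ hM] := euler_energy_mean (K0 k) T0 e0.
  by exists (maxn k M); split; [exact: leq_maxl|apply: hM; exact: leq_maxr].
exists K, N; split => [w|k]; last by have [] := hN k.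
apply: (euler_energy_cvg j00 hphi hp) => // A.
  apply: filterS (nbhs_infty_ger A) => k /le_trans; apply.
  by rewrite /K ler_nat.
apply: filterS (nbhs_infty_ge A) => k /leq_trans; apply.
by have [] := hN k.
Qed.

Lemma measurable_energy T : 0 < T ->
  measurable_fun [set: borel Omega] ((fun w => energy phi p w T) : borel Omega -> R).
Proof.
move=> T0; have [K [N [hKN _]]] := energy_approx T0 ltr01.
apply: (@measurable_fun_cvg _ (borel Omega) R setT (fun k => euler_energy j0 sigma p (K k) T (N k))).
  by move=> k; exact: measurable_euler_energy.
by move=> w _; exact: hKN.
Qed.

Lemma energy_mean (T e : R) : 0 < T -> 0 < e ->
  (\int[P]_w (energy phi p w T)%:E <= (lyap (p 0 j0) + T * (1 - sigma ^+ 2 / 5 + e))%:E)%E.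
Proof.
move=> T0 e0; have [K [N [hKN hb]]] := energy_approx T0 e0.
pose f k (w : borel Omega) := (euler_energy j0 sigma p (K k) T (N k) w)%:E.
have mf k : measurable_fun setT (f k) by apply/measurable_EFinP; exact: measurable_euler_energy.
have f0 k w : [set: borel Omega] w -> (0 <= f k w)%E.
  move=> _; rewrite lee_fin mulr_ge0 ?divr_ge0 ?(ltW T0)//.
  by apply: sumr_ge0 => j _; exact: lsqr_ge0.
have := @fatou _ (borel Omega) R P setT measurableT f mf f0.
rewrite (eq_integral (fun w : borel Omega => (energy phi p w T)%:E)); last first.
  move=> w _; have L : f^~ w @ \oo --> (energy phi p w T)%:E.
    apply: cvg_EFin; [by near=> k|exact: hKN].
  by rewrite is_cvg_limn_einfE; [exact: cvg_lim|apply/cvg_ex; eexists; exact: L].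
move=> /le_trans; apply; rewrite limn_einf_lim; apply: lime_le.
  exact: is_cvg_einfs.
near=> k; apply: le_trans (hb k).
by apply: ereal_inf_lbound; exists k => /=.
Unshelve. all: by end_near. Qed.

End energy_bound.

Section one_dimensional_noise.
Context {R : realType} {d : nat}.
Local Notation Omega := (wiener_space R 1).
Variables (P : probability (borel Omega) R) (hP : is_wiener_measure P).
Variables (sigma : R) (phi : R -> Omega -> 'rV[R]_d -> 'rV[R]_d).
Hypotheses (hphi : is_sde_rds sigma phi) (hsigma : 0 < sigma <= 1 / 2).
Variables (i0 j0 : 'I_d) (j00 : j0 = 0%N :> nat) (hi0 : (1 <= i0)%N).

Lemma energy_average (p : 'rV[R]_d) (e : R) :
  (forall i : 'I_d, (1 <= i)%N -> p 0 i = 0) -> 0 < e ->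
  \forall m \near \oo, (\int[P]_w (m.+1%:R^-1 * energy phi p w m.+1%:R)%:E <=
    (1 - sigma ^+ 2 / 5 + e)%:E)%E.
Proof.
move=> hp e0; have e2 : 0 < e / 2 by rewrite divr_gt0.
near=> m; have m0 : 0 < m.+1%:R :> R by rewrite ltr0n.
under eq_integral do rewrite EFinM.
rewrite ge0_integralZl//; last 2 first.
- by apply/measurable_EFinP; exact: (measurable_energy hP hphi hsigma j00 hp).
- by move=> w _; rewrite lee_fin (energy_ge0 hphi)// ltW.
apply: le_trans (lee_wpmul2l _ (energy_mean hP hphi hsigma j00 hp m0 e2)) _.
  by rewrite lee_fin.
rewrite -EFinM lee_fin mulrDr mulKf ?lt0r_neq0//.
have : m.+1%:R^-1 * lyap (p 0 j0) <= e / 2.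
  rewrite mulrC ler_pdivrMr// -ler_pdivrMl//.
  apply: (@le_trans _ _ m%:R); last by rewrite ler_nat.
  by near: m; exact: nbhs_infty_ger.
by set u := _ * lyap _; lra.
Unshelve. all: by end_near. Qed.

(** Start at the origin. Pathwise energy / m = 1 - growth / m, and growth / m is at most the
    separation bound, so the sum of energy / m and that bound is at least 1; with c = sigma^2 / 5
    its mean is eventually at most 1 - c + c/4 + c/4. *)
Lemma no_weak_sync_1 : ~ weak_synchronization P phi.
Proof.
move=> ws; pose p : 'rV[R]_d := 0.
have hp (i : 'I_d) : (1 <= i)%N -> p 0 i = 0 by rewrite mxE.
pose c := sigma ^+ 2 / 5; have c0 : 0 < c by rewrite divr_gt0// exprn_gt0//; case/andP: hsigma.
have c4 : 0 < c / 4 by rewrite divr_gt0.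
pose f m w := m.+1%:R^-1 * energy phi p w m.+1%:R + separation_bound phi i0 p m.+1 w.
have mE m : measurable_fun [set: borel Omega]
    ((fun w => m.+1%:R^-1 * energy phi p w m.+1%:R) : borel Omega -> R).
  apply: measurable_funM => //.
  by apply: (measurable_energy hP hphi hsigma j00 hp); rewrite ltr0n.
have E0 m w : 0 <= m.+1%:R^-1 * energy phi p w m.+1%:R.
  by rewrite mulr_ge0// (energy_ge0 hphi).
have : 1 <= 1 - c / 2.
  apply: (@eventually_ge_integral _ (borel Omega) R P f) => //.
  - by move=> m; apply: measurable_funD => //; exact: (measurable_separation_bound hphi).
  - by move=> m w; rewrite addr_ge0// separation_bound_ge0.
  - apply/aeW => w; near=> m.
    have := growth_le_bound hphi hi0 (hp _ hi0) m.+1 w.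
    rewrite /f (energy_growth hphi p w (ler0n _ m.+1)) mulrBr mulVf ?pnatr_eq0//.
    by set u := _ * growth _ _; lra.
  - have h1 := energy_average hp c4.
    have h2 := sync_separation_bound hphi hP hi0 (hp _ hi0) ws c4.
    near=> m.
    under eq_integral do rewrite EFinD.
    rewrite ge0_integralD//; last 4 first.
    + by move=> w _; rewrite lee_fin.
    + by apply/measurable_EFinP; exact: mE.
    + by move=> w _; rewrite lee_fin separation_bound_ge0.
    + by apply/measurable_EFinP; exact: (measurable_separation_bound hphi).
    apply: le_trans (leeD _ _) _.
    + near: m; exact: h1.
    + near: m; move: h2 => [N _ h2]; exists N => // m /= Nm; apply: h2; exact: leqW.
    + by rewrite -EFinD lee_fin /c; lra.
lra.
Unshelve. all: by end_near. Qed.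

End one_dimensional_noise.

(** * The derivative of the flow on the noise axis *)

Section row_norm.
Context {R : realType} {d : nat}.
Implicit Types x : 'rV[R]_d.

Lemma norm_rV_le x (e : R) : 0 <= e -> (forall i, `|x 0 i| <= e) -> `|x| <= e.
Proof.
move=> e0 hx; rewrite [`|x|]/Num.norm/= mx_normrE; apply: bigmax_le => // -[i j] _ /=.
by rewrite ord1.
Qed.

Lemma coord_le_norm x i : `|x 0 i| <= `|x|.
Proof.
rewrite [in leRHS]/Num.norm/= mx_normrE.
exact: (le_bigmax 0 (fun ij : 'I_1 * 'I_d => `|x ij.1 ij.2|) (0, i)).
Qed.

Lemma sqn_le_norm x : sqn x <= d%:R * `|x| ^+ 2.
Proof.
rewrite /sqn -[d in d%:R]card_ord -sumr_const mulr_suml; apply: ler_sum => i _.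
by rewrite mul1r -(real_normK (num_real (x 0 i))) lerXn2r ?nnegrE// coord_le_norm.
Qed.

Lemma near_sqn (e : R) : 0 < e -> \forall x \near (0 : 'rV[R]_d), sqn x <= e.
Proof.
move=> e0; have cs : continuous (@sqn R d) by exact: (@sqn_continuous _ _ _ id (fun x => cvg_id)).
have /cvgrPdist_le/(_ e e0) := cs 0.
rewrite (_ : sqn 0 = 0); last by rewrite /sqn big1// => i _; rewrite mxE expr0n.
by apply: filterS => x; rewrite sub0r normrN; exact: le_trans (ler_norm _).
Qed.

End row_norm.

Lemma expR_close {R : realType} (x e : R) : 0 < e ->
  exists2 e1, 0 < e1 & forall y, `|y - x| <= e1 -> `|expR y - expR x| <= e.
Proof.
move=> e0; have /cvgrPdist_le/(_ e e0)/nbhs_ballP[e1 /= e10 H] := @continuous_expR R x.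
exists (e1 / 2); first by rewrite divr_gt0.
move=> y yx; rewrite distrC; apply: H; rewrite /ball/= distrC.
by apply: le_lt_trans yx _; rewrite ltr_pdivrMr// mulr_natr mulr2n ltrDl.
Qed.

Section axis_derivative.
Context {R : realType} {d : nat}.
Local Notation Omega := (wiener_space R 1).
Variables (sigma : R) (phi : R -> Omega -> 'rV[R]_d -> 'rV[R]_d).
Hypothesis hphi : is_sde_rds sigma phi.
Variables (j0 : 'I_d) (j00 : j0 = 0%N :> nat).
Variables (p : 'rV[R]_d) (hp : forall i : 'I_d, (1 <= i)%N -> p 0 i = 0).
Implicit Types (h : 'rV[R]_d) (w : Omega).

(** Both sides are the sum over the coordinates off the axis, where [x] vanishes. *)
Lemma sqnB_axis (z x : 'rV[R]_d) : (forall i : 'I_d, (1 <= i)%N -> x 0 i = 0) ->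
  sqn z - z 0 j0 ^+ 2 = sqn (z - x) - (z 0 j0 - x 0 j0) ^+ 2.
Proof.
move=> hx; rewrite /sqn (bigD1 j0)//= [in RHS](bigD1 j0)//= !mxE.
rewrite [LHS]addrC addKr [RHS]addrC addKr; apply: eq_bigr => i ij.
rewrite !mxE hx ?subr0// lt0n; apply: contra ij => /eqP iz.
by apply/eqP/val_inj; rewrite /= iz j00.
Qed.

Lemma cubic_remainder (B F v X U s : R) : 0 <= B -> 0 <= F -> `|X| <= B -> `|U| <= F ->
  U ^+ 2 <= v -> 0 <= s <= v ->
  `|3 * X * U ^+ 2 + U ^+ 3 + s * (X + U)| <= (4 * B + 2 * F) * v.
Proof.
move=> B0 F0 XB UF Uv /andP[s0 sv].
have v0 : 0 <= v by exact: le_trans sv.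
have h1 : `|3 * X * U ^+ 2| <= 3 * B * v.
  rewrite normrM (ger0_norm (sqr_ge0 U)) normrM (@ger0_norm _ 3)//.
  by apply: ler_pM => //; [exact: sqr_ge0|rewrite ler_pM2l].
have h2 : `|U ^+ 3| <= F * v.
  rewrite exprS normrM (ger0_norm (sqr_ge0 U)); apply: ler_pM => //; exact: sqr_ge0.
have h3 : `|s * (X + U)| <= v * (B + F).
  rewrite normrM (ger0_norm s0); apply: ler_pM => //.
  by apply: le_trans (ler_normD _ _) _; exact: lerD.
have := ler_normD (3 * X * U ^+ 2 + U ^+ 3) (s * (X + U)).
have := ler_normD (3 * X * U ^+ 2) (U ^+ 3).
lra.
Qed.

(* On the noise axis the first coordinate [U] of the difference of two solutions
   satisfies [U' = (1 - 3 x^2) U - r] with [r] quadratic in the difference. *)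
Lemma axis_remainder w (T : R) : 0 <= T -> exists a C : R, 0 <= C /\
  forall h, sqn h <= 1 ->
    `|phi T w (h + p) 0 j0 - phi T w p 0 j0 - a * h 0 j0| <= C * sqn h.
Proof.
move=> T0; pose x := traj phi w p; have sx := sde_sol w p hphi; have [cx hx] := sx.
have ax (t : R) : 0 <= t -> forall i : 'I_d, (1 <= i)%N -> x t 0 i = 0.
  by move=> t0 i i1; exact: (traj_axis hphi hp).
have cX : continuous (fun t => x t 0 j0).
  by move=> t; apply: (@continuous_comp _ _ _ x (fun u : 'rV[R]_d => u 0 j0)); [exact: cx|exact: coord_continuous].
pose g (t : R) := 1 - 3 * x t 0 j0 ^+ 2.
have cg : continuous g.
  move=> t; apply: cvgB; first exact: cvg_cst.
  apply: cvgM; first exact: cvg_cst.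
  by apply: (@continuous_comp _ _ _ (fun t => x t 0 j0) (fun u => u ^+ 2)); [exact: cX|exact: exprn_continuous].
pose G := prim g.
have [B0 hB0] := segment_bounded T (sqn_continuous cx).
pose B := 1 + `|B0|; have B1 : 1 <= B by rewrite lerDl.
have Bp : 0 <= B by exact: le_trans B1.
have hB (t : R) : 0 <= t <= T -> `|x t 0 j0| <= B.
  move=> tT; have := hB0 t tT; have := ler_sqn (x t) j0; have := ler_norm B0.
  rewrite /B -[x t 0 j0 ^+ 2]real_normK ?num_real//.
  have := normr_ge0 (x t 0 j0); rewrite /x; nra.
pose F := expR (2 * T).
have F1 : 1 <= F by rewrite /F -expR0 ler_expR mulr_ge0.
have Fp : 0 <= F by exact: le_trans F1.
exists (expR (G T)), (T * expR T * ((4 * B + 2 * F) * F)); split.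
  by rewrite !mulr_ge0 ?expR_ge0 ?addr_ge0 ?mulr_ge0.
move=> h h1; pose z := traj phi w (h + p).
have sz := sde_sol w (h + p) hphi; have [cz hz] := sz.
have [u [_ du uE]] := hz j0; have [v [_ dv vE]] := hx j0.
pose U (t : R) := u t - v t.
have UE (t : R) : 0 <= t -> U t = z t 0 j0 - x t 0 j0.
  by move=> t0; rewrite /U /z /x uE// vE//; ring.
pose s (t : R) := sqn (z t) - z t 0 j0 ^+ 2.
pose r (t : R) := 3 * x t 0 j0 * U t ^+ 2 + U t ^+ 3 + s t * (x t 0 j0 + U t).
have dU (t : R) : 0 <= t -> is_derive t 1 U (g t * U t - r t).
  move=> t0; apply: (is_derive_eq (is_deriveB (du t t0) (dv t t0))).
  rewrite !driftE -/z -/x (sqn_axis j00 (ax t t0)) /r /s /g.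
  have -> : z t 0 j0 = x t 0 j0 + U t by rewrite UE//; ring.
  by ring.
have rB (t : R) : 0 <= t <= T -> `|r t| <= (4 * B + 2 * F) * F * sqn h.
  move=> tT; have t0 : 0 <= t by case/andP: tT.
  have vh : sqn (z t - x t) <= F * sqn h.
    have := gap_expR hphi w p (h + p) tT.
    by rewrite addrK /gap /z /x /traj max_l// mulrC.
  have Uv : U t ^+ 2 <= sqn (z t - x t).
    by have := ler_sqn (z t - x t) j0; rewrite !mxE UE.
  rewrite -mulrA; apply: le_trans (ler_wpM2l _ vh); last by rewrite addr_ge0 ?mulr_ge0.
  apply: cubic_remainder => //; first exact: hB.
    have : U t ^+ 2 <= F.
      by apply: le_trans Uv _; apply: le_trans vh _; rewrite ger_pMr// (lt_le_trans ltr01 F1).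
    rewrite -[U t ^+ 2]real_normK ?num_real// => UF.
    rewrite -(@ler_pXn2r _ 2)// ?nnegrE//; apply: le_trans UF _.
    by rewrite expr2 ler_peMr.
  rewrite /s (sqnB_axis _ (ax t t0)) -UE// subr_ge0 Uv/=.
  by rewrite gerBl sqr_ge0.
have dG (t : R) : 0 <= t -> is_derive t 1 G (g t) by move=> t0; exact: is_derive_prim.
(* Variation of constants: the factor exp (- G) removes the linear part, and the mean value theorem
   on [0, T] leaves a single value of [r]. *)
have dW (t : R) : 0 <= t <= T -> is_derive t 1 (fun t => U t * expR (- G t)) (- r t * expR (- G t)).
  move=> /andP[t0 _].
  have k := is_derive_expR_comp (is_deriveN (dG t t0)).
  apply: (is_derive_eq (is_deriveM (dU t t0) k)).
  by rewrite /GRing.scale/=; ring.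
have [c cT] := derive_mvt T0 dW.
have c0 : 0 <= c by case/andP: cT.
have cT' : c <= T by case/andP: cT.
rewrite UE// UE// /z /x (traj0 _ _ hphi) (traj0 _ _ hphi) -/z -/x {2}/G prim0// oppr0 expR0 mulr1.
rewrite [(h + p) 0 j0]mxE addrK addr0 => E.
have GT : G T - G c <= T.
  have [e _ ->] := @derive_mvt _ G g c T cT' (fun t ht => dG t (le_trans c0 (proj1 (andP ht)))).
  have g1 : g e <= 1 by rewrite /g gerBl mulr_ge0 ?sqr_ge0.
  have Tc : 0 <= T - c by rewrite subr_ge0.
  apply: le_trans (ler_wpM2r Tc g1) _; rewrite mul1r gerBl//.
have zT q : phi T w q = traj phi w q T by rewrite /traj max_l.
rewrite !zT -/z -/x.
have -> : z T 0 j0 - x T 0 j0 - expR (G T) * h 0 j0 = - (r c * (T * expR (G T - G c))).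
  have ->: z T 0 j0 - x T 0 j0 = expR (G T) * ((z T 0 j0 - x T 0 j0) * expR (- G T)).
    by rewrite mulrCA -expRD subrr expR0 mulr1.
  by rewrite -mulrBr E expRD; ring.
rewrite normrN normrM (ger0_norm (mulr_ge0 T0 (expR_ge0 _))).
have h2 : T * expR (G T - G c) <= T * expR T by rewrite ler_wpM2l// ler_expR.
rewrite -(mulrA (T * expR T)) mulrC; apply: ler_pM => //.
- by rewrite mulr_ge0 ?expR_ge0.
- exact: rB.
Qed.

Variables (i0 : 'I_d) (hi0 : (1 <= i0)%N).

Lemma coord_axis w (T : R) h (i : 'I_d) : 0 <= T -> (1 <= i)%N ->
  phi T w (h + p) 0 i = h 0 i * expR (growth (traj phi w (h + p)) T).
Proof.
move=> T0 i1.
have := @coord_growth _ _ _ _ _ (sde_sol w (h + p) hphi) i T.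
rewrite [(h + p) 0 i]mxE (hp i1) addr0 /traj max_l//; apply => // s.
by rewrite mxE pad_out// mulr0.
Qed.

(** Existence of the differential has to be proved, so the whole diagonal map is exhibited. Along
    the axis the entry is [a], with quadratic error; elsewhere coordinate i of the difference is
    exactly h_i exp (growth at h + p), and growth is continuous in the starting point. *)
Lemma diff_axis w (T : R) : 0 <= T ->
  'd (phi T w) p (delta_mx 0 i0) = expR (growth (traj phi w p) T) *: delta_mx 0 i0.
Proof.
move=> T0; have [a [C [C0 hC]]] := axis_remainder w T0.
set b := expR (growth (traj phi w p) T).
pose D : 'rV[R]_d := \row_i (if i == j0 then a else b).
pose L : {linear 'rV[R]_d -> 'rV[R]_d} := mulmxr (diag_mx D).
have LE h i : L h 0 i = h 0 i * (if i == j0 then a else b) by rewrite /= mul_mx_diag !mxE.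
rewrite (_ : 'd (phi T w) p = L :> (_ -> _)); last first.
  apply: diff_unique.
    apply: mx_continuous => i j x; rewrite ord1.
    rewrite (_ : (fun x => _) = (fun h : 'rV[R]_d => h 0 j * (if j == j0 then a else b))); last first.
      by apply/funext => h; rewrite LE.
    exact: (cvgM (@coord_continuous R 1 d 0 j x) (cvg_cst _)).
  apply/eqaddoP => e /= e0.
  have [e1 e10 he1] := expR_close (growth (traj phi w p) T) e0.
  have [dl dl0 hdl] := growth_close hphi w p T0 e10.
  have Cd : 0 < C * d%:R + 1 by rewrite ltr_wpDl// mulr_ge0.
  have near_norm := @nbhs0_le _ 'rV[R]_d _ (divr_gt0 e0 Cd).
  near=> h.
  apply: norm_rV_le => [|i]; first by rewrite mulr_ge0// ltW.
  have hi := coord_le_norm h i.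
  have -> : (phi T w \o +%R^~ p - (cst (phi T w p) + L)) h 0 i =
      phi T w (h + p) 0 i - phi T w p 0 i - L h 0 i :> R.
    by rewrite !fctE /= !mxE; ring.
  rewrite LE; case: ifPn => [/eqP ->|ij].
    rewrite [h 0 j0 * a]mulrC; apply: le_trans (hC h _) _; first by near: h; exact: near_sqn.
    have hd : C * d%:R * `|h| <= e.
      have : `|h| <= e / (C * d%:R + 1).
        by near: h.
      rewrite ler_pdivlMr//.
      by have := normr_ge0 h; lra.
    apply: le_trans (ler_wpM2l C0 (sqn_le_norm h)) _.
    by rewrite mulrA expr2 mulrA ler_wpM2r.
  have i1 : (1 <= i)%N.
    rewrite lt0n; apply: contra ij => /eqP iz.
    by apply/eqP/val_inj; rewrite /= iz j00.
  have := coord_axis w 0 T0 i1; rewrite add0r mxE mul0r => ->.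
  rewrite coord_axis// subr0 -mulrBr normrM mulrC; apply: ler_pM => //.
  apply: he1; apply: hdl; rewrite addrK.
  by near: h; exact: near_sqn.
apply/rowP => i; rewrite LE !mxE !eqxx/=.
have [->|_] := eqVneq i i0; last by rewrite mul0r mulr0.
rewrite mul1r mulr1 ifN//; apply/eqP => E.
by move: hi0; rewrite E j00.
Unshelve. all: by end_near. Qed.

Lemma lyapunov_quotient_axis w m : lyapunov_quotient phi w p (delta_mx 0 i0) m =
  m%:R^-1 * growth (traj phi w p) m%:R.
Proof.
rewrite /lyapunov_quotient diff_axis// /enorm -/(sqn _) sqnZ sqn_delta mulr1.
by rewrite sqrtr_sqr ger0_norm ?expR_ge0// expRK.
Qed.

End axis_derivative.

(** If the top exponent were at most 0, every exponent would be, and the exact derivative would give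
    growth / m <= c / 4 eventually; then energy / m >= 1 - c / 4, against a mean of at most 1 - c +
    c / 4. *)
Lemma top_exponent_gt0 (R : realType) (d : nat)
    (P : probability (borel (wiener_space R 1)) R) (sigma : R)
    (phi : R -> wiener_space R 1 -> 'rV[R]_d -> 'rV[R]_d)
    (rho : probability (borel 'rV[R]_d) R) (i0 j0 : 'I_d) (lambda : R) :
  is_wiener_measure P -> is_sde_rds sigma phi -> 0 < sigma <= 1 / 2 ->
  is_rho 1 sigma rho -> j0 = 0%N :> nat -> (1 <= i0)%N ->
  is_top_lyapunov_exponent P rho phi lambda -> 0 < lambda.
Proof.
move=> hP hphi hsigma hrho j00 hi0 [s [ss /(rho_point hrho)[p hp hs]]].
pose c := sigma ^+ 2 / 5.
have c0 : 0 < c by rewrite divr_gt0// exprn_gt0//; case/andP: hsigma.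
have c4 : 0 < c / 4 by rewrite divr_gt0.
have c1 : c <= 1.
  case/andP: hsigma => s0 s1.
  by rewrite /c ler_pdivrMr// mul1r; nra.
rewrite ltNge; apply/negP => l0.
pose f m w := m.+1%:R^-1 * energy phi p w m.+1%:R.
have : 1 - c / 4 <= 1 - c + c / 4.
  apply: (@eventually_ge_integral _ (borel (wiener_space R 1)) R P f) => //.
  - by lra.
  - move=> m; apply: measurable_funM => //.
    by apply: (measurable_energy hP hphi hsigma j00 hp); rewrite ltr0n.
  - by move=> m w; rewrite mulr_ge0// (energy_ge0 hphi).
  - have [N [mN N0 hN]] := hs; exists N; split => // w /= hw; apply: hN => /= -[h1 _]; apply: hw.
    have v0 : delta_mx 0 i0 != 0 :> 'rV[R]_d.
      apply/eqP => /rowP/(_ i0)/eqP; rewrite !mxE !eqxx/=; exact/negP/oner_neq0.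
    have [l ls L] := h1 _ v0.
    have l1 : l <= 0.
      apply: le_trans l0; move: ls; rewrite inE => /predU1P[->//|ls].
      have /allP/(_ _ ls)/ltW := order_path_min (rev_trans lt_trans) ss; exact.
    have /cvgrPdist_le/(_ _ c4)[M _ hM] := L.
    exists M => // m /= Mm; have := hM m.+1 (leqW Mm).
    rewrite (lyapunov_quotient_axis hphi j00 hp hi0).
    rewrite /f (energy_growth hphi p w (ler0n _ m.+1)) mulrBr mulVf ?pnatr_eq0//.
    by set u := _ * growth _ _ => /ler_normlP[+ _]; lra.
  - exact: (energy_average hP hphi hsigma j00 hp c4).
by clearbody c; lra.
Qed.

Theorem theorem6p2 (R : realType) (d n : nat) (hn : (0 < n)%N) (hnd : (n < d)%N)
    (sigma : R) (hsigma : 0 < sigma)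
    (P : probability (borel (wiener_space R n)) R) (hP : is_wiener_measure P)
    (phi : R -> wiener_space R n -> 'rV[R]_d -> 'rV[R]_d)
    (hphi : is_sde_rds sigma phi)
    (rho : probability (borel 'rV[R]_d) R) (hrho : is_rho n sigma rho) :
  (forall lambda_top : R, is_top_lyapunov_exponent P rho phi lambda_top ->
     0 < lambda_top ->
     ~ synchronization P phi /\ ~ weak_synchronization P phi) /\
  (n = 1%N -> sigma <= 1 / 2 ->
     (forall lambda_top : R, is_top_lyapunov_exponent P rho phi lambda_top ->
        0 < lambda_top) /\
     ~ synchronization P phi /\ ~ weak_synchronization P phi).
Proof.
have both : ~ weak_synchronization P phi ->
    ~ synchronization P phi /\ ~ weak_synchronization P phi.
  by move=> h; split => // /synchronization_weak.
(* Index n is the first coordinate without noise. *)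
pose i0 := Ordinal hnd; split.
  move=> l hl l0; apply: both.
  exact: (positive_exponent_no_sync hphi hP hrho (i0 := i0) (leqnn n) hl l0).
move=> n1 s2; subst n; have hs : 0 < sigma <= 1 / 2 by rewrite hsigma.
pose j0 : 'I_d := Ordinal (ltnW hnd).
split; last by apply: both; exact: (no_weak_sync_1 hP hphi hs (i0 := i0) (j0 := j0)).
by move=> l; exact: (top_exponent_gt0 hP hphi hs hrho (i0 := i0) (j0 := j0)).
Qed.
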